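(* Let $\beta\in(0,\infty)$ be such that, for some constant $C>0$, $\ell^q\geq C\,\|q+1\|_\infty^{-a\beta}$ for all $q\in\mathbb{N}^V$. Assume that $2a\beta<1$ and that $Q^N(0)\to q^0$ as $N\to+\infty$ for some $q^0\in(0,+\infty)^V$. Then $Q^N(\cdot)$ converges in probability to $q^*(\cdot,q^0)$ as $N\to+\infty$, uniformly over compact subsets of $[0,T_{\rm ext}(q^0))$; that is, for every $0<T<T_{\rm ext}(q^0)$ and every $\delta>0$, $\mathbb{P}\big(\sup_{0\le t\le T}\|Q^N(t)-q^*(t,q^0)\|_\infty\geq\delta\big)\to 0$ as $N\to+\infty$.
   Context: Model. $V$ is a finite set, $n=|V|$, and $G=(V,E)$ is a simple undirected graph; $v\sim w$ means $\{v,w\}\in E$. $S(G)=\{\sigma\in\{0,1\}^V:\ \sigma_v+\sigma_w\le 1 \text{ whenever } v\sim w\}$. Fix $a>0$ and $\lambda=(\lambda_v)_{v\in V}$ with $\lambda_v>0$. For $x\in\mathbb{N}=\{0,1,\dots\}$ put $\Psi_+(x)=\frac{(x+1)^a}{1+(x+1)^a}$, $\Psi_-(x)=1-\Psi_+(x)$. Let $e^v$ be the $v$th unit vector. $(Q(t),\sigma(t))_{t\ge0}$ is the continuous-time Markov process on $\mathbb{N}^V\times S(G)$ with the following transitions from $(q,\sigma)$, for each $v\in V$: $q\to q+e^v$ at rate $\lambda_v$; $q\to q-e^v$ at rate $\sigma_v\mathbf{1}_{q_v>0}$; $\sigma\to\sigma-e^v$ at rate $\sigma_v\Psi_-(q_v)$;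 $\sigma\to\sigma+e^v$ at rate $(1-\sigma_v)\prod_{w\sim v}(1-\sigma_w)\,\Psi_+(q_v)$. For each $N\ge1$ one takes such a process, whose initial state may depend on $N$ (this dependence is not written), and sets $Q^N(t)=Q(Nt)/N$, $\sigma^N(t)=\sigma(Nt)$. Spectral gap. For $q\in\mathbb{N}^V$, $L_{\rm f}^q$ is the generator on functions $h:S(G)\to\mathbb{R}$, $L_{\rm f}^q[h](\sigma)=\sum_v\sigma_v\Psi_-(q_v)(h(\sigma-e^v)-h(\sigma))+\sum_v(1-\sigma_v)\prod_{w\sim v}(1-\sigma_w)\Psi_+(q_v)(h(\sigma+e^v)-h(\sigma))$; it has a unique reversible distribution, and $\ell^q$ is its spectral gap (smallest nonzero eigenvalue of $-L_{\rm f}^q$). $\|q+1\|_\infty=\max_v(q_v+1)$. Limit. $|\sigma|=\sum_v\sigma_v$, $\Upsilon=\max_{\sigma\in S(G)}|\sigma|$, $S^*=\{\sigma\in S(G):|\sigma|=\Upsilon\}$. For $q\in(0,\infty)^V$, $\overline{\pi}^q(v)=\sum_{\sigma\in S^*}\sigma_v\frac{\prod_{w}q_w^{a\sigma_w}}{\sum_{\rho\in S^*}\prod_{w}q_w^{a\rho_w}}$ and $g(q)=\lambda-\overline{\pi}^q$. For $q^0\in(0,\infty)^V$, $q^*(\cdot,q^0)$ is the maximal solution with values in $(0,\infty)^V$ of $f'=g(f)$, $f(0)=q^0$ (restricted to nonnegative times), and $T_{\rm ext}(q^0)\in(0,+\infty]$ is the supremum of its maximal interval of definition. *)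

(* Defs.v *)
From HB Require Import structures.
From mathcomp Require Import all_boot all_order all_algebra.
From mathcomp Require Import all_classical all_reals all_analysis.
Set Implicit Arguments.
Unset Strict Implicit.
Unset Printing Implicit Defensive.
Import Order.TTheory GRing.Theory Num.Theory.
Import numFieldNormedType.Exports.
Local Open Scope classical_set_scope.
Local Open Scope ring_scope.

Section Markov_jump_processes.
Context {R : realType} {T : countType}.

(* [p t x y] is the transition function with jump rates [r x y] (x != y). The
   two [rate] conditions say that its Q-matrix is stable and conservative with
   off-diagonal entries [r]; the values [r x x] are irrelevant. When the total
   jump rates are bounded, these conditions determine [p t] for t >= 0. *)
Record transition_function (r : T -> T -> R) (p : R -> T -> T -> R) : Prop := {
  tf_ge0 : forall t x y, 0 <= t -> 0 <= p t x y;
  tf_sum1 : forall t x, 0 <= t ->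
    \esum_(y in [set: T]) (p t x y)%:E = 1%E;
  tf_0 : forall x y, p 0 x y = (x == y)%:R;
  tf_add : forall s t x z, 0 <= s -> 0 <= t ->
    (p (s + t) x z)%:E = \esum_(y in [set: T]) (p s x y * p t y z)%:E;
  tf_rate : forall x y, x != y -> p h x y / h @[h --> 0^'+] --> r x y;
  tf_rate_diag : forall x,
    ((1 - p h x x) / h)%:E @[h --> 0^'+]
      --> \esum_(y in [set y | y != x]) (r x y)%:E
}.

(* The values of [X] at negative times are irrelevant. Paths are right-continuous
   with left limits for the discrete topology on [T], and the Markov property is
   expressed by finite-dimensional distributions; the initial law is arbitrary. *)
Record markov_jump_process d (Om : measurableType d) (P : probability Om R)
    (r : T -> T -> R) (X : R -> Om -> T) : Prop := {
  mjp_measurable : forall t x, 0 <= t -> measurable (X t @^-1` [set x]);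
  mjp_right : forall w t, 0 <= t -> \forall s \near t^'+, X s w = X t w;
  mjp_left : forall w t, 0 < t ->
    exists x, \forall s \near t^'-, X s w = x;
  mjp_markov : exists2 p, transition_function r p &
    forall (n : nat) (t : nat -> R) (x : nat -> T),
      0 <= t 0%N -> (forall i, (i <= n)%N -> t i <= t i.+1) ->
      (P (\bigcap_(i < n.+2) (X (t i) @^-1` [set x i]))
       = P (\bigcap_(i < n.+1) (X (t i) @^-1` [set x i]))
         * (p (t n.+1 - t n) (x n) (x n.+1))%:E)%E
}.

End Markov_jump_processes.

Section Model.
Context {V : finType}.

(* An element sigma of {0,1}^V is encoded by its support A = {v | sigma_v = 1}. *)
Definition admissible (e : rel V) (A : {set V}) : bool :=
  [forall v, forall w, e v w ==> ((v \in A) + (w \in A) <= 1)%N].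

Definition config (e : rel V) := {A : {set V} | admissible e A}.

Context {e : rel V}.
Implicit Types (sigma rho : config e) (v w : V) (q : {ffun V -> nat}).

(* sigma + e^v and sigma - e^v; the default [sigma] of [insubd] is used only if
   the result is not in S(G), in which case the corresponding rate is 0. *)
Definition activate sigma v : config e := insubd sigma (v |: val sigma).
Definition deactivate sigma v : config e := insubd sigma (val sigma :\ v).

Definition arrive q v : {ffun V -> nat} := [ffun w => (q w + (w == v))%N].
Definition depart q v : {ffun V -> nat} := [ffun w => (q w - (w == v))%N].

Definition occ (R : realType) sigma v : R := (v \in val sigma)%:R.

Section Dynamics.
Context {R : realType}.
Variables (a : R) (lam : V -> R).

Definition Psi_plus (x : nat) : R := x.+1%:R `^ a / (1 + x.+1%:R `^ a).
Definition Psi_minus (x : nat) : R := 1 - Psi_plus x.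

Definition act_rate q sigma v : R :=
  (1 - occ R sigma v) * (\prod_(w | e v w) (1 - occ R sigma w)) * Psi_plus (q v).
Definition deact_rate q sigma v : R := occ R sigma v * Psi_minus (q v).

Definition jump_rate (x y : {ffun V -> nat} * config e) : R :=
  let: (q, sigma) := x in
  \sum_(v : V)
    (lam v * (y == (arrive q v, sigma))%:R
     + occ R sigma v * (0 < q v)%N%:R * (y == (depart q v, sigma))%:R
     + deact_rate q sigma v * (y == (q, deactivate sigma v))%:R
     + act_rate q sigma v * (y == (q, activate sigma v))%:R).

Definition fast_generator q (h : config e -> R) sigma : R :=
  \sum_(v : V) deact_rate q sigma v * (h (deactivate sigma v) - h sigma)
  + \sum_(v : V) act_rate q sigma v * (h (activate sigma v) - h sigma).

Definition eigenvalue_opp_generator q (l : R) : Prop :=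
  exists2 h : config e -> R, (exists sigma, h sigma != 0) &
    forall sigma, - fast_generator q h sigma = l * h sigma.

(* The smallest nonzero eigenvalue: there are finitely many eigenvalues, so the
   infimum is a minimum, except for V empty, where S(G) is a singleton and there
   is no nonzero eigenvalue (the gap is then +oo). The generator is reversible,
   so that all its eigenvalues are real. *)
Definition spectral_gap q : \bar R :=
  ereal_inf [set l%:E | l in [set l | l != 0 /\ eigenvalue_opp_generator q l]].

End Dynamics.

Section Limit.
Context {R : realType}.

Definition norm_inf (x : V -> R) : R := \big[Num.max/0]_v `|x v|.

Definition Upsilon : nat := \max_(sigma : config e) #|val sigma|.
Definition max_config sigma : bool := #|val sigma| == Upsilon.

Variables (a : R) (lam : V -> R).

Definition weight (q : V -> R) sigma : R :=
  \prod_w (q w `^ (a * occ R sigma w)).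

Definition pibar (q : V -> R) v : R :=
  \sum_(sigma : config e | max_config sigma)
    occ R sigma v * (weight q sigma / \sum_(rho | max_config rho) weight q rho).

Definition drift (q : V -> R) v : R := lam v - pibar q v.

End Limit.

End Model.

Section ODE.
Context {R : realType} {V : finType}.
Implicit Types (F : (V -> R) -> V -> R) (f : R -> V -> R).

(* [f] restricted to the open interval ]tm, tp[ is a solution with values in
   (0,+oo)^V; its values outside ]tm, tp[ are irrelevant. *)
Record ode_solution F (q0 : V -> R) (tm tp : \bar R) f : Prop := {
  ode_tm : (tm < 0)%E;
  ode_tp : (0 < tp)%E;
  ode_init : f 0 = q0;
  ode_pos : forall t v, (tm < t%:E < tp)%E -> 0 < f t v;
  ode_deriv : forall t v, (tm < t%:E < tp)%E ->
    is_derive t 1 (fun s : R => f s v) (F (f t) v)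
}.

(* A solution without proper extension. *)
Definition maximal_ode_solution F (q0 : V -> R) (tm tp : \bar R) f : Prop :=
  ode_solution F q0 tm tp f /\
  forall (tm' tp' : \bar R) f',
    ode_solution F q0 tm' tp' f' -> (tm' <= tm)%E -> (tp <= tp')%E ->
    (forall t, (tm < t%:E < tp)%E -> f' t = f t) ->
    tm' = tm /\ tp' = tp.

End ODE.

Arguments jump_rate {V} e {R} a lam x y.
Arguments spectral_gap {V} e {R} a q.
Arguments drift {V} e {R} a lam q v.

Section Scaling.
Context {R : realType} {V : finType} {e : rel V}.

Definition scaled_queue (Om : Type) (X : R -> Om -> {ffun V -> nat} * config e)
    (N : nat) (t : R) (w : Om) : V -> R :=
  fun v => ((X (N%:R * t) w).1 v)%:R / N%:R.

End Scaling.

(* Main.v *)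
Require Import Defs.
From HB Require Import structures.
From mathcomp Require Import all_boot all_order all_algebra.
From mathcomp Require Import all_classical all_reals all_analysis.
From mathcomp Require Import ring lra.
Import Order.TTheory GRing.Theory Num.Theory.
Import numFieldNormedType.Exports.
Local Open Scope classical_set_scope.
Local Open Scope ring_scope.
Set Implicit Arguments.
Unset Strict Implicit.
Unset Printing Implicit Defensive.

(** The proof is a perturbed Lyapunov function argument on the scaled chain.
Write [d = Q / N - qstar (t / N)].  The generator applied to [\sum_v d_v ^+ 2]
gives, per unit of rescaled time, [2 \sum_v d_v (pibar_v (qstar) - sigma_v)]
and terms of order [1 / N].  The fast variable [sigma_v] is not small, but its
stationary mean given the queues is close to [pibar_v (Q / N)], and [pibar] is
Lipschitz away from the boundary, so only [sigma_v] minus its mean has to be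
removed.  This is what the corrector does: with [L_f] the fast generator and
[K = I + c L_f] a lazy version of the fast dynamics,
[H_v = c \sum_(k < n) K ^ k sigma_v] satisfies [L_f H_v = K ^ n sigma_v - sigma_v],
and [K ^ n sigma_v] is within [exp (- c l n / 2)] times a power of [N] of its
mean, where [l] is the spectral gap.  The function
[\sum_v d_v ^+ 2 - 2 / N \sum_v d_v H_v] (see [lyapunov]) therefore grows at
most exponentially up to an error that is small with [1 / N]
([lyapunov_one_step]).

The window [n] has to be much larger than [1 / l], that is than
[N ^ (a * beta)], for [K ^ n] to have mixed.  On the other hand [H_v] has size
[n], and one arrival or departure changes the fast rates by [O(1 / N)] and hence
[H_v] by [O(n ^ 2 / N)] ([potential_increment]); over a time of order [N] these
changes are harmless when [n ^ 2 / N] tends to 0.  The choice [n = N ^ b] with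
[a * beta < b < 1 / 2] is possible exactly because [2 * a * beta < 1]
([near_window]).

The passage from generators to probabilities uses only transition probabilities
over a small time [h].  As long as the process stays in a tube around the ODE
solution, it visits finitely many states, on which
[p h x y = (x == y) + h r x y + o(h)] uniformly.  A backward induction over a
grid bounds from below the probability to stay in the tube along the grid
([stay_probability_ge], [stays_dyadic_probability_ge]); dyadic grids increase to
a dense set of times, and right-continuity of the paths turns this into a
statement on the supremum ([error_le_dyadic]).

The spectral gap is defined through eigenvalues.  The variational inequality
that is needed, [poincare], follows by minimizing the Rayleigh quotient on the
compact unit sphere of mean-zero functions: a minimizer is an eigenvector. *)

(** * Short-time expansion of transition probabilities *)

Lemma near_all_in {T : Type} {I : eqType} (F : set_system T) (FF : Filter F)
    (s : seq I) (Q : I -> T -> Prop) :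
  (forall i, i \in s -> \forall x \near F, Q i x) ->
  \forall x \near F, forall i, i \in s -> Q i x.
Proof.
elim: s => [|i s IH] H; first by apply: nearW.
have Hi : \forall x \near F, Q i x by apply: H; rewrite mem_head.
have Hs : \forall x \near F, forall j, j \in s -> Q j x.
  by apply: IH => j js; apply: H; rewrite in_cons js orbT.
apply: filterS2 Hi Hs => x Qi Qs j.
by rewrite in_cons => /predU1P[->//|]; exact: Qs.
Qed.

Section Short_time.
Context {R : realType} {T : countType}.
Variables (r : T -> T -> R) (p : R -> T -> T -> R).
Hypothesis r_ge0 : forall x y, 0 <= r x y.
Hypothesis Htf : transition_function r p.

(** Turns the sum in the diagonal rate condition into a finite one, when the
jumps from [x] stay in [B]. *)
Lemma esum_rates_finite (B : seq T) (x : T) : uniq B ->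
  (forall y, y \notin B -> r x y = 0) ->
  \esum_(y in [set y | y != x]) (r x y)%:E = (\sum_(y <- B | y != x) r x y)%:E.
Proof.
move=> uB rB.
rewrite (esumID [set` B]); last by move=> y _; rewrite lee_fin.
rewrite [X in (_ + X)%E]esum1 ?adde0; last first.
  by move=> y /= [_ /negP yB]; rewrite rB.
have -> : [set y | y != x] `&` [set` B] = [set` [seq y <- B | y != x]].
  by apply/seteqP; split => y /=; rewrite mem_filter => /andP.
rewrite esum_fset; [|exact: finite_seq|by move=> y _; rewrite lee_fin].
by rewrite -fsbig_seq ?filter_uniq// big_filter sumEFin.
Qed.

(** Finitely many off-diagonal rates and the diagonal one converge, and no mass is
needed outside [B]; hence the error is uniform over all [g] bounded by [M] on [B].
This uniformity is what allows [g] to depend on the time step later on. *)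
Lemma short_time_expansion (B : seq T) (M eta : R) (x : T) : uniq B ->
  x \in B -> (forall y, y \notin B -> r x y = 0) -> 0 <= M -> 0 < eta ->
  \forall h \near 0^'+, forall g : T -> R,
    (forall y, y \in B -> `|g y| <= M) ->
    g x + h * \sum_(y <- B | y != x) r x y * (g y - g x) - eta * h
      <= \sum_(y <- B) p h x y * g y.
Proof.
move=> uB xB rB M0 eta0.
pose n : R := (size B)%:R.
(* n off-diagonal errors and one diagonal error, each weighted by at most M *)
pose eps := eta / ((n + 1) * (M + 1)).
have n0 : 0 <= n by exact: ler0n.
have den0 : 0 < (n + 1) * (M + 1) by rewrite mulr_gt0// ltr_wpDl.
have eps0 : 0 < eps by rewrite divr_gt0.
have Hoff : \forall h \near 0^'+, forall y, y \in B -> y != x ->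
    `|r x y - p h x y / h| <= eps.
  apply: near_all_in => y yB.
  have [->|yx] := eqVneq y x; first by apply: nearW.
  have := tf_rate Htf (x := x) (y := y); rewrite eq_sym yx => /(_ isT).
  by move=> /cvgrPdist_le /(_ _ eps0); apply: filterS => h.
have Hdiag : \forall h \near 0^'+,
    `|\sum_(y <- B | y != x) r x y - (1 - p h x x) / h| <= eps.
  have := tf_rate_diag Htf (x := x); rewrite (esum_rates_finite uB rB).
  by move=> /fine_cvg /cvgrPdist_le /(_ _ eps0).
have Hpos : \forall h \near 0^'+, (0 : R) < h by exact: nbhs_right_gt.
apply: filterS3 Hpos Hoff Hdiag => h h0 offh diagh g gM.
rewrite [leRHS](bigD1_seq x)//=.
set S := \sum_(y <- B | y != x) r x y.
have -> : \sum_(y <- B | y != x) r x y * (g y - g x) =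
    \sum_(y <- B | y != x) r x y * g y - S * g x.
  by rewrite mulr_suml -sumrB; apply: eq_bigr => y _; rewrite mulrBr.
have heps0 : 0 <= h * eps by rewrite mulr_ge0// ltW.
have heM0 : 0 <= h * eps * M by rewrite mulr_ge0.
have diag : `|p h x x - 1 + h * S| <= h * eps.
  have -> : p h x x - 1 + h * S = h * (S - (1 - p h x x) / h).
    by rewrite mulrBr mulrCA divff ?gt_eqF// mulr1; lra.
  by rewrite normrM gtr0_norm// ler_pM2l.
have diagx : - (h * eps * M) <= (p h x x - 1 + h * S) * g x.
  rewrite lerNl; apply: le_trans (ler_norm _) _; rewrite normrN normrM.
  by apply: ler_pM => //; exact: gM.
have offx : - (n * (h * eps * M)) <=
    \sum_(y <- B | y != x) (p h x y - h * r x y) * g y.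
  rewrite lerNl -sumrN.
  apply: (@le_trans _ _ (\sum_(y <- B | y != x) h * eps * M)); last first.
    rewrite big_const_seq iter_addr_0 -[leLHS]mulr_natl ler_wpM2r//.
    by rewrite /n ler_nat count_size.
  rewrite big_seq_cond [leRHS]big_seq_cond; apply: ler_sum => y /andP[yB yx].
  apply: le_trans (ler_norm _) _; rewrite normrN normrM.
  apply: ler_pM => //; last exact: gM.
  have -> : p h x y - h * r x y = - (h * (r x y - p h x y / h)).
    by rewrite mulrBr mulrCA divff ?gt_eqF// mulr1; lra.
  rewrite normrN normrM gtr0_norm// ler_pM2l//.
  exact: offh.
have -> : \sum_(y <- B | y != x) p h x y * g y =
    \sum_(y <- B | y != x) (p h x y - h * r x y) * g y
    + h * \sum_(y <- B | y != x) r x y * g y.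
  by rewrite mulr_sumr -big_split /=; apply: eq_bigr => y _; ring.
have slack : (n + 1) * (h * eps * M) <= eta * h.
  have -> : eta * h = h * eps * ((n + 1) * (M + 1)).
    by rewrite -mulrA /eps divfK ?gt_eqF// mulrC.
  rewrite -subr_ge0.
  have -> : h * eps * ((n + 1) * (M + 1)) - (n + 1) * (h * eps * M) =
    (n + 1) * (h * eps) by ring.
  by rewrite mulr_ge0// addr_ge0.
move: diagx offx slack; lra.
Qed.

End Short_time.

(** * Staying in a moving set *)

Section Paths.
Context {R : realType} {T : countType} {d : measure_display}
  {Om : measurableType d}.
Variables (P : probability Om R) (r : T -> T -> R) (X : R -> Om -> T).
Hypothesis X_markov : markov_jump_process P r X.

Lemma measurable_state (t : R) (Q : set T) : 0 <= t ->
  measurable (X t @^-1` Q).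
Proof.
move=> t0.
have -> : X t @^-1` Q = \bigcup_x (if `[< Q x >] then X t @^-1` [set x] else set0).
  apply/seteqP; split => [w Qw|w [x _]].
    by exists (X t w) => //; rewrite asboolT.
  by case: asboolP => //= Qx ->.
apply: countable_bigcupT_measurable; first exact: countableP.
move=> x; by case: ifP => _ //; exact: (mjp_measurable X_markov).
Qed.

Lemma sum_disjoint_events (t : R) (A : set Om) (s : seq T) : 0 <= t ->
  measurable A -> uniq s ->
  \sum_(x <- s) fine (P (A `&` X t @^-1` [set x])) =
  fine (P (A `&` X t @^-1` [set` s])).
Proof.
move=> t0 mA; elim: s => [|x s IH] /=.
  by rewrite big_nil set_nil preimage_set0 setI0 measure0.
move=> /andP[xs us]; rewrite big_cons IH//.
have -> : [set` x :: s] = [set x] `|` [set` s].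
  apply/seteqP; split => y /=; rewrite in_cons.
    by move=> /predU1P.
  by move=> /predU1P.
rewrite preimage_setU setIUr.
rewrite measureU ?fineD ?fin_num_measure//.
- by apply: measurableI => //; exact: measurable_state.
- by apply: measurableI => //; exact: measurable_state.
- by apply: measurableI => //; exact: measurable_state.
- by apply: measurableI => //; exact: measurable_state.
- apply/seteqP; split => // w [[_ /= ->] [_ /= xs']].
  by move: xs; rewrite xs'.
Qed.

Definition stays (h : R) (Q : nat -> set T) (k M : nat) : set Om :=
  [set w | forall i, (k <= i <= M)%N -> Q i (X (i%:R * h) w)].

Lemma measurable_stays (h : R) (Q : nat -> set T) (k M : nat) : 0 <= h ->
  measurable (stays h Q k M).
Proof.
move=> h0.
have -> : stays h Q k M =
    \bigcap_(i in [set i | (k <= i <= M)%N]) (X (i%:R * h) @^-1` Q i).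
  by [].
by apply: bigcap_measurableType => // i _; apply: measurable_state; rewrite mulr_ge0.
Qed.

(** [s k x] is any subsolution of the backward recursion for the probability of
staying from step [k] on.  The sets [Q k.+1] are intersected with a finite [B], so
that the Markov property for cylinders and finite additivity suffice. *)
Lemma stay_probability_ge (p : R -> T -> T -> R) (h : R) (M : nat)
    (Q : nat -> set T) (B : seq T) (s : nat -> T -> R) :
  (forall (n : nat) (t : nat -> R) (x : nat -> T),
      0 <= t 0%N -> (forall i, (i <= n)%N -> t i <= t i.+1) ->
      (P (\bigcap_(i < n.+2) (X (t i) @^-1` [set x i]))
       = P (\bigcap_(i < n.+1) (X (t i) @^-1` [set x i]))
         * (p (t n.+1 - t n) (x n) (x n.+1))%:E)%E) ->
  0 <= h -> uniq B -> (forall x, Q M x -> s M x <= 1) ->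
  (forall k x, (k < M)%N -> Q k x ->
     s k x <= \sum_(y <- B | y \in Q k.+1) p h x y * s k.+1 y) ->
  \sum_(x <- B | x \in Q 0%N) fine (P (X 0 @^-1` [set x])) * s 0%N x
    <= fine (P (stays h Q 0 M)).
Proof.
move=> markov h0 uB sM sk.
pose cyl k (x : nat -> T) := \bigcap_(i < k.+1) (X (i%:R * h) @^-1` [set x i]).
have mcyl k x : measurable (cyl k x).
  apply: bigcap_measurableType => // i _.
  by apply: measurable_state; rewrite mulr_ge0.
have ms k := measurable_stays Q k M h0.
(* x' is the path x continued by y *)
have cylS k x y : P (cyl k x `&` X (k.+1%:R * h) @^-1` [set y]) =
    (P (cyl k x) * (p h (x k) y)%:E)%E.
  pose x' i := if i == k.+1 then y else x i.
  have := markov k (fun i => i%:R * h) x'.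
  rewrite mul0r lexx => /(_ isT).
  have mono i : (i <= k)%N -> i%:R * h <= i.+1%:R * h.
    by move=> _; rewrite ler_wpM2r// ler_nat.
  move=> /(_ mono).
  have -> : \bigcap_(i < k.+1) X (i%:R * h) @^-1` [set x' i] = cyl k x.
    apply: eq_bigcapr => i /= ik.
    by rewrite /x' (ltn_eqF ik).
  have -> : \bigcap_(i < k.+2) X (i%:R * h) @^-1` [set x' i] =
      cyl k x `&` X (k.+1%:R * h) @^-1` [set y].
    apply/seteqP; split => [w H|w [H1 H2] i /= ik].
      split; last by have := H k.+1 (ltnSn _); rewrite /x' eqxx.
      move=> i /= ik; have := H i (ltnW ik).
      by rewrite /x' (ltn_eqF ik).
    rewrite /x'; case: eqP => [->//|/eqP ik1]; apply: H1 => /=.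
    by rewrite ltn_neqAle ik1.
  move=> ->; congr (_ * (p _ _ _)%:E)%E.
  - by rewrite -mulrBl -natrB// subSnn mul1r.
  - by rewrite /x' (ltn_eqF (ltnSn k)).
  - by rewrite /x' eqxx.
have main j : forall k x, (k + j = M)%N -> Q k (x k) ->
    fine (P (cyl k x)) * s k (x k) <= fine (P (cyl k x `&` stays h Q k.+1 M)).
  elim: j => [|j IH] k x; rewrite ?addn0 ?addnS => kM Qx.
    subst k; have -> : stays h Q M.+1 M = setT.
      apply/seteqP; split => // w _ i /andP[Mi iM].
      by move: (leq_trans Mi iM); rewrite ltnn.
    by rewrite setIT ler_piMr ?fine_ge0//; exact: sM.
  apply: (@le_trans _ _ (\sum_(y <- B | y \in Q k.+1)
     fine (P ((cyl k x `&` stays h Q k.+1 M) `&` X (k.+1%:R * h) @^-1` [set y])))).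
    apply: (@le_trans _ _ (fine (P (cyl k x)) *
       \sum_(y <- B | y \in Q k.+1) p h (x k) y * s k.+1 y)).
      apply: ler_wpM2l; first exact: fine_ge0.
      by apply: sk => //; rewrite -kM ltnS leq_addr.
    rewrite mulr_sumr; apply: ler_sum => y yQ.
    pose x' i := if i == k.+1 then y else x i.
    have cylE : cyl k.+1 x' = cyl k x `&` X (k.+1%:R * h) @^-1` [set y].
      apply/seteqP; split => [w H|w [H1 H2] i /= ik].
        split; last by have := H k.+1 (ltnSn _); rewrite /x' eqxx.
        move=> i /= ik; have := H i (ltnW ik).
        by rewrite /x' (ltn_eqF ik).
      rewrite /x'; case: eqP => [->//|/eqP ik1]; apply: H1 => /=.
      by rewrite ltn_neqAle ik1.
    have := IH k.+1 x'; rewrite addSn kM => /(_ erefl).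
    rewrite /x' eqxx => /(_ (set_mem yQ)).
    rewrite -/x' cylE cylS fineM ?fin_num_measure// mulrA.
    move=> /le_trans; apply.
    apply: fine_le; rewrite ?fin_num_measure//.
    - apply: measurableI; last exact: ms.
      by apply: measurableI => //; apply: measurable_state; rewrite mulr_ge0.
    - apply: measurableI; first exact: measurableI.
      by apply: measurable_state; rewrite mulr_ge0.
    apply: le_measure; rewrite ?inE.
    - apply: measurableI; last exact: ms.
      by apply: measurableI => //; apply: measurable_state; rewrite mulr_ge0.
    - apply: measurableI; first exact: measurableI.
      by apply: measurable_state; rewrite mulr_ge0.
    move=> w [[Hc Hy] Hst]; split => //; split => // i /andP[ki iM].
    move: ki; rewrite leq_eqVlt => /predU1P[<-|ki]; last by apply: Hst; rewrite ki.
    by rewrite Hy; exact: set_mem.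
  rewrite -big_filter sum_disjoint_events ?filter_uniq// ?mulr_ge0//; last first.
    exact: measurableI.
  apply: fine_le; rewrite ?fin_num_measure//.
  - apply: measurableI; first exact: measurableI.
    by apply: measurable_state; rewrite mulr_ge0.
  - exact: measurableI.
  apply: le_measure; rewrite ?inE//; last exact: measurableI.
  apply: measurableI; first exact: measurableI.
  by apply: measurable_state; rewrite mulr_ge0.
have cyl0 x : cyl 0%N x = X 0 @^-1` [set x 0%N].
  apply/seteqP; split => [w /(_ 0%N (ltn0Sn _)) /=|w /= H i /=].
    by rewrite mul0r.
  by rewrite ltnS leqn0 => /eqP ->; rewrite mul0r.
apply: (@le_trans _ _ (\sum_(x <- B | x \in Q 0%N)
   fine (P (stays h Q 0 M `&` X 0 @^-1` [set x])))).
  apply: ler_sum => x xQ.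
  have := main M 0%N (fun=> x) (add0n _) (set_mem xQ).
  rewrite cyl0 => /le_trans; apply.
  have m1 : measurable (X 0 @^-1` [set x] `&` stays h Q 1 M).
    by apply: measurableI => //; exact: measurable_state.
  have m2 : measurable (stays h Q 0 M `&` X 0 @^-1` [set x]).
    by apply: measurableI => //; exact: measurable_state.
  apply: fine_le; rewrite ?fin_num_measure//.
  apply: le_measure; rewrite ?inE// => w [Hx Hst]; split => // i /andP[_ iM].
  have [->|i0] := posnP i; first by rewrite mul0r Hx; exact: set_mem.
  by apply: Hst; rewrite i0.
rewrite -big_filter sum_disjoint_events ?filter_uniq//.
have m2 : measurable (stays h Q 0 M `&` X 0 @^-1` [set` [seq x <- B | x \in Q 0%N]]).
  by apply: measurableI => //; exact: measurable_state.
apply: fine_le; rewrite ?fin_num_measure//.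
by apply: le_measure; rewrite ?inE.
Qed.

(** Only powers of 2 are used as numbers of steps, so that the grids are nested. *)
Definition dyadic (S : R) (m i : nat) : R := i%:R * (S / 2 ^+ m).

Definition stays_dyadic (S : R) (Q : R -> set T) (m : nat) : set Om :=
  [set w | forall i, (i <= 2 ^ m)%N -> Q (dyadic S m i) (X (dyadic S m i) w)].

Lemma dyadic_refine (S : R) (m n i : nat) : (m <= n)%N ->
  dyadic S m i = dyadic S n (i * 2 ^ (n - m)).
Proof.
move=> mn; rewrite /dyadic natrM natrX.
have -> : (2 : R) ^+ n = 2 ^+ (n - m) * 2 ^+ m by rewrite -exprD subnK.
by field; rewrite !expf_neq0.
Qed.

Lemma dyadic_itv (S : R) (m i : nat) : 0 <= S -> (i <= 2 ^ m)%N ->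
  0 <= dyadic S m i <= S.
Proof.
move=> S0 im; rewrite /dyadic mulr_ge0 ?divr_ge0 ?exprn_ge0//=.
by rewrite mulrA mulrAC ler_piMl// ler_pdivrMr ?exprn_gt0// mul1r -natrX ler_nat.
Qed.

Lemma measurable_stays_dyadic (S : R) (Q : R -> set T) (m : nat) : 0 <= S ->
  measurable (stays_dyadic S Q m).
Proof.
move=> S0; have -> : stays_dyadic S Q m =
    stays (S / 2 ^+ m) (fun i => Q (dyadic S m i)) 0 (2 ^ m) by [].
by apply: measurable_stays; rewrite divr_ge0 ?exprn_ge0.
Qed.

Lemma near_dyadic_step (S : R) (Q : R -> Prop) : 0 < S ->
  (\forall h \near 0^'+, Q h) -> \forall m \near \oo, Q (S / 2 ^+ m).
Proof.
move=> S0 HQ.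
have := @cvg_geometric R S 2^-1; rewrite ger0_norm ?invr_ge0//.
rewrite invf_lt1 ?ltr1n// => /(_ isT) /(_ _ HQ) H.
have {}H : \forall m \near \oo, 0 < geometric S 2^-1 m -> Q (geometric S 2^-1 m).
  exact: H.
apply: filterS H => m; rewrite /geometric /= exprVn; apply.
by rewrite divr_gt0 ?exprn_gt0.
Qed.

Hypothesis r_ge0 : forall x y, 0 <= r x y.

(** Supermartingale bound.  [F] is at least 1 on leaving [Q] and grows at rate
at most [kappa] up to an error [eps], so
[1 - expR (kappa * (S - t)) * F t x - 2 * eps * expR (kappa * S) * (S - t)] is a
subsolution for every fine grid; the factor 2 absorbs the error of the short-time
expansion.  Continuity of [P] along the nested grids concludes. *)
Lemma stays_dyadic_probability_ge (S kappa eps phi M : R) (B : seq T)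
    (Q : R -> set T) (F : R -> T -> R) (I : set T) :
  0 < S -> 0 <= kappa -> 0 < eps -> 0 <= phi -> uniq B ->
  (forall t x, 0 <= t <= S -> Q t x ->
     x \in B /\ (forall y, y \notin B -> r x y = 0)) ->
  (forall t x, 0 <= t <= S -> x \in B -> 0 <= F t x <= M) ->
  (forall t x, 0 <= t <= S -> x \in B -> ~ Q t x -> 1 <= F t x) ->
  (\forall h \near 0^'+, forall t x, 0 <= t -> t + h <= S -> Q t x ->
     F (t + h) x + h * \sum_(y <- B | y != x) r x y * (F (t + h) y - F (t + h) x)
       <= (1 + kappa * h) * F t x + eps * h) ->
  (forall x, I x -> Q 0 x /\ F 0 x <= phi) ->
  ((fine (P (X 0 @^-1` I)) - expR (kappa * S) * (phi + 2 * eps * S))%:E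
    <= P (\bigcap_m stays_dyadic S Q m))%E.
Proof.
move=> S0 k0 eps0 phi0 uB QB FB FQ drift IQ.
have S0' := ltW S0.
have [p Htf markov] := mjp_markov X_markov.
set E := expR (kappa * S).
have E0 : 0 < E by exact: expR_gt0.
have E1 : 1 <= E by rewrite -expR0 ler_expR mulr_ge0.
pose M' := 1 + E * `|M| + 2 * eps * E * S.
have M'0 : 0 <= M' by rewrite !addr_ge0// !mulr_ge0// ltW.
have expansion : \forall h \near 0^'+, forall x, x \in B ->
    (forall y, y \notin B -> r x y = 0) -> forall g : T -> R,
    (forall y, y \in B -> `|g y| <= M') ->
    g x + h * \sum_(y <- B | y != x) r x y * (g y - g x) - eps * h
      <= \sum_(y <- B) p h x y * g y.
  apply: near_all_in => x xB.
  have [rx|rx] := pselect (forall y, y \notin B -> r x y = 0); last first.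
    by apply: nearW.
  have := short_time_expansion r_ge0 Htf uB xB rx M'0 eps0.
  by apply: filterS => h H _; exact: H.
have cv : (P \o stays_dyadic S Q) m @[m --> \oo] -->
    P (\bigcap_m stays_dyadic S Q m).
  apply: nonincreasing_cvg_mu.
  - by rewrite ltey_eq fin_num_measure//; exact: measurable_stays_dyadic.
  - by move=> m; exact: measurable_stays_dyadic.
  - by apply: bigcap_measurableType => m _; exact: measurable_stays_dyadic.
  move=> m n mn; rewrite subsetEset => w Hw i im.
  rewrite (dyadic_refine _ _ mn); apply: Hw.
  by rewrite -[in leqRHS](subnK mn) addnC expnD leq_mul2r im orbT.
apply: (cvge_to_ge cv).
apply: filterS2 (near_dyadic_step S0 drift) (near_dyadic_step S0 expansion).
move=> m driftm expm /=.
set h := S / 2 ^+ m in driftm expm.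
have h0 : 0 < h by rewrite divr_gt0 ?exprn_gt0.
have hS : (2 ^ m)%:R * h = S by rewrite natrX mulrC divfK ?expf_neq0.
(* the start is restricted to I, which enters only at step 0 *)
pose Qm k := if k is 0%N then I else Q (k%:R * h).
pose s k x : R := 1 - expR (kappa * (S - k%:R * h)) * F (k%:R * h) x
  - 2 * eps * E * (S - k%:R * h).
have kS k : (k <= 2 ^ m)%N -> 0 <= k%:R * h <= S.
  move=> km; rewrite mulr_ge0 ?(ltW h0)//=.
  by rewrite -hS ler_wpM2r ?(ltW h0)// ler_nat.
have QmQ k x : Qm k x -> Q (k%:R * h) x.
  by case: k => //= /IQ[]; rewrite mul0r.
have weightE k : (k <= 2 ^ m)%N -> 1 <= expR (kappa * (S - k%:R * h)) <= E.
  move=> /kS /andP[kh0 khS]; rewrite -{1}expR0 !ler_expR.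
  by rewrite mulr_ge0 ?subr_ge0//= ler_wpM2l// gerBl.
have step k x : (k < 2 ^ m)%N -> Qm k x ->
    s k x <= \sum_(y <- B | y \in Qm k.+1) p h x y * s k.+1 y.
  move=> km /QmQ Qx.
  have kmS := kS _ km; have kmS' := kS _ (ltnW km).
  have [xB rx] := QB _ _ kmS' Qx.
  have h1 : k.+1%:R * h = k%:R * h + h by rewrite -natr1 mulrDl mul1r.
  apply: (@le_trans _ _ (\sum_(y <- B) p h x y * s k.+1 y)); last first.
    rewrite [leLHS](bigID (fun y => y \in Qm k.+1))/= gerDl.
    rewrite big_seq_cond; apply: sumr_le0 => y /andP[yB /negP yQ].
    rewrite mulr_ge0_le0 ?(tf_ge0 Htf) ?(ltW h0)//.
    have nQ : ~ Q (k.+1%:R * h) y by move=> Qy; apply: yQ; rewrite inE.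
    have F1 := FQ _ _ kmS yB nQ.
    have /andP[w1 _] := weightE _ km.
    rewrite /s subr_le0 (@le_trans _ _ 0)//; last first.
      by rewrite !mulr_ge0 ?(ltW E0) ?(ltW eps0)// subr_ge0; case/andP: kmS.
    by rewrite subr_le0 -[leLHS]mulr1 ler_pM.
  have sB y : y \in B -> `|s k.+1 y| <= M'.
    move=> yB; have /andP[F0 FM] := FB _ _ kmS yB.
    have /andP[w1 wE] := weightE _ km.
    rewrite /s /M'; apply: le_trans (ler_normB _ _) _; apply: lerD; last first.
      rewrite ger0_norm.
        by rewrite ler_wpM2l ?mulr_ge0 ?(ltW E0) ?(ltW eps0)// gerBl; case/andP: kmS.
      by rewrite !mulr_ge0 ?(ltW E0) ?(ltW eps0)// subr_ge0; case/andP: kmS.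
    apply: le_trans (ler_normB _ _) _; rewrite normr1 lerD2l normrM.
    apply: ler_pM => //; first by rewrite ger0_norm ?expR_ge0.
    by rewrite ger0_norm// (le_trans FM)// ler_norm.
  apply: le_trans (expm x xB rx _ sB).
  set w1 := expR (kappa * (S - k.+1%:R * h)).
  have -> : \sum_(y <- B | y != x) r x y * (s k.+1 y - s k.+1 x) =
      - w1 * \sum_(y <- B | y != x)
        r x y * (F (k.+1%:R * h) y - F (k.+1%:R * h) x).
    by rewrite mulr_sumr; apply: eq_bigr => y _; rewrite /s -/w1; ring.
  have := driftm (k%:R * h) x; rewrite -h1.
  case/andP: kmS => _ kmS; case/andP: (kmS') => kh0 _.
  move=> /(_ kh0 kmS Qx) dr.
  have w10 : 0 <= w1 by exact: expR_ge0.
  have wk : w1 * (1 + kappa * h) <= expR (kappa * (S - k%:R * h)).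
    rewrite (_ : kappa * (S - k%:R * h) = kappa * (S - k.+1%:R * h) + kappa * h).
      by rewrite expRD ler_wpM2l// expR_ge1Dx.
    by rewrite h1; ring.
  have /andP[F0 _] := FB _ _ kmS' xB.
  have /andP[_ wE] := weightE _ km.
  rewrite -/w1 in wE.
  have H1 := ler_wpM2l w10 dr.
  have H2 := ler_wpM2r F0 wk.
  have H3 : w1 * (eps * h) <= E * (eps * h).
    by rewrite ler_wpM2r// mulr_ge0 ?ltW.
  have H4 : eps * h <= E * (eps * h).
    by rewrite ler_peMl// mulr_ge0 ?ltW.
  have H5 : 2 * eps * E * (S - k%:R * h) =
      2 * eps * E * (S - k.+1%:R * h) + 2 * (E * (eps * h)) by rewrite h1; ring.
  rewrite /s -/w1 H5.
  move: H1 H2 H3 H4.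
  rewrite !mulrDr; lra.
have sM x : Qm (2 ^ m)%N x -> s (2 ^ m)%N x <= 1.
  move=> /QmQ Qx; have S2 := kS _ (leqnn _).
  have [xB _] := QB _ _ S2 Qx; have /andP[F0 _] := FB _ _ S2 xB.
  rewrite /s hS subrr !mulr0 subr0 lerBlDr lerDl mulr_ge0 ?expR_ge0//.
  by rewrite hS in F0.
have := stay_probability_ge markov (ltW h0) uB sM step.
move=> stayge.
have mI : measurable (X 0 @^-1` I) by exact: measurable_state.
have mst : measurable (stays h Qm 0 (2 ^ m)).
  by apply: measurable_stays; exact: ltW.
have mst' : measurable (stays_dyadic S Q m) by exact: measurable_stays_dyadic.
apply: (@le_trans _ _ (P (stays h Qm 0 (2 ^ m)))); last first.
  apply: le_measure; rewrite ?inE// => w Hw i im.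
  by apply: QmQ; apply: Hw.
rewrite -[leRHS]fineK ?fin_num_measure// lee_fin.
apply: le_trans stayge.
pose c := E * (phi + 2 * eps * S).
have c0 : 0 <= c by rewrite mulr_ge0 ?(ltW E0)// addr_ge0// !mulr_ge0// ltW.
have IB : X 0 @^-1` I = setT `&` X 0 @^-1` [set` [seq x <- B | x \in I]].
  rewrite setTI; apply/seteqP; split => w /=; rewrite mem_filter; last first.
    by move=> /andP[/set_mem].
  move=> Iw; rewrite mem_set//=.
  by have [/QB []] := IQ _ Iw; rewrite ?lexx ?S0'.
apply: (@le_trans _ _ (fine (P (X 0 @^-1` I)) * (1 - c))).
  rewrite mulrBr mulr1 -/c lerD2l lerN2 ler_piMl//.
  by rewrite -[leRHS]/(fine 1%E); apply: fine_le; rewrite ?fin_num_measure// probability_le1.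
rewrite [in leLHS]IB -sum_disjoint_events ?filter_uniq//.
rewrite big_filter mulr_suml; apply: ler_sum => x xI.
rewrite setTI; apply: ler_wpM2l; first exact: fine_ge0.
rewrite /s mul0r subr0 -/E.
have [_ F0] := IQ _ (set_mem xI).
rewrite /c mulrDr opprD addrA -[X in _ <= _ - X]mulrA.
have -> : E * (2 * eps * S) = 2 * (eps * (E * S)) by ring.
have := ler_wpM2l (ltW E0) F0.
have -> : 2 * eps * (E * S) = 2 * (eps * (E * S)) by ring.
lra.
Qed.

End Paths.

(** * Poincare inequality of a finite reversible chain *)

Lemma quadratic_nonneg_linear_coef_eq0 {R : realFieldType} (b c : R) :
  (forall t, 0 <= 2 * t * b + t ^+ 2 * c) -> b = 0.
Proof.
(* minimizing over t suggests - b / c; the denominator k avoids division by 0 *)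
move=> H; pose k := `|c| + 1.
have k0 : 0 < k by rewrite ltr_wpDl.
have := H (- b / k).
have -> : 2 * (- b / k) * b + (- b / k) ^+ 2 * c =
   (- 2 + c / k) * (b ^+ 2 / k) by field; rewrite gt_eqF.
have ck : c / k <= 1.
  by rewrite ler_pdivrMr// mul1r (le_trans (ler_norm _))// lerDl.
move=> Hn.
have b2 : 0 <= b ^+ 2 / k by rewrite divr_ge0 ?sqr_ge0// ltW.
have : b ^+ 2 / k = 0 by nra.
move=> /eqP; rewrite mulf_eq0 invr_eq0 (gt_eqF k0) orbF sqrf_eq0.
by move=> /eqP.
Qed.

Section Reversible_chain.
Context {R : realType} {S I : finType}.
Variables (w : S -> R) (tau : I -> S -> S) (r : I -> S -> R).
Implicit Types (f g : S -> R) (x : S) (i : I).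

Definition generator f x : R := \sum_i r i x * (f (tau i x) - f x).

Definition dot f g : R := \sum_x w x * (f x * g x).

Definition dirichlet f g : R :=
  2^-1 * \sum_x \sum_i w x * r i x * ((f (tau i x) - f x) * (g (tau i x) - g x)).

Hypothesis w_gt0 : forall x, 0 < w x.
Hypothesis r_ge0 : forall i x, 0 <= r i x.
Hypothesis r_le1 : forall i x, r i x <= 1.
Hypothesis tauK : forall i, involutive (tau i).
Hypothesis reversible : forall i x, w x * r i x = w (tau i x) * r i (tau i x).

Lemma dotC f g : dot f g = dot g f.
Proof. by apply: eq_bigr => x _; rewrite [f x * _]mulrC. Qed.

Lemma dot_ge0 f : 0 <= dot f f.
Proof. by apply: sumr_ge0 => x _; rewrite mulr_ge0 ?(ltW (w_gt0 _))// -expr2 sqr_ge0. Qed.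

Lemma dot_eq0 f : dot f f = 0 -> forall x, f x = 0.
Proof.
have P y : true -> 0 <= w y * (f y * f y).
  by move=> _; rewrite mulr_ge0 ?(ltW (w_gt0 _))// -expr2 sqr_ge0.
move=> /(psumr_eq0P P) H x; have /eqP := H x isT.
by rewrite mulf_eq0 (gt_eqF (w_gt0 x)) mulf_eq0 orbb => /eqP.
Qed.

Lemma dirichletC f g : dirichlet f g = dirichlet g f.
Proof.
congr (_ * _); apply: eq_bigr => x _; apply: eq_bigr => i _.
by congr (_ * _); rewrite mulrC.
Qed.

Lemma dirichlet_ge0 f : 0 <= dirichlet f f.
Proof.
rewrite mulr_ge0// sumr_ge0// => x _; apply: sumr_ge0 => i _.
by rewrite mulr_ge0 ?(mulr_ge0 (ltW (w_gt0 _)))// -expr2 sqr_ge0.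
Qed.

(** Reversibility pairs each jump with its reverse, so the two halves of the
Dirichlet form agree. *)
Lemma dot_generator f g : dot f (generator g) = - dirichlet f g.
Proof.
have H i : \sum_x w x * r i x * (f x * (g (tau i x) - g x)) =
    \sum_x w x * r i x * (- f (tau i x) * (g (tau i x) - g x)).
  rewrite (reindex_inj (inv_inj (tauK i))) /=; apply: eq_bigr => x _.
  by rewrite -reversible tauK; ring.
have E : dot f (generator g) = \sum_i \sum_x w x * r i x * (f x * (g (tau i x) - g x)).
  rewrite exchange_big; apply: eq_bigr => x _ /=.
  by rewrite /generator !mulr_sumr; apply: eq_bigr => i _; ring.
rewrite E /dirichlet [in RHS]exchange_big /= -mulrN -sumrN mulr_sumr.
apply: eq_bigr => i _.
have -> : - (\sum_x w x * r i x * ((f (tau i x) - f x) * (g (tau i x) - g x))) =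
    \sum_x w x * r i x * (f x * (g (tau i x) - g x)) +
    \sum_x w x * r i x * (- f (tau i x) * (g (tau i x) - g x)).
  by rewrite -sumrN -big_split /=; apply: eq_bigr => x _; ring.
by rewrite -H; field.
Qed.

Lemma dot_generator1 g : \sum_x w x * generator g x = 0.
Proof.
have := dot_generator (fun=> 1) g; rewrite /dot /dirichlet.
under eq_bigr do rewrite mul1r.
by move=> ->; rewrite big1 ?mulr0 ?oppr0// => x _; rewrite big1// => i _; ring.
Qed.

Lemma dirichletD f g t :
  dirichlet (fun x => f x + t * g x) (fun x => f x + t * g x) =
  dirichlet f f + 2 * t * dirichlet f g + t ^+ 2 * dirichlet g g.
Proof.
rewrite /dirichlet !mulr_sumr -!big_split /=; apply: eq_bigr => x _.
rewrite !mulr_sumr -!big_split /=; apply: eq_bigr => i _; ring.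
Qed.

Lemma dotD f g t :
  dot (fun x => f x + t * g x) (fun x => f x + t * g x) =
  dot f f + 2 * t * dot f g + t ^+ 2 * dot g g.
Proof.
rewrite /dot !mulr_sumr -!big_split /=; apply: eq_bigr => x _; ring.
Qed.

Lemma dirichletZ f t :
  dirichlet (fun x => t * f x) (fun x => t * f x) = t ^+ 2 * dirichlet f f.
Proof.
rewrite /dirichlet !mulr_sumr; apply: eq_bigr => x _.
rewrite !mulr_sumr; apply: eq_bigr => i _; ring.
Qed.

Lemma dotZ f t : dot (fun x => t * f x) (fun x => t * f x) = t ^+ 2 * dot f f.
Proof. by rewrite /dot !mulr_sumr; apply: eq_bigr => x _; ring. Qed.

Lemma sqr_sum_le (J : finType) (a : J -> R) :
  (\sum_j a j) ^+ 2 <= #|J|%:R * \sum_j a j ^+ 2.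
Proof.
have : 0 <= \sum_j \sum_k (a j - a k) ^+ 2.
  by apply: sumr_ge0 => j _; apply: sumr_ge0 => k _; exact: sqr_ge0.
have -> : \sum_j \sum_k (a j - a k) ^+ 2 =
    2 * (#|J|%:R * \sum_j a j ^+ 2) - 2 * (\sum_j a j) ^+ 2.
  rewrite expr2 mulr_suml [X in _ - X]mulr_sumr.
  have -> : 2 * (#|J|%:R * \sum_j a j ^+ 2) =
      \sum_j (#|J|%:R * a j ^+ 2 + \sum_k a k ^+ 2).
    rewrite big_split /= sumr_const -mulr_sumr -[in X in _ + X]mulr_natl; ring.
  rewrite -sumrB; apply: eq_bigr => j _.
  rewrite mulr_sumr mulr_sumr.
  have -> : #|J|%:R * a j ^+ 2 = \sum_(k : J) a j ^+ 2.
    by rewrite sumr_const mulr_natl.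
  rewrite -big_split /= -sumrB; apply: eq_bigr => k _; ring.
by rewrite subr_ge0 ler_pM2l.
Qed.

(** The generator is bounded by its own Dirichlet form, which makes
[I + c * generator] nonnegative for small [c] (see [kernel_contraction]). *)
Lemma generator_norm_le f :
  dot (generator f) (generator f) <= 2 * #|I|%:R * dirichlet f f.
Proof.
have -> : 2 * #|I|%:R * dirichlet f f =
    \sum_x w x * (#|I|%:R * \sum_i r i x * (f (tau i x) - f x) ^+ 2).
  rewrite /dirichlet !mulr_sumr; apply: eq_bigr => x _.
  by rewrite !mulr_sumr; apply: eq_bigr => i _; field.
apply: ler_sum => x _; rewrite -expr2; apply: ler_wpM2l; first exact: ltW.
apply: le_trans (sqr_sum_le _) _; apply: ler_wpM2l => //.
apply: ler_sum => i _; rewrite exprMn ler_wpM2r ?sqr_ge0//.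
by rewrite expr2 ler_piMl.
Qed.

Lemma dot1_combination f g t : dot (fun=> 1) f = 0 -> dot (fun=> 1) g = 0 ->
  dot (fun=> 1) (fun x => f x + t * g x) = 0.
Proof.
rewrite /dot => f0 g0.
have -> : \sum_x w x * (1 * (f x + t * g x)) =
    \sum_x w x * (1 * f x) + t * \sum_x w x * (1 * g x).
  by rewrite mulr_sumr -big_split /=; apply: eq_bigr => x _; ring.
by rewrite f0 g0 mulr0 addr0.
Qed.

Lemma dot1_scale f t : dot (fun=> 1) f = 0 -> dot (fun=> 1) (fun x => t * f x) = 0.
Proof.
move=> f0; have -> : dot (fun=> 1) (fun x => t * f x) = t * dot (fun=> 1) f.
  by rewrite /dot mulr_sumr; apply: eq_bigr => x _; ring.
by rewrite f0 mulr0.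
Qed.

(** Functions on [S] are seen as row vectors, whose unit sphere for [dot] is a
closed subset of a product of segments. *)
Lemma rayleigh_minimizer :
  (exists f, dot (fun=> 1) f = 0 /\ dot f f = 1) ->
  exists f, [/\ dot (fun=> 1) f = 0, dot f f = 1 &
    forall g, dot (fun=> 1) g = 0 -> dot g g = 1 ->
      dirichlet f f <= dirichlet g g].
Proof.
move=> [f0 [f01 f02]].
pose fn (v : 'rV[R]_#|S|) x : R := v ord0 (enum_rank x).
pose vec (f : S -> R) : 'rV[R]_#|S| := \row_j f (enum_val j).
have fnK f : fn (vec f) = f.
  by apply/funext => x; rewrite /fn mxE enum_rankK.
pose A := [set v : 'rV[R]_#|S| | dot (fun=> 1) (fn v) = 0 /\ dot (fn v) (fn v) = 1].
have cfn x : continuous (fun v => fn v x) by exact: coord_continuous.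
have csum (J : finType) (G : J -> 'rV[R]_#|S| -> R) :
    (forall j, continuous (G j)) -> continuous (fun v => \sum_j G j v).
  by move=> cG; apply: continuous_big => //; exact: add_continuous.
have cmul (G H : 'rV[R]_#|S| -> R) :
    continuous G -> continuous H -> continuous (fun v => G v * H v).
  by move=> cG cH v; exact: (cvgM (cG v) (cH v)).
have csub (G H : 'rV[R]_#|S| -> R) :
    continuous G -> continuous H -> continuous (fun v => G v - H v).
  by move=> cG cH v; exact: (cvgB (cG v) (cH v)).
have ccst (c : R) : continuous (fun _ : 'rV[R]_#|S| => c) by exact: cst_continuous.
have cdot1 : continuous (fun v => dot (fun=> 1) (fn v)).
  by apply: (csum) => x; apply: (cmul); [exact: ccst|apply: (cmul); [exact: ccst|exact: cfn]].
have cdot : continuous (fun v => dot (fn v) (fn v)).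
  by apply: (csum) => x; apply: (cmul); [exact: ccst|apply: (cmul); exact: cfn].
have cdir : continuous (fun v => dirichlet (fn v) (fn v)).
  apply: (cmul); first exact: ccst.
  apply: (csum) => x; apply: (csum) => i; apply: (cmul); first exact: ccst.
  by apply: (cmul); apply: (csub).
have Aclosed : closed A.
  have -> : A = (fun v => dot (fun=> 1) (fn v)) @^-1` [set z | z = 0] `&`
      (fun v => dot (fn v) (fn v)) @^-1` [set z | z = 1] by [].
  by apply: closedI; apply: preimage_closed => //; exact: closed_eq.
have Acompact : compact A.
  (* a square at most u has absolute value at most 1 + u *)
  pose b (j : 'I_#|S|) : R := 1 + (w (enum_val j))^-1.
  apply: (subclosed_compact Aclosed
      (@rV_compact R #|S| (fun j => `[- b j, b j]%classic) _)).
    by move=> j; exact: segment_compact.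
  move=> v [_ v1] j /=; rewrite in_itv /= -ler_norml.
  set x := enum_val j.
  have vx : fn v x = v ord0 j by rewrite /fn /x enum_valK.
  have : w x * (fn v x * fn v x) <= 1.
    rewrite -v1 /dot (bigD1 x)//= lerDl sumr_ge0// => y _.
    by rewrite mulr_ge0 ?(ltW (w_gt0 _))// -expr2 sqr_ge0.
  rewrite vx -expr2 -real_normK ?num_real//.
  rewrite -ler_pdivlMl// mulr1 /b -/x.
  have := w_gt0 x; rewrite -invr_gt0.
  move: (w x)^-1 (v ord0 j) => u z u0 zu.
  have z0 := normr_ge0 z.
  have [z1|z1] := leP `|z| 1; first by lra.
  by nra.
have A0 : A !=set0 by exists (vec f0); rewrite /A /= fnK.
have [v /set_mem[v1 v2] vmin] :=
  compact_EVT_min A0 Acompact (continuous_subspaceT cdir).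
exists (fn v); split => // g g1 g2.
have := vmin (vec g); rewrite fnK; apply.
by rewrite inE /A /= fnK.
Qed.

(** First-order condition: perturbing the minimizer in a mean-zero direction [g]
cannot decrease the quotient at first order.  The second conclusion takes for [g]
the residual of the eigenvalue equation. *)
Lemma minimizer_eigenvector f : dot (fun=> 1) f = 0 -> dot f f = 1 ->
  (forall g, dot (fun=> 1) g = 0 -> dot g g = 1 ->
      dirichlet f f <= dirichlet g g) ->
  (forall g, dot (fun=> 1) g = 0 -> dirichlet f f * dot g g <= dirichlet g g)
  /\ forall x, - generator f x = dirichlet f f * f x.
Proof.
move=> f1 ff fmin; set mu := dirichlet f f.
have rayleigh g : dot (fun=> 1) g = 0 -> mu * dot g g <= dirichlet g g.
  move=> g1; have [g0|g0] := eqVneq (dot g g) 0.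
    by rewrite g0 mulr0 dirichlet_ge0.
  have gpos : 0 < dot g g by rewrite lt_neqAle eq_sym g0 dot_ge0.
  pose t := (Num.sqrt (dot g g))^-1.
  have t2 : t ^+ 2 = (dot g g)^-1 by rewrite exprVn sqr_sqrtr// ltW.
  have := fmin (fun x => t * g x).
  rewrite dotZ t2 mulVf// dirichletZ t2.
  move=> /(_ (dot1_scale t g1) erefl); rewrite -/mu mulrC => ?.
  by rewrite -ler_pdivlMr.
split=> // x.
pose g x := - generator f x - mu * f x.
have g1 : dot (fun=> 1) g = 0.
  rewrite /dot /g.
  have -> : \sum_x w x * (1 * (- generator f x - mu * f x)) =
      - (\sum_x w x * generator f x) - mu * \sum_x w x * (1 * f x).
    rewrite mulr_sumr -!sumrN -big_split /=; apply: eq_bigr => y _; ring.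
  by rewrite dot_generator1 -/(dot (fun=> 1) f) f1 mulr0 oppr0 addr0.
have orth : dirichlet f g - mu * dot f g = 0.
  apply: (@quadratic_nonneg_linear_coef_eq0 _ _ (dirichlet g g - mu * dot g g)).
  move=> t; have := rayleigh _ (dot1_combination t f1 g1).
  rewrite dirichletD dotD ff -/mu; lra.
have gg : dot g g = 0.
  rewrite -orth [dirichlet f g]dirichletC -[dirichlet g f]opprK -dot_generator.
  rewrite [dot f g]dotC /dot mulr_sumr -!sumrN -big_split /=.
  by apply: eq_bigr => y _; rewrite /g; ring.
by have /eqP := dot_eq0 gg x; rewrite /g subr_eq0 => /eqP.
Qed.

(** The smallest Rayleigh quotient is an eigenvalue, nonzero by irreducibility,
hence at least [l]. *)
Lemma poincare (l : R) :
  (forall f, dirichlet f f = 0 -> forall x y, f x = f y) ->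
  (forall (mu : R) f, mu != 0 -> (exists x, f x != 0) ->
     (forall x, - generator f x = mu * f x) -> l <= mu) ->
  forall f, dot (fun=> 1) f = 0 -> l * dot f f <= dirichlet f f.
Proof.
move=> irr gap f f1.
have [ff0|ff0] := eqVneq (dot f f) 0; first by rewrite ff0 mulr0 dirichlet_ge0.
have fpos : 0 < dot f f by rewrite lt_neqAle eq_sym ff0 dot_ge0.
have [|h [h1 hh hmin]] := rayleigh_minimizer.
  pose t := (Num.sqrt (dot f f))^-1.
  have t2 : t ^+ 2 = (dot f f)^-1 by rewrite exprVn sqr_sqrtr// ltW.
  exists (fun x => t * f x); rewrite dotZ t2 mulVf//; split => //.
  exact: dot1_scale.
have [ray eig] := minimizer_eigenvector h1 hh hmin.
apply: le_trans (ray _ f1); rewrite ler_wpM2r ?dot_ge0//.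
have [x hx] : exists x, h x != 0.
  apply/not_existsP => H; have : dot h h = 0.
    by rewrite /dot big1// => x _; have /negP/negPn/eqP -> := H x; rewrite mul0r mulr0.
  by rewrite hh => /eqP; rewrite oner_eq0.
apply: (gap _ h) => //; last by exists x.
apply: contra_neq hx => /irr hconst.
have : dot (fun=> 1) h = h x * \sum_y w y.
  by rewrite /dot mulr_sumr; apply: eq_bigr => y _; rewrite mul1r mulrC (hconst y x).
rewrite h1 => /esym/eqP; rewrite mulf_eq0 => /orP[/eqP//|].
rewrite gt_eqF// (bigD1 x)//= ltr_pwDl// sumr_ge0// => y _; exact: ltW.
Qed.

End Reversible_chain.

(** * Discretized chain, corrector and mixing *)

Section Kernel.
Context {R : realType} {S I : finType}.
Variables (tau : I -> S -> S) (c : R).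
Implicit Types (f g : S -> R) (r : I -> S -> R) (x : S) (i : I).

Definition kernel r f x : R := f x + c * generator tau r f x.

(** Approximate solution of the Poisson equation for [f] minus its mean; see
[generator_corrector].  A finite sum has the advantage of a bound that does not
involve the smallest stationary weight. *)
Definition corrector r (n : nat) f x : R := c * \sum_(k < n) iter k (kernel r) f x.

Hypothesis c_ge0 : 0 <= c.
Hypothesis c_small : c * (2 * #|I|%:R) <= 1.

Section Rates.
Variable r : I -> S -> R.
Hypothesis r_ge0 : forall i x, 0 <= r i x.
Hypothesis r_le1 : forall i x, r i x <= 1.

Lemma total_rate_le1 x : c * \sum_i r i x <= 1.
Proof.
have : \sum_i r i x <= #|I|%:R.
  rewrite -sumr_const; apply: ler_sum => i _; exact: r_le1.
have : 0 <= \sum_i r i x by apply: sumr_ge0.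
move: c_small c_ge0; move: (\sum_i r i x) => s; nra.
Qed.

Lemma kernelE f x : kernel r f x =
  (1 - c * \sum_i r i x) * f x + c * \sum_i r i x * f (tau i x).
Proof.
rewrite /kernel /generator.
have -> : \sum_i r i x * (f (tau i x) - f x) =
    \sum_i r i x * f (tau i x) - (\sum_i r i x) * f x.
  by rewrite mulr_suml -sumrB; apply: eq_bigr => i _; ring.
ring.
Qed.

Lemma kernel_norm_le f e : (forall x, `|f x| <= e) -> forall x, `|kernel r f x| <= e.
Proof.
move=> fe x; rewrite kernelE; apply: le_trans (ler_normD _ _) _.
rewrite !normrM (ger0_norm c_ge0) [`|1 - _|]ger0_norm ?subr_ge0 ?total_rate_le1//.
have H : `|\sum_i r i x * f (tau i x)| <= (\sum_i r i x) * e.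
  apply: le_trans (ler_norm_sum _ _ _) _; rewrite mulr_suml.
  by apply: ler_sum => i _; rewrite normrM ger0_norm// ler_wpM2l.
have H1 : (1 - c * \sum_i r i x) * `|f x| <= (1 - c * \sum_i r i x) * e.
  by rewrite ler_wpM2l// subr_ge0 total_rate_le1.
have := ler_wpM2l c_ge0 H; move: H1; lra.
Qed.

Lemma kernel_itv01 f : (forall x, 0 <= f x <= 1) ->
  forall x, 0 <= kernel r f x <= 1.
Proof.
move=> f01 x; rewrite kernelE; have t1 := total_rate_le1 x.
have f0 y : 0 <= f y by case/andP: (f01 y).
have f1 y : f y <= 1 by case/andP: (f01 y).
have s0 : 0 <= \sum_i r i x * f (tau i x) by apply: sumr_ge0 => i _; rewrite mulr_ge0.
have s1 : \sum_i r i x * f (tau i x) <= \sum_i r i x.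
  by apply: ler_sum => i _; rewrite ler_piMr.
apply/andP; split; first by rewrite addr_ge0// mulr_ge0// subr_ge0.
have H1 : (1 - c * \sum_i r i x) * f x <= (1 - c * \sum_i r i x) * 1.
  by rewrite ler_wpM2l// subr_ge0.
by have := ler_wpM2l c_ge0 s1; move: H1; lra.
Qed.

Lemma iter_kernel_itv01 f k : (forall x, 0 <= f x <= 1) ->
  forall x, 0 <= iter k (kernel r) f x <= 1.
Proof. by move=> f01; elim: k => //= k IH; exact: kernel_itv01. Qed.

Lemma corrector_itv f n x : (forall x, 0 <= f x <= 1) ->
  0 <= corrector r n f x <= c * n%:R.
Proof.
move=> f01; rewrite /corrector mulr_ge0//=; last first.
  by apply: sumr_ge0 => k _; case/andP: (iter_kernel_itv01 k f01 x).
rewrite ler_wpM2l//; apply: (@le_trans _ _ (\sum_(k < n) 1)); last first.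
  by rewrite sumr_const card_ord.
by apply: ler_sum => k _; case/andP: (iter_kernel_itv01 k f01 x).
Qed.

(** Telescoping, since [c * generator f = kernel f - f]. *)
Lemma generator_corrector f n x :
  generator tau r (corrector r n f) x = iter n (kernel r) f x - f x.
Proof.
elim: n => [|n IH].
  rewrite /= subrr /generator big1// => i _.
  by rewrite /corrector !big_ord0 !mulr0 subrr mulr0.
have E y : corrector r n.+1 f y = corrector r n f y + c * iter n (kernel r) f y.
  by rewrite /corrector big_ord_recr /= mulrDr.
have -> : generator tau r (corrector r n.+1 f) x =
    generator tau r (corrector r n f) x + c * generator tau r (iter n (kernel r) f) x.
  rewrite /generator mulr_sumr -big_split /=; apply: eq_bigr => i _.
  by rewrite !E; ring.
by rewrite IH /= /kernel; ring.
Qed.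

End Rates.

Section Comparison.
Variables r r' : I -> S -> R.
Hypothesis r_ge0 : forall i x, 0 <= r i x.
Hypothesis r_le1 : forall i x, r i x <= 1.
Hypothesis r'_ge0 : forall i x, 0 <= r' i x.
Hypothesis r'_le1 : forall i x, r' i x <= 1.
Variable e : R.
Hypothesis close : forall x, \sum_i `|r i x - r' i x| <= e.

(** One step of each kernel adds the distance of the kernels, and the kernels are
contractions for the sup norm. *)
Lemma iter_kernel_close f k x : (forall x, 0 <= f x <= 1) ->
  `|iter k (kernel r) f x - iter k (kernel r') f x| <= k%:R * (c * e).
Proof.
move=> f01; elim: k x => [|k IH] x; first by rewrite subrr normr0 mul0r.
set u := iter k (kernel r) f in IH *; set v := iter k (kernel r') f in IH *.
have v01 : forall x, 0 <= v x <= 1 by exact: iter_kernel_itv01.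
rewrite !iterS -/u -/v.
have -> : kernel r u x - kernel r' v x = kernel r (fun y => u y - v y) x +
    c * \sum_i (r i x - r' i x) * (v (tau i x) - v x).
  rewrite /kernel /generator !mulr_sumr.
  rewrite opprD addrACA -[RHS]addrA; congr (_ + _).
  by rewrite -sumrN -!big_split /=; apply: eq_bigr => i _; ring.
apply: le_trans (ler_normD _ _) _; rewrite -natr1 mulrDl mul1r; apply: lerD.
  exact: kernel_norm_le.
rewrite normrM ger0_norm// ler_wpM2l//; apply: le_trans (close x).
apply: le_trans (ler_norm_sum _ _ _) _; apply: ler_sum => i _.
rewrite normrM ler_piMr// ler_norml.
move: (v01 x) (v01 (tau i x)) => /andP[? ?] /andP[? ?]; apply/andP; split; lra.
Qed.

Lemma corrector_close f n x : (forall x, 0 <= f x <= 1) ->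
  `|corrector r n f x - corrector r' n f x| <= c ^+ 2 * n%:R ^+ 2 * e.
Proof.
move=> f01; have e0 : 0 <= e by apply: le_trans (close x); apply: sumr_ge0.
rewrite /corrector -mulrBr -sumrB normrM ger0_norm//.
have -> : c ^+ 2 * n%:R ^+ 2 * e = c * (\sum_(k < n) n%:R * (c * e)).
  by rewrite sumr_const card_ord -mulr_natl; ring.
rewrite ler_wpM2l//; apply: le_trans (ler_norm_sum _ _ _) _.
apply: ler_sum => k _; apply: le_trans (iter_kernel_close _ _ f01) _.
by rewrite ler_wpM2r ?mulr_ge0// ler_nat ltnW.
Qed.

End Comparison.

Section Mixing.
Variables (w : S -> R) (r : I -> S -> R) (l : R).
Hypothesis w_gt0 : forall x, 0 < w x.
Hypothesis r_ge0 : forall i x, 0 <= r i x.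
Hypothesis r_le1 : forall i x, r i x <= 1.
Hypothesis tauK : forall i, involutive (tau i).
Hypothesis reversible : forall i x, w x * r i x = w (tau i x) * r i (tau i x).
Hypothesis poincare_l : forall f, dot w (fun=> 1) f = 0 ->
  l * dot w f f <= dirichlet w tau r f f.

(** Expand the square: the first-order term is [- 2 * c] times the Dirichlet form,
and the second-order one is at most [c] times it because [c] is small. *)
Lemma kernel_contraction f : dot w (fun=> 1) f = 0 ->
  dot w (kernel r f) (kernel r f) <= expR (- (c * l)) * dot w f f.
Proof.
move=> f1; rewrite /kernel dotD dot_generator// mulrN.
have gl := generator_norm_le tau w_gt0 r_ge0 r_le1 f.
have d0 := dirichlet_ge0 tau w_gt0 r_ge0 f.
have pl := poincare_l f1.
have ff := dot_ge0 w_gt0 f.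
have e1 : 1 - c * l <= expR (- (c * l)) by rewrite expR_ge1Dx.
apply: le_trans (ler_wpM2r ff e1).
have := ler_wpM2l (sqr_ge0 c) gl.
have : c ^+ 2 * (2 * #|I|%:R * dirichlet w tau r f f) <= c * dirichlet w tau r f f.
  have -> : c ^+ 2 * (2 * #|I|%:R * dirichlet w tau r f f) =
    c * (2 * #|I|%:R) * (c * dirichlet w tau r f f) by ring.
  by rewrite ler_piMl// mulr_ge0.
have := ler_wpM2l c_ge0 pl.
move: (dirichlet _ _ _ _ _) (dot _ _ _) (dot _ _ _) => D G F; lra.
Qed.

Lemma kernel_mean0 f : dot w (fun=> 1) f = 0 -> dot w (fun=> 1) (kernel r f) = 0.
Proof.
move=> f1; apply: dot1_combination => //.
rewrite /dot; under eq_bigr do rewrite mul1r.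
exact: dot_generator1.
Qed.

Lemma iter_kernel_contraction f n : dot w (fun=> 1) f = 0 ->
  dot w (iter n (kernel r) f) (iter n (kernel r) f)
    <= expR (- (c * l * n%:R)) * dot w f f.
Proof.
move=> f1; have mean0 k : dot w (fun=> 1) (iter k (kernel r) f) = 0.
  by elim: k => //= k; exact: kernel_mean0.
elim: n => [|n IH]; first by rewrite mulr0 oppr0 expR0 mul1r.
rewrite iterS; apply: le_trans (kernel_contraction (mean0 n)) _.
rewrite -natr1 mulrDr mulr1 opprD addrC expRD -mulrA.
by rewrite ler_wpM2l// expR_ge0.
Qed.

(** The weighted square norm of the centered function controls its value at each
point, at the price of the weight [w x]. *)
Lemma iter_kernel_mixing f n x : (forall x, 0 <= f x <= 1) ->
  w x * (iter n (kernel r) f x - (\sum_y w y * f y) / \sum_y w y) ^+ 2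
    <= expR (- (c * l * n%:R)) * \sum_y w y.
Proof.
move=> f01; set W := \sum_y w y; set m := _ / W.
have W0 : 0 < W.
  rewrite /W (bigD1 x)//= ltr_pwDl// sumr_ge0// => y _; exact: ltW.
have mW : m * W = \sum_y w y * f y by rewrite divfK ?gt_eqF.
have m01 : 0 <= m <= 1.
  apply/andP; split.
    by rewrite divr_ge0 ?(ltW W0)// sumr_ge0// => y _; rewrite mulr_ge0 ?(ltW (w_gt0 _))//; case/andP: (f01 y).
  rewrite ler_pdivrMr// mul1r; apply: ler_sum => y _.
  by rewrite ler_piMr ?(ltW (w_gt0 _))//; case/andP: (f01 y).
pose g y := f y - m.
have iterE k y : iter k (kernel r) g y = iter k (kernel r) f y - m.
  elim: k y => //= k IH y; rewrite /kernel /generator IH.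
  rewrite (eq_bigr (fun i => r i y * (iter k (kernel r) f (tau i y) - iter k (kernel r) f y))); first by ring.
  by move=> i _; rewrite !IH; ring.
have g1 : dot w (fun=> 1) g = 0.
  rewrite /dot /g (eq_bigr (fun y => w y * f y - m * w y)); last by move=> y _; ring.
  by rewrite sumrB -mulr_sumr -/W mW subrr.
have gg : dot w g g <= W.
  apply: ler_sum => y _; rewrite ler_piMr ?(ltW (w_gt0 _))// -expr2 /g.
  have := f01 y; case/andP: m01 => ? ? /andP[? ?]; nra.
apply: (@le_trans _ _ (dot w (iter n (kernel r) g) (iter n (kernel r) g))).
  rewrite /dot (bigD1 x)//= -expr2 iterE lerDl sumr_ge0// => y _.
  by rewrite mulr_ge0 ?(ltW (w_gt0 _))// -expr2 sqr_ge0.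
apply: le_trans (iter_kernel_contraction n g1) _.
by rewrite ler_wpM2l// expR_ge0.
Qed.

End Mixing.

End Kernel.

(** * The fast dynamics as a reversible chain *)

Section Hard_core.
Context {V : finType} {e : rel V}.
Implicit Types (sigma : config e) (v w : V) (q : {ffun V -> nat}).

Lemma admissibleP (A : {set V}) :
  reflect (forall v w, e v w -> v \in A -> w \notin A) (admissible e A).
Proof.
apply: (iffP forallP) => [H v w evw vA|H v].
  have /forallP/(_ w) := H v; rewrite evw vA /=; by case: (w \in A).
apply/forallP => w; apply/implyP => evw.
by case: (v \in A) (H v w evw) => [/(_ isT)/negbTE ->//|_]; case: (w \in A).
Qed.

(** Activation and deactivation at [v] as a single involution: it fixes [sigma]
when [v] cannot be activated.  Reversible sums can then be reindexed. *)
Definition toggle v sigma : config e :=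
  insubd sigma (if v \in val sigma then val sigma :\ v else v |: val sigma).

Lemma admissible_sub (A B : {set V}) : A \subset B -> admissible e B -> admissible e A.
Proof.
move=> /fintype.subsetP AB /admissibleP BP; apply/admissibleP => v w evw vA.
by apply: contra (BP v w evw (AB _ vA)); exact: AB.
Qed.

Lemma val_toggle_in v sigma : v \in val sigma -> val (toggle v sigma) = val sigma :\ v.
Proof.
move=> vs; rewrite /toggle vs val_insubd.
by rewrite (admissible_sub _ (valP sigma)) ?finset.subsetDl.
Qed.

Lemma toggleK v : involutive (toggle v).
Proof.
move=> sigma; apply: val_inj.
have [vs|vs] := boolP (v \in val sigma).
  have := val_toggle_in vs; set t := toggle v sigma => tE.
  by rewrite /toggle tE setD11 finset.setD1K// val_insubd (valP sigma).
have [adm|nadm] := boolP (admissible e (v |: val sigma)).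
  have E : val (toggle v sigma) = v |: val sigma.
    by rewrite /toggle (negbTE vs) val_insubd adm.
  by rewrite val_toggle_in E ?setU11// finset.setU1K.
have E : toggle v sigma = sigma.
  by apply: val_inj; rewrite /toggle (negbTE vs) val_insubd (negbTE nadm).
by rewrite !E.
Qed.

Definition empty_config : config e.
Proof.
exists finset.set0; apply/admissibleP => v w _; by rewrite inE.
Defined.

Section Rates.
Context {R : realType}.
Variable a : R.

Definition fast_rate q v sigma : R := deact_rate a q sigma v + act_rate a q sigma v.

Definition load q : V -> R := fun v => (q v).+1%:R.

Lemma Psi_plus_itv x : 0 < Psi_plus a x < 1.
Proof.
have p0 : 0 < x.+1%:R `^ a by rewrite powR_gt0 ?ltr0n.
by rewrite /Psi_plus divr_gt0 ?addr_gt0//= ltr_pdivrMr ?addr_gt0// mul1r ltrDr.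
Qed.

Lemma Psi_minus_itv x : 0 < Psi_minus a x < 1.
Proof.
rewrite /Psi_minus subr_gt0; case/andP: (Psi_plus_itv x) => H ->.
by rewrite gtrBl.
Qed.

(** Detailed balance at a single vertex. *)
Lemma Psi_ratio x : Psi_minus a x * x.+1%:R `^ a = Psi_plus a x.
Proof.
have p0 : 0 < x.+1%:R `^ a by rewrite powR_gt0 ?ltr0n.
by rewrite /Psi_minus /Psi_plus; field; rewrite gt_eqF ?addr_gt0.
Qed.

Lemma occ01 sigma v : 0 <= occ R sigma v <= 1.
Proof. by rewrite /occ; case: (_ \in _); rewrite /= ?lexx ?ler01. Qed.

Lemma fast_rate_in q v sigma : v \in val sigma ->
  fast_rate q v sigma = Psi_minus a (q v).
Proof.
by move=> vs; rewrite /fast_rate /deact_rate /act_rate /occ vs subrr !mul0r mul1r addr0.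
Qed.

Lemma fast_rate_notin q v sigma : v \notin val sigma ->
  fast_rate q v sigma = (\prod_(w | e v w) (1 - occ R sigma w)) * Psi_plus a (q v).
Proof.
by move=> vs; rewrite /fast_rate /deact_rate /act_rate {1 2}/occ (negbTE vs) mul0r add0r subr0 mul1r.
Qed.

Lemma vacancy_itv v sigma : 0 <= \prod_(w | e v w) (1 - occ R sigma w) <= 1.
Proof.
rewrite prodr_ge0 ?prodr_ile1// => w _; have /andP[? ?] := occ01 sigma w.
  by rewrite subr_ge0 andbC gerBl; apply/andP.
by rewrite subr_ge0.
Qed.

Lemma fast_rate_itv q v sigma : 0 <= fast_rate q v sigma <= 1.
Proof.
have [vs|vs] := boolP (v \in val sigma).
  by rewrite fast_rate_in//; case/andP: (Psi_minus_itv (q v)) => /ltW -> /ltW ->.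
rewrite fast_rate_notin//; case/andP: (Psi_plus_itv (q v)) => /ltW p0 /ltW p1.
by case/andP: (vacancy_itv v sigma) => ? ?; rewrite mulr_ge0//= mulr_ile1.
Qed.

Lemma weight_gt0 (y : V -> R) sigma : (forall v, 0 < y v) -> 0 < weight a y sigma.
Proof. by move=> y0; apply: prodr_gt0 => v _; rewrite powR_gt0. Qed.

Lemma load_gt0 q v : 0 < load q v.
Proof. by rewrite ltr0n. Qed.

Lemma fast_rate_reversible_in q v sigma : v \in val sigma ->
  weight a (load q) sigma * fast_rate q v sigma =
  weight a (load q) (toggle v sigma) * fast_rate q v (toggle v sigma).
Proof.
move=> vs; have tE := val_toggle_in vs.
rewrite fast_rate_in// fast_rate_notin; last by rewrite tE setD11.
rewrite big1 ?mul1r; last first.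
  move=> w evw; rewrite /occ tE in_setD1.
  have /admissibleP/(_ v w evw vs)/negbTE -> := valP sigma.
  by rewrite andbF subr0.
rewrite /weight (bigD1 v)//= [in RHS](bigD1 v)//=.
rewrite {1}/occ vs mulr1 {2}/occ tE setD11 mulr0 powRr0 mul1r.
rewrite (eq_bigr (fun w => load q w `^ (a * occ R (toggle v sigma) w))); last first.
  by move=> w wv; rewrite /occ tE in_setD1 wv.
by rewrite -Psi_ratio /load; ring.
Qed.

Lemma fast_rate_reversible q v sigma :
  weight a (load q) sigma * fast_rate q v sigma =
  weight a (load q) (toggle v sigma) * fast_rate q v (toggle v sigma).
Proof.
have [vs|vs] := boolP (v \in val sigma); first exact: fast_rate_reversible_in.
have [adm|nadm] := boolP (admissible e (v |: val sigma)).
  have E : val (toggle v sigma) = v |: val sigma.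
    by rewrite /toggle (negbTE vs) val_insubd adm.
  have := @fast_rate_reversible_in q v (toggle v sigma).
  by rewrite E setU11 toggleK => /(_ isT).
suff -> : toggle v sigma = sigma by [].
by apply: val_inj; rewrite /toggle (negbTE vs) val_insubd (negbTE nadm).
Qed.

Lemma fast_generatorE q (h : config e -> R) sigma :
  fast_generator a q h sigma = generator toggle (fast_rate q) h sigma.
Proof.
rewrite /fast_generator /generator -big_split /=; apply: eq_bigr => v _.
rewrite /fast_rate mulrDl.
have [vs|vs] := boolP (v \in val sigma).
  by rewrite /act_rate /toggle /deactivate /occ vs subrr !mul0r.
by rewrite /deact_rate /toggle /activate /occ (negbTE vs) !mul0r.
Qed.

(** Deactivations have positive rate and lead from every configuration to the
empty one. *)
Lemma fast_irreducible q (f : config e -> R) :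
  dirichlet (weight a (load q)) toggle (fast_rate q) f f = 0 ->
  forall sigma rho, f sigma = f rho.
Proof.
move=> D0.
have w0 sigma : 0 < weight a (load q) sigma by apply: weight_gt0 => v; exact: load_gt0.
have term0 sigma v : 0 <= weight a (load q) sigma * fast_rate q v sigma *
    ((f (toggle v sigma) - f sigma) * (f (toggle v sigma) - f sigma)).
  rewrite mulr_ge0 -?expr2 ?sqr_ge0// mulr_ge0 ?(ltW (w0 _))//.
  by case/andP: (fast_rate_itv q v sigma).
have deact sigma v : v \in val sigma -> f (toggle v sigma) = f sigma.
  move=> vs; move/eqP: D0; rewrite /dirichlet mulf_eq0 invr_eq0 pnatr_eq0 /=.
  rewrite psumr_eq0 => [/allP/(_ sigma)|rho _]; last by apply: sumr_ge0 => w _.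
  rewrite mem_index_enum => /(_ isT); rewrite psumr_eq0// => /allP/(_ v).
  rewrite mem_index_enum => /(_ isT) /=.
  rewrite -mulrA mulf_eq0 (gt_eqF (w0 _)) fast_rate_in//=.
  rewrite mulf_eq0 gt_eqF ?mulf_eq0 ?orbb/=; last by case/andP: (Psi_minus_itv (q v)).
  by rewrite subr_eq0 => /eqP.
have to_empty sigma : f sigma = f empty_config.
  move: {2}#|val sigma| (erefl #|val sigma|) => n.
  elim: n sigma => [|n IH] sigma.
    by move=> /cards0_eq s0; congr f; apply: val_inj; rewrite s0.
  move=> sn; have /card_gt0P[v vs] : (0 < #|val sigma|)%N by rewrite sn.
  rewrite -(deact _ _ vs); apply: IH; rewrite val_toggle_in//.
  by move: sn; rewrite (cardsD1 v) vs => -[].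
by move=> sigma rho; rewrite !to_empty.
Qed.

(** Every nonzero eigenvalue is at least [spectral_gap], which is their infimum. *)
Lemma fast_poincare q (l : R) : (l%:E <= spectral_gap e a q)%E ->
  forall f, dot (weight a (load q)) (fun=> 1) f = 0 ->
  l * dot (weight a (load q)) f f
    <= dirichlet (weight a (load q)) toggle (fast_rate q) f f.
Proof.
move=> gap; apply: poincare.
- by move=> sigma; apply: weight_gt0 => v; exact: load_gt0.
- by move=> v sigma; case/andP: (fast_rate_itv q v sigma).
- exact: toggleK.
- exact: fast_rate_reversible.
- exact: fast_irreducible.
move=> mu f mu0 f0 eig; rewrite -lee_fin; apply: le_trans gap _.
apply: ereal_inf_lbound; exists mu => //; split => //.
by exists f => // sigma; rewrite fast_generatorE.
Qed.

End Rates.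
End Hard_core.

(** * Dependence of the rates on the queues; the jump generator *)

Lemma bernoulli_le {R : realFieldType} (t : R) (n : nat) : 0 <= t <= 1 ->
  1 - n%:R * (1 - t) <= t ^+ n.
Proof.
move=> /andP[t0 t1]; elim: n => [|n IH]; first by rewrite mul0r subr0 expr0.
rewrite exprS -natr1; apply: le_trans (ler_wpM2l t0 IH).
have n0 : 0 <= (n%:R : R) by [].
have : 0 <= n%:R * (1 - t) ^+ 2 by rewrite mulr_ge0// sqr_ge0.
rewrite -subr_ge0 => H; rewrite -subr_ge0; apply: le_trans H _.
by rewrite le_eqVlt; apply/orP; left; apply/eqP; ring.
Qed.

(** Mean value inequality for a real power, from Bernoulli applied to [x / y] with
an integer exponent above [a]. *)
Lemma powR_increment_le {R : realType} (a x y : R) (n : nat) :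
  a <= n%:R -> 0 < x -> x <= y ->
  y `^ a - x `^ a <= n%:R * (y `^ a / y) * (y - x).
Proof.
move=> an x0 xy; have y0 : 0 < y by exact: lt_le_trans xy.
have t01 : 0 < x / y <= 1 by rewrite divr_gt0//= ler_pdivrMr// mul1r.
have -> : x `^ a = (x / y) `^ a * y `^ a.
  by rewrite -powRM ?divfK ?gt_eqF// ltW// divr_gt0.
have /andP[t0 t1] := t01.
have H1 : (x / y) ^+ n <= (x / y) `^ a.
  by rewrite -powR_mulrn ?(ltW t0)//; apply: ger_powR.
have H2 := @bernoulli_le R (x / y) n; rewrite (ltW t0) t1 in H2.
have H3 := le_trans (H2 isT) H1.
have ya : 0 <= y `^ a by exact: powR_ge0.
have -> : n%:R * (y `^ a / y) * (y - x) = n%:R * (1 - x / y) * y `^ a.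
  by field; rewrite gt_eqF.
have -> : y `^ a - (x / y) `^ a * y `^ a = (1 - (x / y) `^ a) * y `^ a by ring.
by rewrite ler_wpM2r// lerBlDl -lerBlDr.
Qed.

Section Psi_increment.
Context {R : realType}.
Variables (a : R) (n : nat).
Hypothesis a_gt0 : 0 < a.
Hypothesis an : a <= n%:R.

(** The relative increment of [x.+1 `^ a] is [O(1 / x)], and [Psi_plus] is a
Lipschitz function of its logarithm. *)
Lemma Psi_plus_increment x :
  `|Psi_plus a x.+1 - Psi_plus a x| <= n%:R / x.+2%:R.
Proof.
set X : R := x.+1%:R `^ a; set Y : R := x.+2%:R `^ a.
have X0 : 0 < X by rewrite powR_gt0 ?ltr0n.
have Y0 : 0 < Y by rewrite powR_gt0 ?ltr0n.
have XY : X <= Y by rewrite /X /Y ge0_ler_powR ?nnegrE ?ler_nat ?(ltW a_gt0).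
have inc : Y - X <= n%:R / x.+2%:R * Y.
  have := @powR_increment_le R a x.+1%:R x.+2%:R n an; rewrite ltr0n ler_nat.
  move=> /(_ isT (leqnSn _)); rewrite -/X -/Y => /le_trans; apply.
  rewrite -[x.+2%:R in X in _ * (X - _)]natr1 [_%:R + 1]addrC addrK mulr1.
  by rewrite le_eqVlt; apply/orP; left; apply/eqP; ring.
have -> : Psi_plus a x.+1 - Psi_plus a x = (Y - X) / ((1 + X) * (1 + Y)).
  by rewrite /Psi_plus -/X -/Y; field; rewrite !gt_eqF ?addr_gt0.
rewrite ger0_norm; last by rewrite divr_ge0 ?subr_ge0// mulr_ge0 ?addr_ge0 ?ltW.
have d0 : 0 < (1 + X) * (1 + Y) by rewrite mulr_gt0 ?addr_gt0.
rewrite ler_pdivrMr//; apply: le_trans inc _.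
rewrite ler_wpM2l ?divr_ge0//.
have : 0 < X * Y by rewrite mulr_gt0.
nra.
Qed.

Context {V : finType} {e : rel V}.
Implicit Types (sigma : config e) (v w : V) (q : {ffun V -> nat}).

(** Only the rate at [w] changes. *)
Lemma fast_rate_increment q w sigma :
  \sum_v `|fast_rate a (arrive q w) v sigma - fast_rate a q v sigma|
    <= n%:R / load q w.
Proof.
rewrite (bigD1 w)//= [X in _ + X]big1 ?addr0; last first.
  move=> v vw; rewrite /fast_rate /deact_rate /act_rate /arrive ffunE.
  by rewrite (negbTE vw) addn0 subrr normr0.
have qE : arrive q w w = (q w).+1 by rewrite /arrive ffunE eqxx addn1.
have psi : `|Psi_plus a (q w).+1 - Psi_plus a (q w)| <= n%:R / load q w.
  apply: le_trans (Psi_plus_increment _) _; rewrite /load ler_wpM2l//.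
  by rewrite lef_pV2 ?posrE ?ltr0n// ler_nat.
have [ws|ws] := boolP (w \in val sigma).
  rewrite !fast_rate_in// qE /Psi_minus opprB addrC addrA subrK -normrN opprB.
  exact: psi.
rewrite !fast_rate_notin// qE -mulrBr normrM; apply: le_trans psi.
have /andP[v0 v1] := @vacancy_itv V e R w sigma.
by rewrite ger0_norm// ler_piMl.
Qed.

End Psi_increment.

Lemma sum_of_four_atoms {R : nzRingType} {T : eqType} (D : T -> R) (B : seq T)
    (z1 z2 z3 z4 : T) (k1 k2 k3 k4 : R) : uniq B ->
  z1 \in B -> z2 \in B -> z3 \in B -> z4 \in B ->
  \sum_(y <- B) (k1 * (y == z1)%:R + k2 * (y == z2)%:R + k3 * (y == z3)%:R
    + k4 * (y == z4)%:R) * D y = k1 * D z1 + k2 * D z2 + k3 * D z3 + k4 * D z4.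
Proof.
move=> uB H1 H2 H3 H4.
have pick k z : z \in B -> k * D z = \sum_(y <- B) k * (y == z)%:R * D y.
  move=> zB; rewrite (bigD1_seq z)//= eqxx mulr1 big1 ?addr0// => y /negbTE ->.
  by rewrite mulr0 mul0r.
rewrite (pick k1 z1)// (pick k2 z2)// (pick k3 z3)// (pick k4 z4)// -!big_split /=.
by apply: eq_bigr => y _; rewrite !mulrDl.
Qed.

Section Jump_generator.
Context {V : finType} {e : rel V} {R : realType}.
Variables (a : R) (lam : V -> R).
Hypothesis lam_gt0 : forall v, 0 < lam v.
Implicit Types (sigma : config e) (v w : V) (q : {ffun V -> nat}).

Lemma jump_rate_ge0 x y : 0 <= jump_rate e a lam x y.
Proof.
case: x => q sigma; apply: sumr_ge0 => v _.
have /andP[p0 p1] := Psi_plus_itv a (q v).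
have /andP[m0 m1] := Psi_minus_itv a (q v).
have /andP[u0 u1] := @occ01 V e R sigma v.
have /andP[c0 c1] := @vacancy_itv V e R v sigma.
have l0 := ltW (lam_gt0 v).
rewrite /deact_rate /act_rate.
by rewrite !addr_ge0// !mulr_ge0// ?subr_ge0// ltW.
Qed.

Definition contains_jumps (B : seq ({ffun V -> nat} * config e))
    (x : {ffun V -> nat} * config e) : Prop :=
  forall v, [/\ (arrive x.1 v, x.2) \in B, (depart x.1 v, x.2) \in B
    & forall sigma, (x.1, sigma) \in B].

Lemma jump_rate_out B x y : contains_jumps B x -> y \notin B ->
  jump_rate e a lam x y = 0.
Proof.
case: x => q sigma H yB; rewrite /jump_rate big1// => v _.
have /= [Ha Hd Hf] := H v.
have ne z : z \in B -> (y == z) = false.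
  by move=> zB; apply/negP => /eqP yz; rewrite yz zB in yB.
by rewrite !ne// !mulr0 !addr0.
Qed.

(** Splits the generator of the chain into its slow and fast parts. *)
Lemma jump_generatorE B q sigma (f : {ffun V -> nat} * config e -> R) : uniq B ->
  contains_jumps B (q, sigma) ->
  \sum_(y <- B | y != (q, sigma))
     jump_rate e a lam (q, sigma) y * (f y - f (q, sigma)) =
  \sum_v (lam v * (f (arrive q v, sigma) - f (q, sigma))
    + occ R sigma v * (0 < q v)%N%:R * (f (depart q v, sigma) - f (q, sigma)))
  + generator toggle (fast_rate a q) (fun rho => f (q, rho)) sigma.
Proof.
move=> uB H; set x := (q, sigma).
transitivity (\sum_(y <- B) jump_rate e a lam x y * (f y - f x)).
  rewrite [RHS](bigID (fun y => y != x))/= [X in _ + X]big1 ?addr0//.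
  by move=> y /negPn/eqP ->; rewrite subrr mulr0.
have -> : generator toggle (fast_rate a q) (fun rho => f (q, rho)) sigma =
    \sum_v (deact_rate a q sigma v * (f (q, deactivate sigma v) - f x) +
            act_rate a q sigma v * (f (q, activate sigma v) - f x)).
  by rewrite -fast_generatorE /fast_generator big_split.
rewrite -big_split /=.
transitivity (\sum_v \sum_(y <- B)
   (lam v * (y == (arrive q v, sigma))%:R
     + occ R sigma v * (0 < q v)%N%:R * (y == (depart q v, sigma))%:R
     + deact_rate a q sigma v * (y == (q, deactivate sigma v))%:R
     + act_rate a q sigma v * (y == (q, activate sigma v))%:R) * (f y - f x)).
  by rewrite exchange_big; apply: eq_bigr => y _; rewrite /jump_rate /x mulr_suml.
apply: eq_bigr => v _; have /= [Ha Hd Hf] := H v.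
rewrite (sum_of_four_atoms (fun y => f y - f x) _ _ _ _ uB Ha Hd (Hf _) (Hf _)).
by rewrite addrA.
Qed.

End Jump_generator.

(** * Lipschitz regularity and concentration of the stationary law *)

Section Lipschitz.
Context {R : realType} {V : finType}.
Implicit Types (x y : V -> R) (f g : (V -> R) -> R) (D : set (V -> R)).

Definition dist1 x y : R := \sum_v `|x v - y v|.

Definition bounded_lipschitz D f : Prop := exists2 C : R, 0 <= C &
  (forall x, D x -> `|f x| <= C) /\
  (forall x y, D x -> D y -> `|f x - f y| <= C * dist1 x y).

Lemma dist1_ge0 x y : 0 <= dist1 x y.
Proof. by apply: sumr_ge0 => v _; exact: normr_ge0. Qed.

Lemma bounded_lipschitz_cst D (k : R) : bounded_lipschitz D (fun=> k).
Proof.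
exists `|k| => //; split => // x y _ _.
by rewrite subrr normr0 mulr_ge0// dist1_ge0.
Qed.

Lemma bounded_lipschitzD D f g : bounded_lipschitz D f -> bounded_lipschitz D g ->
  bounded_lipschitz D (fun x => f x + g x).
Proof.
move=> [A A0 [fA fL]] [B B0 [gB gL]]; exists (A + B); first exact: addr_ge0.
split => [x Dx|x y Dx Dy].
  by apply: le_trans (ler_normD _ _) _; apply: lerD; [exact: fA|exact: gB].
rewrite opprD addrACA mulrDl; apply: le_trans (ler_normD _ _) _.
by apply: lerD; [exact: fL|exact: gL].
Qed.

Lemma bounded_lipschitzM D f g : bounded_lipschitz D f -> bounded_lipschitz D g ->
  bounded_lipschitz D (fun x => f x * g x).
Proof.
move=> [A A0 [fA fL]] [B B0 [gB gL]]; exists (A * B + A * B).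
  by rewrite addr_ge0// mulr_ge0.
split => [x Dx|x y Dx Dy].
  rewrite normrM; apply: le_trans (_ : A * B <= _).
    by apply: ler_pM => //; [exact: fA|exact: gB].
  by rewrite lerDl mulr_ge0.
have -> : f x * g x - f y * g y = f x * (g x - g y) + (f x - f y) * g y by ring.
apply: le_trans (ler_normD _ _) _; rewrite !normrM mulrDl; apply: lerD.
  by rewrite -mulrA; apply: ler_pM => //; [exact: fA|exact: gL].
rewrite [A * B * _]mulrAC; apply: ler_pM => //; [exact: fL|exact: gB].
Qed.

Lemma bounded_lipschitz_sum D (J : Type) (s : seq J) (Q : pred J) (F : J -> (V -> R) -> R) :
  (forall j, bounded_lipschitz D (F j)) ->
  bounded_lipschitz D (fun x => \sum_(j <- s | Q j) F j x).
Proof.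
move=> H; elim: s => [|j s IH].
  under eq_fun do rewrite big_nil; exact: bounded_lipschitz_cst.
under eq_fun do rewrite big_cons.
by case: (Q j) => //; exact: bounded_lipschitzD.
Qed.

Lemma bounded_lipschitz_prod D (J : Type) (s : seq J) (Q : pred J) (F : J -> (V -> R) -> R) :
  (forall j, bounded_lipschitz D (F j)) ->
  bounded_lipschitz D (fun x => \prod_(j <- s | Q j) F j x).
Proof.
move=> H; elim: s => [|j s IH].
  under eq_fun do rewrite big_nil; exact: bounded_lipschitz_cst.
under eq_fun do rewrite big_cons.
by case: (Q j) => //; exact: bounded_lipschitzM.
Qed.

Lemma bounded_lipschitzV D f (k : R) : 0 < k -> (forall x, D x -> k <= f x) ->
  bounded_lipschitz D f -> bounded_lipschitz D (fun x => (f x)^-1).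
Proof.
move=> k0 fk [A A0 [fA fL]]; have k20 : 0 < k ^+ 2 by rewrite exprn_gt0.
have f0 x : D x -> 0 < f x by move=> /fk; exact: lt_le_trans.
exists (k^-1 + A / k ^+ 2).
  by rewrite addr_ge0 ?divr_ge0 ?invr_ge0// ltW.
split => [x Dx|x y Dx Dy].
  rewrite gtr0_norm ?invr_gt0 ?f0//; apply: le_trans (_ : k^-1 <= _).
    by rewrite lef_pV2 ?posrE ?f0// fk.
  by rewrite lerDl divr_ge0 ?(ltW k20).
have -> : (f x)^-1 - (f y)^-1 = (f y - f x) / (f x * f y).
  by field; rewrite !gt_eqF ?f0.
rewrite normrM normfV [`|f x * f y|]gtr0_norm ?mulr_gt0 ?f0// distrC.
apply: (@le_trans _ _ (A * dist1 x y / k ^+ 2)).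
  apply: ler_pM => //; [by rewrite invr_ge0 ltW// mulr_gt0 ?f0|exact: fL|].
  rewrite lef_pV2 ?posrE ?mulr_gt0 ?f0// expr2.
  by apply: ler_pM; rewrite ?(ltW k0)// fk.
rewrite mulrAC ler_wpM2r ?dist1_ge0// lerDr invr_ge0; exact: ltW.
Qed.

Definition box (m M : R) : set (V -> R) := [set x | forall v, m <= x v <= M].

Lemma bounded_lipschitz_powR (a m M : R) v : 0 < a -> 0 < m ->
  bounded_lipschitz (box m M) (fun x => x v `^ a).
Proof.
move=> a0 m0.
pose n := (Num.truncn a).+1.
have an : a <= n%:R by rewrite ltW// truncnS_gt.
exists (M `^ a + n%:R * (M `^ a / m)).
  by rewrite addr_ge0 ?powR_ge0// mulr_ge0// divr_ge0 ?powR_ge0// ltW.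
have pow_le x : box m M x -> x v `^ a <= M `^ a.
  move=> /(_ v) /andP[mx xM]; apply: ge0_ler_powR; rewrite ?nnegrE ?(ltW a0)//.
    by rewrite (le_trans (ltW m0)).
  by rewrite (le_trans (ltW m0))// (le_trans mx).
split => [x Dx|x y Dx Dy].
  rewrite ger0_norm ?powR_ge0//; apply: le_trans (pow_le x Dx) _.
  by rewrite lerDl mulr_ge0// divr_ge0 ?powR_ge0// ltW.
wlog yx : x y Dx Dy / y v <= x v.
  move=> H; have [yx|xy] := leP (y v) (x v); first exact: H.
  rewrite distrC; have -> : dist1 x y = dist1 y x.
    by apply: eq_bigr => w _; rewrite distrC.
  by apply: H => //; exact: ltW.
have /andP[mx xM] := Dx v; have /andP[my yM] := Dy v.
have y0 : 0 < y v by exact: lt_le_trans my.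
have x0 : 0 < x v by exact: lt_le_trans mx.
have d1 : x v - y v <= dist1 x y.
  rewrite /dist1 (bigD1 v)//=; apply: le_trans (ler_norm _) _.
  by rewrite lerDl sumr_ge0.
rewrite ger0_norm ?subr_ge0; last first.
  by apply: ge0_ler_powR => //; rewrite ?nnegrE ltW.
apply: le_trans (powR_increment_le an y0 yx) _.
apply: (@le_trans _ _ (n%:R * (M `^ a / m) * dist1 x y)); last first.
  by rewrite ler_wpM2r ?dist1_ge0// lerDr powR_ge0.
apply: ler_pM; [|by rewrite subr_ge0| |exact: d1].
  by rewrite mulr_ge0// divr_ge0 ?powR_ge0// ltW.
rewrite ler_wpM2l//; apply: ler_pM; rewrite ?invr_ge0 ?powR_ge0 ?(ltW x0)//.
  exact: pow_le.
by rewrite lef_pV2 ?posrE.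
Qed.

End Lipschitz.

Section Stationary.
Context {R : realType} {V : finType} {e : rel V}.
Variable a : R.
Hypothesis a_gt0 : 0 < a.
Implicit Types (x y : V -> R) (sigma rho : config e) (v w : V).

Lemma aocc_ge0 sigma w : 0 <= a * occ R sigma w.
Proof. by rewrite mulr_ge0 ?(ltW a_gt0)//; case/andP: (@occ01 _ _ R sigma w). Qed.

Lemma weight_le x y sigma : (forall v, 0 <= x v) -> (forall v, x v <= y v) ->
  weight a x sigma <= weight a y sigma.
Proof.
move=> x0 xy; apply: ler_prod => w _; rewrite powR_ge0/=.
apply: ge0_ler_powR; rewrite ?nnegrE ?aocc_ge0//.
exact: le_trans (x0 w) (xy w).
Qed.

Lemma weight_lipschitz (m M : R) sigma : 0 < m ->
  bounded_lipschitz (box m M) (fun x => weight a x sigma).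
Proof.
move=> m0; apply: bounded_lipschitz_prod => w.
rewrite /occ; case: (w \in val sigma); rewrite ?mulr1 ?mulr0.
  exact: bounded_lipschitz_powR.
under eq_fun do rewrite powRr0.
exact: bounded_lipschitz_cst.
Qed.

Lemma max_config_exists : exists sigma : config e, max_config sigma.
Proof.
have [|sigma _ E] := @eq_bigmax_cond (config e) xpredT (fun sigma => #|val sigma|).
  by apply/card_gt0P; exists empty_config.
by exists sigma; rewrite /max_config /Upsilon E.
Qed.

Definition max_weight x : R := \sum_(rho : config e | max_config rho) weight a x rho.

Lemma max_weight_lower (m M : R) : 0 < m -> exists2 k : R, 0 < k &
  forall x, box m M x -> k <= max_weight x.
Proof.
move=> m0; have [sigma ms] := max_config_exists.
exists (weight a (fun=> m) sigma); first by apply: weight_gt0.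
move=> x Dx; rewrite /max_weight (bigD1 sigma)//=; apply: le_trans (_ : weight a x sigma <= _).
  by apply: weight_le => v; rewrite ?(ltW m0)//; case/andP: (Dx v).
rewrite lerDl sumr_ge0// => rho _; apply: ltW; apply: weight_gt0 => v.
by case/andP: (Dx v) => + _; exact: lt_le_trans.
Qed.

Lemma pibar_lipschitz (m M : R) v : 0 < m ->
  bounded_lipschitz (box m M) (fun x => @pibar V e R a x v).
Proof.
move=> m0; have [k k0 kx] := max_weight_lower M m0.
apply: bounded_lipschitz_sum => sigma; apply: bounded_lipschitzM.
  exact: bounded_lipschitz_cst.
apply: bounded_lipschitzM; first exact: weight_lipschitz.
apply: (bounded_lipschitzV k0) => //.
by apply: bounded_lipschitz_sum => rho; exact: weight_lipschitz.
Qed.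

Lemma pibarE x v : @pibar V e R a x v =
  (\sum_(sigma : config e | max_config sigma) occ R sigma v * weight a x sigma) / max_weight x.
Proof. by rewrite /pibar mulr_suml; apply: eq_bigr => sigma _; rewrite mulrA. Qed.

Lemma occ_weight_le (Q : pred (config e)) x v : (forall v, 0 < x v) ->
  0 <= \sum_(sigma | Q sigma) occ R sigma v * weight a x sigma
    <= \sum_(sigma | Q sigma) weight a x sigma.
Proof.
move=> x0; have w0 sigma : 0 <= weight a x sigma by apply/ltW/weight_gt0.
apply/andP; split.
  by apply: sumr_ge0 => sigma _; rewrite mulr_ge0//; case/andP: (@occ01 _ _ R sigma v).
by apply: ler_sum => sigma _; rewrite ler_piMl//; case/andP: (@occ01 _ _ R sigma v).
Qed.

Lemma max_weight_gt0 x : (forall v, 0 < x v) -> 0 < max_weight x.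
Proof.
move=> x0; have [sigma ms] := max_config_exists.
rewrite /max_weight (bigD1 sigma)//= ltr_pwDl ?weight_gt0// sumr_ge0// => rho _.
exact/ltW/weight_gt0.
Qed.

Lemma pibar_itv x v : (forall v, 0 < x v) -> 0 <= @pibar V e R a x v <= 1.
Proof.
move=> x0; rewrite pibarE; have /andP[s0 s1] := @occ_weight_le max_config x v x0.
have w0 := max_weight_gt0 x0.
by rewrite divr_ge0 ?(ltW w0)//= ler_pdivrMr// mul1r.
Qed.

Lemma weight_scale (N : R) x sigma : 0 < N -> (forall v, 0 < x v) ->
  weight a (fun v => N * x v) sigma = (N `^ a) ^+ #|val sigma| * weight a x sigma.
Proof.
move=> N0 x0; rewrite /weight.
rewrite (eq_bigr (fun w => N `^ (a * occ R sigma w) * x w `^ (a * occ R sigma w))); last first.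
  by move=> w _; rewrite powRM ?ltW.
rewrite big_split /=; congr (_ * _).
rewrite -prodr_const [RHS]big_mkcond /=; apply: eq_bigr => w _.
by rewrite /occ; case: (w \in val sigma); rewrite ?mulr1 ?mulr0 ?powRr0.
Qed.

Definition stationary_occupation x v : R :=
  (\sum_(sigma : config e) weight a x sigma * occ R sigma v) / \sum_(sigma : config e) weight a x sigma.

(** Scaling the queues by [N] multiplies the weight of [sigma] by
[N `^ (a * #|sigma|)]: maximal configurations keep their relative weights and the
others lose a factor [N `^ a] at least. *)
Lemma stationary_concentration (m M : R) : 0 < m -> exists2 K : R, 0 <= K &
  forall (N : R) x v, 1 <= N -> box m M x ->
    `|stationary_occupation (fun v => N * x v) v - @pibar V e R a x v| <= K * N `^ (- a).
Proof.
move=> m0; have [k k0 kx] := max_weight_lower M m0.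
pose K1 := \sum_(sigma : config e) weight a (fun=> M) sigma.
exists (K1 / k).
  by rewrite divr_ge0 ?(ltW k0)// sumr_ge0// => s _; apply: prodr_ge0 => w _; exact: powR_ge0.
move=> N x v N1 Dx; have N0 : 0 < N by exact: lt_le_trans N1.
have x0 w : 0 < x w by case/andP: (Dx w) => + _; exact: lt_le_trans.
pose y w := N * x w.
have y0 w : 0 < y w by rewrite mulr_gt0.
rewrite -/y; set L := N `^ a.
have L0 : 0 < L by rewrite powR_gt0.
have L1 : 1 <= L.
  have E : 1 `^ a = 1 :> R by rewrite powR1.
  by rewrite -E /L ge0_ler_powR ?nnegrE ?(ltW a_gt0) ?(ltW N0).
have LV : N `^ (- a) = L^-1 by rewrite powRN.
pose U := L ^+ (@Upsilon V e).
have U0 : 0 < U by rewrite exprn_gt0.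
have maxW sigma : max_config sigma -> weight a y sigma = U * weight a x sigma.
  by move=> /eqP E; rewrite weight_scale// E.
have -> : @pibar V e R a x v = @pibar V e R a y v.
  rewrite !pibarE /max_weight [in RHS](eq_bigr (fun s => U * (occ R s v * weight a x s))).
    rewrite [X in _ = _ / X](eq_bigr (fun s => U * weight a x s)) => [|s /maxW //].
    rewrite -!mulr_sumr -mulf_div divff ?gt_eqF ?mul1r//.
  by move=> s /maxW ->; ring.
rewrite /stationary_occupation pibarE.
rewrite (eq_bigr (fun s => occ R s v * weight a y s)); last by move=> s _; rewrite mulrC.
rewrite (bigID (@max_config V e))/= [X in _ / X - _](bigID (@max_config V e))/= -/(max_weight y).
have /andP[p0 pZ] := @occ_weight_le (@max_config V e) y v y0.
have /andP[q0 qZ] := @occ_weight_le (fun s => ~~ max_config s) y v y0.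
rewrite -/(max_weight y) in pZ.
have Zm0 := max_weight_gt0 y0.
have Zmk : U * k <= max_weight y.
  rewrite /max_weight (eq_bigr (fun s => U * weight a x s)) => [|s /maxW //].
  by rewrite -mulr_sumr ler_wpM2l ?(ltW U0)//; exact: kx.
(* bound of the total weight of non maximal configurations *)
have ZnK : (\sum_(s : config e | ~~ max_config s) weight a y s) * L <= U * K1.
  rewrite mulr_suml mulr_sumr [leRHS](bigID (@max_config V e))/=.
  apply: ler_wpDl.
    by apply: sumr_ge0 => s _; rewrite mulr_ge0 ?(ltW U0)//; apply: prodr_ge0 => w _; exact: powR_ge0.
  apply: ler_sum => s nmax; rewrite weight_scale// -/L mulrAC.
  have lt : (#|val s| < @Upsilon V e)%N.
    by rewrite ltn_neqAle nmax /=; exact: leq_bigmax_cond.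
  have wM : weight a x s <= weight a (fun=> M) s.
    by apply: weight_le => w; [exact: ltW|case/andP: (Dx w)].
  apply: ler_pM => //; rewrite ?mulr_ge0 ?exprn_ge0 ?(ltW L0)//.
    exact/ltW/weight_gt0.
  by rewrite -exprSr; exact: ler_weXn2l.
have K10 : 0 <= K1.
  by apply: sumr_ge0 => s _; apply: prodr_ge0 => w _; exact: powR_ge0.
have Zn0 : 0 <= \sum_(s : config e | ~~ max_config s) weight a y s := le_trans q0 qZ.
move: p0 pZ q0 qZ Zm0 Zmk ZnK Zn0; rewrite LV.
move: (\sum_(s | _) _) => p.
move: (max_weight y) => Zm p0 pZ.
move: (\sum_(s | _) _) => q.
move: (\sum_(s | _) _) => Zn q0 qZ Zm0 Zmk ZnK Zn0.
have Z0 : 0 < Zm + Zn by rewrite ltr_pwDl.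
have -> : (p + q) / (Zm + Zn) - p / Zm = (q * Zm - p * Zn) / ((Zm + Zn) * Zm).
  by field; rewrite !gt_eqF.
have H : `|q * Zm - p * Zn| <= Zn * Zm.
  have := ler_wpM2r (ltW Zm0) qZ; have := ler_wpM2r Zn0 pZ.
  have := mulr_ge0 p0 Zn0; have := mulr_ge0 q0 (ltW Zm0).
  by rewrite ler_norml; move=> *; apply/andP; split; lra.
rewrite normrM normfV [`|_ * Zm|]gtr0_norm ?mulr_gt0//.
rewrite ler_pdivrMr ?mulr_gt0//; apply: le_trans H _.
rewrite mulrA ler_wpM2r ?(ltW Zm0)//.
apply: (@le_trans _ _ (K1 / k / L * Zm)); last first.
  by rewrite ler_wpM2l ?lerDl// !divr_ge0 ?(ltW k0) ?(ltW L0).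
apply: (@le_trans _ _ (K1 / k / L * (U * k))).
  have -> : K1 / k / L * (U * k) = U * K1 / L by field; rewrite !gt_eqF.
  by rewrite ler_pdivlMr.
by rewrite ler_wpM2l// !divr_ge0 ?(ltW k0) ?(ltW L0).
Qed.

End Stationary.

(** * The perturbed Lyapunov function *)

Lemma slow_rates_le {R : realFieldType} (l k z A1 A2 D N : R) :
  0 <= l -> 0 <= k <= 1 -> 0 <= z ->
  A1 <= 2 * 1 * D / N + z -> A2 <= 2 * -1 * D / N + z ->
  l * A1 + k * A2 <= 2 / N * (D * (l - k)) + (l + 1) * z.
Proof.
move=> l0 /andP[k0 k1] z0 H1 H2.
have := ler_wpM2l l0 H1; have := ler_wpM2l k0 H2.
have : k * z <= 1 * z by rewrite ler_wpM2r.
lra.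
Qed.

Lemma one_step_arithmetic {R : realFieldType} (h F F' N A B T nN W th Lk X : R) :
  F' <= F - 2 * (h / N * B) + 2 * nN * (h / N * T) ->
  2 * (A - B) + (T * (N^-1 + 2 * (W * th + nN)) + 2 * nN * T) <= Lk * F + X ->
  0 <= h / N ->
  F' + h * (2 / N * A + N^-1 * (T * (N^-1 + 2 * (W * th + nN)))) <=
    (1 + Lk * (h / N)) * F + X * (h / N).
Proof.
move=> H1 H2 hN; have := ler_wpM2l hN H2.
have -> : h * (2 / N * A + N^-1 * (T * (N^-1 + 2 * (W * th + nN)))) =
    h / N * (2 * A + T * (N^-1 + 2 * (W * th + nN))) by ring.
move: H1; move: (h / N) => Q; rewrite !mulrDr !mulrDl; lra.
Qed.

Lemma one_step_bracket {R : realFieldType} (L W D2 F eta AB br T5 : R) :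
  L * W * D2 <= L * W * (2 * F + 2 * W * eta) ->
  AB <= L * W * D2 + eta * W -> br <= eta * T5 ->
  2 * AB + br <= 4 * L * W * F + eta * (4 * L * W ^+ 2 + 2 * W + T5).
Proof.
move=> H1 H2 H3.
have -> : 4 * L * W * F + eta * (4 * L * W ^+ 2 + 2 * W + T5) =
  2 * (L * W * (2 * F + 2 * W * eta) + eta * W) + eta * T5 by ring.
by lra.
Qed.

Section Lyapunov.
Context {V : finType} {e : rel V} {R : realType}.
Variables (a : R) (lam : V -> R).
Hypothesis a_gt0 : 0 < a.
Hypothesis lam_gt0 : forall v, 0 < lam v.
Implicit Types (sigma : config e) (v w : V) (q : {ffun V -> nat}) (u : V -> R).

(** Small enough for [I + mixing_step * generator] to be a stochastic and
nonnegative operator. *)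
Definition mixing_step : R := (2 * #|V|.+1%:R)^-1.

Lemma mixing_step_gt0 : 0 < mixing_step.
Proof. by rewrite invr_gt0 mulr_gt0. Qed.

Lemma mixing_step_small : mixing_step * (2 * #|V|%:R) <= 1.
Proof. by rewrite ler_pdivrMl ?mulr_gt0// mulr1 ler_wpM2l// ler_nat. Qed.

Lemma mixing_step_le1 : mixing_step <= 1.
Proof. by rewrite invf_le1 ?mulr_gt0// -natrM ler1n. Qed.

(** The corrector of the occupation of [v]. *)
Definition potential (n : nat) v q sigma : R :=
  corrector toggle mixing_step (fast_rate a q) n (fun rho => occ R rho v) sigma.

Definition averaged (n : nat) v q sigma : R :=
  iter n (kernel toggle mixing_step (fast_rate a q)) (fun rho => occ R rho v) sigma.

Lemma fast_rate_ge0 q v sigma : 0 <= fast_rate a q v sigma.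
Proof. by case/andP: (fast_rate_itv a q v sigma). Qed.

Lemma fast_rate_le1 q v sigma : fast_rate a q v sigma <= 1.
Proof. by case/andP: (fast_rate_itv a q v sigma). Qed.

Lemma potential_itv n v q sigma : 0 <= potential n v q sigma <= n%:R.
Proof.
have /andP[p0 p1] := corrector_itv toggle (ltW mixing_step_gt0) mixing_step_small (fast_rate_ge0 q)
  (fast_rate_le1 q) n sigma (fun rho => occ01 rho v).
rewrite /potential p0 (le_trans p1)// ler_piMl//; exact: mixing_step_le1.
Qed.

(** The increment is quadratic in [n]: each of the [n] terms of the corrector is an
iterate of up to [n] kernels, each perturbed by [O(1 / load q w)]. *)
Lemma potential_increment n k v w q sigma : a <= k%:R ->
  `|potential n v (arrive q w) sigma - potential n v q sigma|
    <= n%:R ^+ 2 * k%:R / load q w.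
Proof.
move=> ak.
have := corrector_close toggle (ltW mixing_step_gt0) mixing_step_small (fast_rate_ge0 (arrive q w))
  (fast_rate_le1 (arrive q w)) (fast_rate_ge0 q) (fast_rate_le1 q)
  (fast_rate_increment a_gt0 ak q w) n sigma (fun rho => occ01 rho v).
move=> /le_trans; apply; rewrite -[leRHS]mulrA ler_wpM2r//.
  by rewrite divr_ge0 ?ler0n.
rewrite ler_piMl ?sqr_ge0//.
by rewrite expr_le1// ?(ltW mixing_step_gt0)// mixing_step_le1.
Qed.

Lemma arrive_depart q v : (0 < q v)%N -> arrive (depart q v) v = q.
Proof.
move=> qv; apply/ffunP => w; rewrite !ffunE; case: eqP => [->|_].
  by rewrite subnK.
by rewrite subn0 addn0.
Qed.

Section Fixed_scale.
Variables (N n : nat).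
Hypothesis N_gt0 : (0 < N)%N.
Variable c0 : R.

Definition deviation u q v : R := (q v)%:R / N%:R - u v.

(** The constant [c0] is there to make this function dominate its first sum on
the states that matter; see [lyapunov_bounds]. *)
Definition lyapunov u (x : {ffun V -> nat} * config e) : R :=
  \sum_v deviation u x.1 v ^+ 2
  - 2 / N%:R * \sum_v deviation u x.1 v * potential n v x.1 x.2 + c0.

(** The generator of the process applied to [lyapunov u], with [u] frozen. *)
Definition lyapunov_drift u (x : {ffun V -> nat} * config e) : R :=
  let: (q, sigma) := x in
  \sum_v (lam v * (lyapunov u (arrive q v, sigma) - lyapunov u (q, sigma))
    + occ R sigma v * (0 < q v)%N%:R *
        (lyapunov u (depart q v, sigma) - lyapunov u (q, sigma)))
  + generator toggle (fast_rate a q) (fun rho => lyapunov u (q, rho)) sigma.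

Let Nr : R := N%:R.
Let Nr_gt0 : 0 < Nr. Proof. by rewrite ltr0n. Qed.

Lemma lyapunov_fast u q sigma :
  generator toggle (fast_rate a q) (fun rho => lyapunov u (q, rho)) sigma =
  - (2 / Nr * \sum_v deviation u q v * (averaged n v q sigma - occ R sigma v)).
Proof.
have E v : generator toggle (fast_rate a q) (potential n v q) sigma =
    averaged n v q sigma - occ R sigma v.
  exact: generator_corrector.
under [in RHS]eq_bigr do rewrite -E /generator mulr_sumr.
rewrite exchange_big /= mulr_sumr -sumrN /generator; apply: eq_bigr => w _.
rewrite /lyapunov /= -/Nr.
have -> : \sum_v deviation u q v *
      (fast_rate a q w sigma * (potential n v q (toggle w sigma) - potential n v q sigma)) =
    fast_rate a q w sigma * (\sum_v deviation u q v * potential n v q (toggle w sigma)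
      - \sum_v deviation u q v * potential n v q sigma).
  by rewrite -sumrB mulr_sumr; apply: eq_bigr => v _; ring.
ring.
Qed.

(** Here [s] is 1 for an arrival and -1 for a departure. *)
Lemma lyapunov_slow u q q' v sigma (s theta : R) : s ^+ 2 = 1 ->
  (forall w, deviation u q' w = deviation u q w + s / Nr * (w == v)%:R) ->
  (forall w, `|deviation u q w| <= 1) ->
  (forall w, `|potential n w q' sigma - potential n w q sigma| <= theta) ->
  lyapunov u (q', sigma) - lyapunov u (q, sigma) <=
    2 * s * deviation u q v / Nr
    + Nr^-1 * (Nr^-1 + 2 * (#|V|%:R * theta + n%:R / Nr)).
Proof.
move=> s2 dE d1 th; rewrite /lyapunov /= -/Nr.
have -> : \sum_w deviation u q' w ^+ 2 =
    \sum_w deviation u q w ^+ 2 + (2 * s * deviation u q v / Nr + Nr^-1 ^+ 2).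
  transitivity (\sum_w (deviation u q w ^+ 2 +
      (2 * s * deviation u q w / Nr + Nr^-1 ^+ 2) * (w == v)%:R)).
    apply: eq_bigr => w _; rewrite dE; case: eqP => _ /=; last by ring.
    have -> : Nr^-1 ^+ 2 = s ^+ 2 * Nr^-1 ^+ 2 by rewrite s2 mul1r.
    by ring.
  rewrite big_split /=; congr (_ + _).
  rewrite (bigD1 v)//= eqxx mulr1 big1 ?addr0// => w /negbTE ->.
  by rewrite mulr0.
have sn : `|s| <= 1.
  have : `|s| ^+ 2 = 1 by rewrite real_normK ?num_real.
  by move=> /eqP; rewrite sqrf_eq1 => /orP[] /eqP ->; lra.
have /andP[H0 Hn] := potential_itv n v q' sigma.
have -> : \sum_w deviation u q' w * potential n w q' sigma =
    \sum_w deviation u q w * potential n w q sigma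
    + (\sum_w deviation u q w * (potential n w q' sigma - potential n w q sigma)
    + s / Nr * potential n v q' sigma).
  transitivity (\sum_w (deviation u q w * potential n w q sigma
    + (deviation u q w * (potential n w q' sigma - potential n w q sigma)
    + s / Nr * potential n w q' sigma * (w == v)%:R))).
    by apply: eq_bigr => w _; rewrite dE; ring.
  rewrite !big_split /=; congr (_ + (_ + _)).
  rewrite (bigD1 v)//= eqxx mulr1 big1 ?addr0// => w /negbTE ->.
  by rewrite mulr0.
set A := \sum_w deviation u q w * (potential n w q' sigma - potential n w q sigma).
have A_le : `|A| <= #|V|%:R * theta.
  apply: le_trans (ler_norm_sum _ _ _) _.
  apply: (@le_trans _ _ (\sum_(w : V) theta)); last by rewrite sumr_const mulr_natl.
  by apply: ler_sum => w _; rewrite normrM -[leRHS]mul1r; apply: ler_pM.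
have B_le : `|s / Nr * potential n v q' sigma| <= n%:R / Nr.
  rewrite normrM normrM (ger0_norm H0) (gtr0_norm (_ : 0 < Nr^-1)) ?invr_gt0//.
  rewrite -mulrA [n%:R / _]mulrC -[leRHS]mul1r; apply: ler_pM => //.
    by rewrite mulr_ge0// invr_ge0 ltW.
  by rewrite ler_wpM2l// invr_ge0 ltW.
have : - (#|V|%:R * theta + n%:R / Nr) <= A + s / Nr * potential n v q' sigma.
  move: A_le B_le; rewrite !ler_norml => /andP[? _] /andP[? _]; lra.
have iN : 0 <= 2 / Nr by rewrite divr_ge0// ltW.
move=> /(ler_wpM2l iN).
move: (A + _) => AB HAB.
lra.
Qed.

Definition total_rate : R := \sum_v (lam v + 1).

(** The corrector replaces the occupation of [v] by [averaged]: the terms in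
[occ R sigma v] from the departures and from the fast part cancel. *)
Lemma lyapunov_drift_le u q sigma (theta : R) :
  (forall v, (0 < q v)%N) -> (forall w, `|deviation u q w| <= 1) ->
  (forall v w, `|potential n w (arrive q v) sigma - potential n w q sigma| <= theta) ->
  (forall v w, `|potential n w (depart q v) sigma - potential n w q sigma| <= theta) ->
  lyapunov_drift u (q, sigma) <=
    2 / Nr * (\sum_v deviation u q v * (lam v - averaged n v q sigma))
    + Nr^-1 * (total_rate * (Nr^-1 + 2 * (#|V|%:R * theta + n%:R / Nr))).
Proof.
move=> q0 d1 tha thd; rewrite /lyapunov_drift lyapunov_fast.
set E := Nr^-1 + _.
have th0 (v : V) : 0 <= theta by apply: le_trans (tha v v); exact: normr_ge0.
have slow v : lam v * (lyapunov u (arrive q v, sigma) - lyapunov u (q, sigma))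
    + occ R sigma v * (0 < q v)%N%:R *
        (lyapunov u (depart q v, sigma) - lyapunov u (q, sigma)) <=
    2 / Nr * (deviation u q v * (lam v - occ R sigma v)) + (lam v + 1) * (Nr^-1 * E).
  have E0 : 0 <= Nr^-1 * E.
    by rewrite mulr_ge0 ?addr_ge0 ?mulr_ge0 ?addr_ge0 ?mulr_ge0 ?(th0 v) ?invr_ge0 ?(ltW Nr_gt0)//.
  have arr := @lyapunov_slow u q (arrive q v) v sigma 1 theta (expr1n _ _) _ d1 (tha v).
  have {}arr : lyapunov u (arrive q v, sigma) - lyapunov u (q, sigma) <=
      2 * 1 * deviation u q v / Nr + Nr^-1 * E.
    apply: arr => w; rewrite /deviation /arrive ffunE natrD -/Nr; ring.
  have dep := @lyapunov_slow u q (depart q v) v sigma (-1) theta _ _ d1 (thd v).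
  have {}dep : lyapunov u (depart q v, sigma) - lyapunov u (q, sigma) <=
      2 * -1 * deviation u q v / Nr + Nr^-1 * E.
    apply: dep; first by rewrite sqrrN expr1n.
    move=> w; rewrite /deviation /depart ffunE -/Nr.
    have [->|_] := eqVneq w v; last by rewrite subn0 /= mulr0 addr0.
    by rewrite natrB// /=; ring.
  rewrite q0 mulr1.
  exact: (slow_rates_le (ltW (lam_gt0 v)) (occ01 sigma v) E0 arr dep).
have := ler_sum (index_enum V) (P := xpredT) (fun v _ => slow v).
rewrite [in leRHS]big_split /= -mulr_sumr -mulr_suml -/total_rate => H.
apply: (le_trans (lerD H (lexx _))).
rewrite addrAC -mulrBr -sumrB [total_rate * _]mulrCA lerD2r.
rewrite (eq_bigr (fun v => deviation u q v * (lam v - averaged n v q sigma)))//.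
by move=> v _; ring.
Qed.

(** Effect of moving [u]; the square of the increment has the favorable sign. *)
Lemma lyapunov_time u u' q sigma (mu : R) :
  \sum_v `|u' v - u v| <= mu ->
  lyapunov u' (q, sigma) <= lyapunov u (q, sigma)
    - 2 * (\sum_v deviation u' q v * (u' v - u v)) + 2 * (n%:R / Nr) * mu.
Proof.
move=> Dmu; rewrite /lyapunov /= -/Nr.
have dE v : deviation u q v = deviation u' q v + (u' v - u v).
  by rewrite /deviation; ring.
have -> : \sum_v deviation u q v ^+ 2 =
   \sum_v deviation u' q v ^+ 2 + 2 * (\sum_v deviation u' q v * (u' v - u v))
   + \sum_v (u' v - u v) ^+ 2.
  by rewrite mulr_sumr -!big_split /=; apply: eq_bigr => v _; rewrite dE; ring.
have -> : \sum_v deviation u q v * potential n v q sigma =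
   \sum_v deviation u' q v * potential n v q sigma
   + \sum_v (u' v - u v) * potential n v q sigma.
  by rewrite -big_split /=; apply: eq_bigr => v _; rewrite dE; ring.
have S0 : 0 <= \sum_v (u' v - u v) ^+ 2 by apply: sumr_ge0 => v _; exact: sqr_ge0.
have P0 : \sum_v (u' v - u v) * potential n v q sigma <= mu * n%:R.
  apply: le_trans (ler_wpM2r (ler0n _ n) Dmu); rewrite mulr_suml; apply: ler_sum => v _.
  have /andP[p0 pn] := potential_itv n v q sigma.
  apply: (@le_trans _ _ (`|u' v - u v| * potential n v q sigma)).
    by rewrite ler_wpM2r// ler_norm.
  by rewrite ler_wpM2l.
have iN : 0 <= 2 / Nr by rewrite divr_ge0// ltW.
have := ler_wpM2l iN P0; lra.
Qed.

Definition error_constant (L : R) : R :=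
  4 * L * #|V|%:R ^+ 2 + 2 * #|V|%:R + total_rate * (2 * #|V|%:R + 5).

(** The displacement [u' - u] cancels [lam] in the drift, and what remains is
[g - averaged], which is a Lipschitz function of the deviation up to [eta]. *)
Lemma lyapunov_one_step u u' q sigma (g : V -> R) (h L theta eta : R) :
  0 < h -> 0 <= L -> 0 <= eta <= 1 ->
  (forall v, (0 < q v)%N) -> (forall w, `|deviation u' q w| <= 1) ->
  (forall v w, `|potential n w (arrive q v) sigma - potential n w q sigma| <= theta) ->
  (forall v w, `|potential n w (depart q v) sigma - potential n w q sigma| <= theta) ->
  (forall v, u' v - u v = h / Nr * (lam v - g v)) ->
  (forall v, 0 <= g v <= 1) ->
  (forall v, `|u' v - u v| <= eta) ->
  (forall v, `|g v - averaged n v q sigma| <= L * (\sum_w `|deviation u' q w|) + eta) ->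
  Nr^-1 <= eta -> theta <= eta -> n%:R / Nr <= eta ->
  \sum_v deviation u q v ^+ 2 <= lyapunov u (q, sigma) ->
  lyapunov u' (q, sigma) + h * lyapunov_drift u' (q, sigma) <=
    (1 + 4 * L * #|V|%:R * (h / Nr)) * lyapunov u (q, sigma)
    + eta * error_constant L * (h / Nr).
Proof.
move=> h0 L0 /andP[eta0 eta1] q0 d1 tha thd Delta g01 Dsmall gavg N_eta th_eta n_eta sq.
have hN0 : 0 <= h / Nr by rewrite divr_ge0 ?(ltW h0).
have Lam0 : 0 <= total_rate by apply: sumr_ge0 => v _; rewrite addr_ge0 ?(ltW (lam_gt0 v)).
have Dmu : \sum_v `|u' v - u v| <= h / Nr * total_rate.
  rewrite mulr_sumr; apply: ler_sum => v _; rewrite Delta normrM ger0_norm//.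
  rewrite ler_wpM2l//; have /andP[g0 g1] := g01 v; have := lam_gt0 v.
  by rewrite ler_norml => ?; apply/andP; split; lra.
have time := lyapunov_time q sigma Dmu.
have drift := lyapunov_drift_le q0 d1 tha thd.
have Hdrift := ler_wpM2l (ltW h0) drift.
pose D1 := \sum_v `|deviation u' q v|.
pose D2 := \sum_v deviation u' q v ^+ 2.
pose W : R := #|V|%:R.
have W0 : 0 <= W by exact: ler0n.
have D1V : D1 <= W.
  rewrite /W -sumr_const; apply: ler_sum => v _; exact: d1.
have D1sq : D1 ^+ 2 <= W * D2.
  apply: le_trans (sqr_sum_le _) _; rewrite ler_wpM2l//.
  by apply: ler_sum => v _; rewrite real_normK ?num_real.
have D10 : 0 <= D1 by apply: sumr_ge0.
have cross : \sum_v deviation u' q v * (g v - averaged n v q sigma)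
    <= L * (W * D2) + eta * W.
  apply: (@le_trans _ _ (D1 * (L * D1 + eta))).
    rewrite /D1 mulr_suml; apply: ler_sum => v _.
    apply: le_trans (ler_norm _) _; rewrite normrM; apply: ler_pM => //.
  rewrite mulrDr; apply: lerD; last by rewrite mulrC ler_wpM2l.
  by rewrite mulrCA -expr2 ler_wpM2l.
have D2le : D2 <= 2 * lyapunov u (q, sigma) + 2 * W * eta.
  apply: (@le_trans _ _ (2 * (\sum_v deviation u q v ^+ 2) + 2 * W * eta)); last first.
    by rewrite lerD2r ler_wpM2l.
  have -> : 2 * W * eta = \sum_(v : V) (2 * eta) by rewrite sumr_const -mulr_natl -/W; ring.
  rewrite mulr_sumr -big_split /=; apply: ler_sum => v _.
  have dE : deviation u' q v = deviation u q v - (u' v - u v) by rewrite /deviation; ring.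
  have x2 : (u' v - u v) ^+ 2 <= eta.
    rewrite -real_normK ?num_real// expr2.
    apply: le_trans (_ : 1 * `|u' v - u v| <= _).
      by rewrite ler_wpM2r// (le_trans (Dsmall v)).
    by rewrite mul1r.
  rewrite dE; move: (deviation u q v) (u' v - u v) x2 => x y y2.
  have : 0 <= (x + y) ^+ 2 by exact: sqr_ge0.
  rewrite expr2 in y2; rewrite !expr2; nra.
have bracket : total_rate * (Nr^-1 + 2 * (W * theta + n%:R / Nr)) + 2 * (n%:R / Nr) * total_rate
    <= eta * (total_rate * (2 * W + 5)).
  have Wth : W * theta <= W * eta by rewrite ler_wpM2l.
  have -> : total_rate * (Nr^-1 + 2 * (W * theta + n%:R / Nr)) + 2 * (n%:R / Nr) * total_rate
     = total_rate * (Nr^-1 + 2 * (W * theta + n%:R / Nr) + 2 * (n%:R / Nr)) by ring.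
  have -> : eta * (total_rate * (2 * W + 5)) = total_rate * (eta + 2 * (W * eta + eta) + 2 * eta) by ring.
  by rewrite ler_wpM2l//; lra.
have Delta_sum : \sum_v deviation u' q v * (u' v - u v) =
    h / Nr * \sum_v deviation u' q v * (lam v - g v).
  by rewrite mulr_sumr; apply: eq_bigr => v _; rewrite Delta; ring.
have cross_split : \sum_v deviation u' q v * (g v - averaged n v q sigma) =
    \sum_v deviation u' q v * (lam v - averaged n v q sigma) -
    \sum_v deviation u' q v * (lam v - g v).
  by rewrite -sumrB; apply: eq_bigr => v _; ring.
rewrite cross_split in cross.
rewrite Delta_sum in time.
apply: le_trans (lerD (lexx _) Hdrift) _.
apply: (one_step_arithmetic time _ hN0).
rewrite -/W in bracket *.
set A := \sum_v _ in cross *; set B := \sum_v _ in cross *.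
have LW0 : 0 <= L * W by rewrite mulr_ge0.
have c2 := ler_wpM2l LW0 D2le.
have E1 : L * (W * D2) = L * W * D2 by ring.
rewrite E1 in cross.
rewrite /error_constant -/W.
exact: (one_step_bracket c2 cross bracket).
Qed.

End Fixed_scale.
End Lyapunov.

(** * Choice of the mixing window *)

Section Asymptotics.
Context {R : realType}.

Lemma near_powR_small (K x eta : R) : 0 < x -> 0 < eta -> 0 <= K ->
  \forall N \near \oo, K * N%:R `^ (- x) <= eta.
Proof.
move=> x0 eta0 K0; pose Y := ((K + 1) / eta) `^ x^-1.
near=> N.
have NY : Y <= N%:R by near: N; exact: nbhs_infty_ger.
have K1 : 0 < K + 1 by rewrite ltr_wpDl.
have Y0 : 0 < Y by rewrite powR_gt0 ?divr_gt0.
have N0 : 0 < (N%:R : R) by exact: lt_le_trans NY.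
have : Y `^ x <= N%:R `^ x by rewrite ge0_ler_powR ?nnegrE ?(ltW x0) ?(ltW Y0) ?(ltW N0).
rewrite -powRrM mulVf ?gt_eqF// powRr1 ?divr_ge0 ?(ltW K1) ?(ltW eta0)//.
rewrite powRN ler_pdivrMr// => H; rewrite ler_pdivrMr ?powR_gt0//.
by rewrite mulrC; apply: le_trans H; rewrite lerDl.
Unshelve. all: by end_near. Qed.

Lemma expR_ge_exprn (x : R) (j : nat) : 0 <= x -> (0 < j)%N -> (x / j%:R) ^+ j <= expR x.
Proof.
move=> x0 j0.
have -> : expR x = expR (x / j%:R) ^+ j.
  by rewrite -expRM_natl mulrC divfK// pnatr_eq0 -lt0n.
rewrite lerXn2r ?nnegrE ?expR_ge0 ?divr_ge0//.
by apply: le_trans (expR_ge1Dx _); rewrite lerDr.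
Qed.

Lemma near_expR_powR_small (k g p S eta : R) : 0 < k -> 0 < g -> 0 <= S -> 0 < eta ->
  \forall N \near \oo, expR (- (k * N%:R `^ g)) * (S * N%:R `^ p) <= eta.
Proof.
move=> k0 g0 S0 eta0.
(* expR x beats (x / j) ^+ j; this j leaves at least one spare power of N *)
pose j := (Num.truncn (`|(p + 1) / g|)).+1.
have jg : p + 1 <= g * j%:R.
  rewrite mulrC -ler_pdivrMr//; apply: le_trans (ler_norm _) _.
  by rewrite ltW// truncnS_gt.
pose K := S * (j%:R / k) ^+ j.
have K0 : 0 <= K by rewrite mulr_ge0// exprn_ge0// divr_ge0 ?(ltW k0).
near=> N.
have N0 : (0 < N)%N by near: N; exact: nbhs_infty_gt.
have N1 : 1 <= (N%:R : R) by rewrite ler1n.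
have Nr0 : 0 < (N%:R : R) by rewrite ltr0n.
have Ng0 : 0 < N%:R `^ g :> R by rewrite powR_gt0.
apply: (@le_trans _ _ (K * N%:R `^ (- 1))); last first.
  by near: N; exact: near_powR_small.
have x0 : 0 <= k * N%:R `^ g by rewrite mulr_ge0 ?(ltW k0) ?(ltW Ng0).
have E := expR_ge_exprn x0 (ltn0Sn _ : (0 < j)%N).
have x1 : 0 < (k * N%:R `^ g / j%:R) ^+ j by rewrite exprn_gt0// divr_gt0// mulr_gt0.
have : expR (- (k * N%:R `^ g)) <= ((k * N%:R `^ g / j%:R) ^+ j)^-1.
  by rewrite expRN lef_pV2 ?posrE ?expR_gt0.
have -> : ((k * N%:R `^ g / j%:R) ^+ j)^-1 = (j%:R / k) ^+ j * N%:R `^ (- (g * j%:R)).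
  rewrite powRN powRrM powR_mulrn ?powR_ge0// -!exprVn -exprMn; congr (_ ^+ _).
  by field; rewrite !gt_eqF.
move=> H; have SN : 0 <= S * N%:R `^ p by rewrite mulr_ge0 ?powR_ge0.
apply: le_trans (ler_wpM2r SN H) _.
rewrite mulrACA mulrC [(j%:R / k) ^+ j * S]mulrC -/K mulrC.
rewrite ler_wpM2l// -powRD ?(gt_eqF Nr0) ?implybT//.
apply: ler_powR => //; lra.
Unshelve. all: by end_near. Qed.

(** Number of terms of the corrector, of order [N `^ b]. *)
Definition window (b : R) (N : nat) : nat := (Num.truncn (N%:R `^ b)).+1.

Lemma window_itv (b : R) (N : nat) : 0 < b -> (0 < N)%N ->
  N%:R `^ b <= (window b N)%:R <= 2 * N%:R `^ b.
Proof.
move=> b0 N0; rewrite /window ltW ?truncnS_gt//=.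
have N1 : 1 <= (N%:R `^ b : R).
  have NR1 : 1 <= (N%:R : R) by rewrite ler1n.
  by have := ler_powR NR1 (ltW b0); rewrite powRr0.
rewrite -natr1 mulr_natl mulr2n lerD//.
by rewrite truncn_le ?powR_ge0.
Qed.

(** The exponent [b] is the midpoint of [a * beta] and [1 / 2].  The third
bound needs [b < 1 / 2]; the last one, which is the mixing error, needs
[a * beta < b] since its exponent is of order [N `^ (b - a * beta)]. *)
Lemma near_window (a beta C c m M A K S p eta : R) :
  0 < a -> 0 < beta -> 2 * a * beta < 1 -> 0 < C -> 0 < c -> 0 < m -> 0 < M ->
  0 <= A -> 0 <= K -> 0 <= S -> 0 < eta ->
  let b := (a * beta + 2^-1) / 2 in
  \forall N \near \oo, [/\ N%:R^-1 <= eta, (window b N)%:R / N%:R <= eta,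
    (window b N)%:R ^+ 2 * A / (m * N%:R) <= eta, K * N%:R `^ (- a) <= eta
  & expR (- (c * (C * (M * N%:R) `^ (- (a * beta))) * (window b N)%:R)) *
      (S * (M * N%:R) `^ p) <= eta ^+ 2].
Proof.
move=> a0 beta0 ab C0 c0 m0 M0 A0 K0 S0 eta0 b.
have ab0 : 0 < a * beta by rewrite mulr_gt0.
have b0 : 0 < b by rewrite divr_gt0// addr_gt0.
have b1 : b < 2^-1 by rewrite /b; lra.
have abb : a * beta < b by rewrite /b; lra.
pose k := c * (C * M `^ (- (a * beta))).
have k0 : 0 < k by rewrite !mulr_gt0// powR_gt0.
have H1 : \forall N \near \oo, 1 * N%:R `^ (- 1) <= eta by exact: near_powR_small.
have H2 : \forall N \near \oo, 2 * N%:R `^ (- (1 - b)) <= eta.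
  by apply: near_powR_small => //; lra.
have H3 : \forall N \near \oo, 4 * A / m * N%:R `^ (- (1 - 2 * b)) <= eta.
  apply: near_powR_small => //; first by lra.
  by rewrite divr_ge0 ?mulr_ge0 ?(ltW m0).
have H4 : \forall N \near \oo, K * N%:R `^ (- a) <= eta by exact: near_powR_small.
have H5 : \forall N \near \oo,
    expR (- (k * N%:R `^ (b - a * beta))) * (S * M `^ p * N%:R `^ p) <= eta ^+ 2.
  apply: near_expR_powR_small => //; rewrite ?subr_gt0 ?exprn_gt0//.
  by rewrite mulr_ge0 ?powR_ge0.
near=> N.
have N0 : (0 < N)%N by near: N; exact: nbhs_infty_gt.
have Nr0 : 0 < (N%:R : R) by rewrite ltr0n.
have /andP[wl wu] := window_itv b0 N0.
have Nb0 : 0 < N%:R `^ b :> R by rewrite powR_gt0.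
have w0 : 0 <= (window b N)%:R :> R by [].
have NV : N%:R^-1 = N%:R `^ (- 1) :> R by rewrite powR_inv1 ?(ltW Nr0).
have N_ne : (N%:R == 0 :> R) = false by rewrite gt_eqF.
split.
- by rewrite NV -[X in X <= _]mul1r; near: N.
- apply: (@le_trans _ _ (2 * N%:R `^ (- (1 - b)))); last by near: N.
  have -> : - (1 - b) = b - 1 by ring.
  rewrite powRD ?N_ne ?implybT// -NV mulrA.
  by rewrite ler_wpM2r// invr_ge0 ltW.
- apply: (@le_trans _ _ (4 * A / m * N%:R `^ (- (1 - 2 * b)))); last by near: N.
  have -> : - (1 - 2 * b) = b + b - 1 by ring.
  rewrite powRD ?N_ne ?implybT// powRD ?N_ne ?implybT// -NV.
  have -> : 4 * A / m * (N%:R `^ b * N%:R `^ b / N%:R) =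
    (2 * N%:R `^ b) ^+ 2 * A / (m * N%:R) by field; rewrite N_ne gt_eqF.
  rewrite ler_wpM2r ?invr_ge0 ?mulr_ge0 ?(ltW m0)// ler_wpM2r//.
  by rewrite lerXn2r ?nnegrE ?mulr_ge0 ?(ltW Nb0).
- by near: N.
have H5N : expR (- (k * N%:R `^ (b - a * beta))) * (S * M `^ p * N%:R `^ p) <= eta ^+ 2.
  by near: N.
apply: le_trans H5N.
rewrite powRM ?(ltW M0) ?(ltW Nr0)// powRM ?(ltW M0) ?(ltW Nr0)//.
have -> : S * (M `^ p * N%:R `^ p) = S * M `^ p * N%:R `^ p by rewrite mulrA.
rewrite ler_wpM2r ?mulr_ge0 ?powR_ge0// ler_expR lerN2.
rewrite powRD ?N_ne ?implybT//.
have -> : c * (C * (M `^ (- (a * beta)) * N%:R `^ (- (a * beta)))) * (window b N)%:R =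
  k * ((window b N)%:R * N%:R `^ (- (a * beta))) by rewrite /k; ring.
by rewrite ler_wpM2l ?(ltW k0)// ler_wpM2r ?powR_ge0.
Unshelve. all: by end_near. Qed.

End Asymptotics.

(** * Averaging error, boxes of states and the ODE solution *)

Section Averaging_error.
Context {V : finType} {e : rel V} {R : realType}.
Variables (a : R).
Hypothesis a_gt0 : 0 < a.
Implicit Types (sigma : config e) (v w : V) (q : {ffun V -> nat}).

Lemma weight_load_ge1 q sigma : 1 <= weight a (load q) sigma.
Proof.
rewrite /weight; elim/big_ind: _ => // [x y x1 y1|w _].
  by rewrite -[leLHS]mulr1 ler_pM.
have H : 1 <= load q w :> R by rewrite /load ler1n.
by have := ler_powR H (aocc_ge0 a_gt0 sigma w); rewrite powRr0.
Qed.

Lemma weight_load_le q sigma (Y : R) : (forall v, load q v <= Y) -> 1 <= Y ->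
  weight a (load q) sigma <= Y `^ (a * #|V|%:R).
Proof.
move=> qY Y1; rewrite powRrM powR_mulrn ?powR_ge0// -prodr_const.
apply: ler_prod => w _; rewrite powR_ge0/=.
apply: (@le_trans _ _ (Y `^ (a * occ R sigma w))).
  apply: ge0_ler_powR; rewrite ?nnegrE ?(aocc_ge0 a_gt0)//.
  exact: le_trans Y1.
apply: ler_powR => //; rewrite ler_piMr ?(ltW a_gt0)//.
by case/andP: (@occ01 _ _ R sigma w).
Qed.

(** The weights [weight a (load q)] are at least 1, and their sum is at most a power
of the largest load, so the mixing bound holds pointwise. *)
Lemma averaged_stationary (n : nat) v q sigma (l Y eta : R) :
  (l%:E <= spectral_gap e a q)%E ->
  (forall v, load q v <= Y) -> 1 <= Y -> 0 <= eta ->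
  expR (- (@mixing_step V R * l * n%:R)) * (#|{: config e}|%:R * Y `^ (a * #|V|%:R)) <= eta ^+ 2 ->
  `|@stationary_occupation R V e a (load q) v - averaged a n v q sigma| <= eta.
Proof.
move=> gap qY Y1 eta0 small.
have w0 (rho : config e) : 0 < weight a (load q) rho by apply: weight_gt0 => w; exact: load_gt0.
have := iter_kernel_mixing (ltW (mixing_step_gt0 (V := V) (R := R))) (mixing_step_small (V := V) (R := R))
  w0 (@fast_rate_ge0 V e R a q) (@fast_rate_le1 V e R a q)
  (@toggleK V e) (@fast_rate_reversible V e R a q)
  (fast_poincare gap) n sigma (fun rho => occ01 rho v).
rewrite -/(averaged a n v q sigma) -/(stationary_occupation a (load q) v).
set z := averaged _ _ _ _ _ - _ => mix.
have W : \sum_(rho : config e) weight a (load q) rho <= #|{: config e}|%:R * Y `^ (a * #|V|%:R).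
  rewrite mulr_natl -sumr_const; apply: ler_sum => rho _; exact: weight_load_le.
rewrite distrC -/z -ler_sqr ?nnegrE// real_normK ?num_real//.
apply: le_trans small; apply: le_trans (_ : weight a (load q) sigma * z ^+ 2 <= _).
  by rewrite ler_peMl ?sqr_ge0// weight_load_ge1.
by apply: le_trans mix _; rewrite ler_wpM2l ?expR_ge0.
Qed.

End Averaging_error.

Section States.
Context {V : finType} {e : rel V}.

Definition states_below (K : nat) : seq ({ffun V -> nat} * config e) :=
  [seq ([ffun v => nat_of_ord (p.1 v)], p.2) | p : {ffun V -> 'I_K} * config e <- enum {: {ffun V -> 'I_K} * config e}].

Lemma states_below_uniq K : uniq (states_below K).
Proof.
rewrite map_inj_uniq ?enum_uniq// => -[f s] [g s'] /= [fg ->]; congr (_, _).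
apply/ffunP => v; apply: val_inj.
by have := congr1 (fun h : {ffun V -> nat} => h v) fg; rewrite !ffunE.
Qed.

Lemma mem_states_below K q (sigma : config e) :
  ((q, sigma) \in states_below K) = [forall v, (q v < K)%N].
Proof.
apply/mapP/forallP => [[[f s] _ [-> _]] v|H]; first by rewrite ffunE.
exists ([ffun v => Ordinal (H v)], sigma); first by rewrite mem_enum.
by congr (_, _); apply/ffunP => v; rewrite !ffunE.
Qed.

End States.

Section Fluid_limit.
Context {V : finType} {e : rel V} {R : realType}.
Variables (a : R) (lam : V -> R).
Variables (q0 : V -> R) (qstar : R -> V -> R) (Tmin Text : \bar R).
Hypothesis sol : ode_solution (drift e a lam) q0 Tmin Text qstar.
Variable T : R.
Hypothesis T_gt0 : 0 < T.
Hypothesis T_lt : (T%:E < Text)%E.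
Implicit Types (v w : V).

Lemma in_domain t : 0 <= t <= T -> (Tmin < t%:E < Text)%E.
Proof.
move=> /andP[t0 tT]; apply/andP; split.
  by apply: lt_le_trans (ode_tm sol) _; rewrite lee_fin.
by apply: le_lt_trans T_lt; rewrite lee_fin.
Qed.

Lemma qstar_gt0 t v : 0 <= t <= T -> 0 < qstar t v.
Proof. by move=> /in_domain; exact: (ode_pos sol). Qed.

Lemma qstar_continuous t v : 0 <= t <= T -> {for t, continuous (qstar^~ v)}.
Proof.
move=> /in_domain tin; apply: differentiable_continuous; apply/derivable1_diffP.
by have [] := ode_deriv sol v tin.
Qed.

Lemma qstar_within v : {within `[0, T], continuous (qstar^~ v)}.
Proof.
apply: continuous_in_subspaceT => t; rewrite inE /= in_itv /=; exact: qstar_continuous.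
Qed.

Lemma qstar_bounds : exists m0 M0 : R, [/\ 0 < m0, 0 <= M0 &
  forall t v, 0 <= t <= T -> m0 <= qstar t v <= M0].
Proof.
have T0 := ltW T_gt0.
have Hmin v : exists k : R, 0 < k /\ forall t, 0 <= t <= T -> k <= qstar t v.
  have [c cin cmin] := EVT_min T0 (@qstar_within v).
  exists (qstar c v); split; first by apply: qstar_gt0; move: cin; rewrite in_itv.
  by move=> t tin; apply: cmin; rewrite in_itv.
have Hmax v : exists k : R, forall t, 0 <= t <= T -> qstar t v <= k.
  have [c cin cmax] := EVT_max T0 (@qstar_within v).
  by exists (qstar c v) => t tin; apply: cmax; rewrite in_itv.
have [k kP] := choice Hmin; have [K KP] := choice Hmax.
have k0 v : 0 < k v by case: (kP v).
have s0 : 0 < 1 + \sum_v (k v)^-1.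
  by rewrite ltr_pwDl// sumr_ge0// => v _; rewrite invr_ge0 ltW.
(* smooth substitutes for the minimum and the maximum over v, valid for every V *)
exists (1 + \sum_v (k v)^-1)^-1, (\sum_v `|K v|).
split; first by rewrite invr_gt0.
  by apply: sumr_ge0.
move=> t v tin; apply/andP; split.
  apply: le_trans (_ : k v <= _); last by case: (kP v) => _; exact.
  rewrite -[leRHS]invrK lef_pV2 ?posrE ?invr_gt0//.
  rewrite (bigD1 v)//= addrCA lerDl addr_ge0// sumr_ge0// => w _.
  by rewrite invr_ge0 ltW.
apply: le_trans (KP v t tin) _; apply: le_trans (ler_norm _) _.
by rewrite (bigD1 v)//= lerDl sumr_ge0.
Qed.

Lemma qstar_increment s t v : 0 <= s -> s < t -> t <= T ->
  exists2 xi, s <= xi <= t &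
    qstar t v - qstar s v = (t - s) * (lam v - @pibar V e R a (qstar xi) v).
Proof.
move=> s0 st tT.
have [||xi xin ->] := @MVT_segment R (qstar^~ v) (fun x => drift e a lam (qstar x) v) s t (ltW st).
- move=> x; rewrite in_itv /= => /andP[sx xt]; apply: (ode_deriv sol); apply: in_domain.
  by rewrite (le_trans s0 (ltW sx)) (le_trans (ltW xt) tT).
- apply: continuous_in_subspaceT => x; rewrite inE /= in_itv /= => /andP[sx xt].
  by apply: qstar_continuous; rewrite (le_trans s0 sx) (le_trans xt tT).
by exists xi; [move: xin; rewrite in_itv|rewrite /drift mulrC].
Qed.

End Fluid_limit.

(** * Staying close to the ODE solution at a fixed scale *)

Section Fixed_scale_bound.
Context {V : finType} {e : rel V} {R : realType}.
Variables (a : R) (lam : V -> R).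
Hypothesis a_gt0 : 0 < a.
Hypothesis lam_gt0 : forall v, 0 < lam v.
Variables (q0 : V -> R) (qstar : R -> V -> R) (Tmin Text : \bar R).
Hypothesis sol : ode_solution (drift e a lam) q0 Tmin Text qstar.
Variable T : R.
Hypothesis T_gt0 : 0 < T.
Hypothesis T_lt : (T%:E < Text)%E.
Variables m0 M0 : R.
Hypothesis m0_gt0 : 0 < m0.
Hypothesis M0_ge0 : 0 <= M0.
Hypothesis qstar_itv : forall t v, 0 <= t <= T -> m0 <= qstar t v <= M0.

(* the margins leave room for the radius of the tube and for one more customer *)
Let m : R := m0 / 2.
Let M : R := M0 + 2.

Variables L K : R.
Hypothesis L_ge0 : 0 <= L.
Hypothesis pibar_lip : forall v x y, box m M x -> box m M y ->
  `|@pibar V e R a x v - @pibar V e R a y v| <= L * dist1 x y.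
Hypothesis concentration : forall (N : R) x v, 1 <= N -> box m M x ->
  `|@stationary_occupation R V e a (fun v => N * x v) v - @pibar V e R a x v|
    <= K * N `^ (- a).
Variable k : nat.
Hypothesis a_le_k : a <= k%:R.
Variables C s : R.
Hypothesis C_gt0 : 0 < C.
Hypothesis s_gt0 : 0 < s.
Hypothesis gap : forall q : {ffun V -> nat},
  ((C * (\max_v (q v).+1)%:R `^ (- s))%:E <= spectral_gap e a q)%E.
Hypothesis V_gt0 : (0 < #|V|)%N.
Variable delta : R.
Hypothesis delta_gt0 : 0 < delta.
Hypothesis delta_le2 : delta <= 2^-1.
Hypothesis delta_le : delta <= m.

Variables (N n : nat) (eta : R).
Hypothesis N_gt0 : (0 < N)%N.
Hypothesis eta_gt0 : 0 < eta.
Hypothesis eta_le1 : eta <= 1.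
Let W : R := #|V|%:R.
Let eta1 : R := (L + L * W + 2) * eta.
Hypothesis eta1_le : eta1 <= 2^-1.
Hypothesis eta_delta : W * eta < delta ^+ 2.
Hypothesis N_eta : N%:R^-1 <= eta.
Hypothesis n_eta : n%:R / N%:R <= eta.
Hypothesis n2_eta : n%:R ^+ 2 * k%:R / (m * N%:R) <= eta.
Hypothesis K_eta : K * N%:R `^ (- a) <= eta.
Hypothesis mixing_eta :
  expR (- (@mixing_step V R * (C * (M * N%:R) `^ (- s)) * n%:R)) *
    (#|{: config e}|%:R * (M * N%:R) `^ (a * W)) <= eta ^+ 2.

Let Nr : R := N%:R.

Local Lemma Nr_gt0 : 0 < Nr. Proof. by rewrite ltr0n. Qed.
Local Lemma m_gt0 : 0 < m. Proof. by rewrite divr_gt0. Qed.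
Local Lemma M_ge2 : 2 <= M. Proof. by rewrite /M lerDr. Qed.
Local Lemma N1 : 1 <= Nr. Proof. by rewrite ler1n. Qed.

(** The Euclidean norm is used, as in [lyapunov]. *)
Definition tube (r t : R) (x : {ffun V -> nat} * config e) : Prop :=
  \sum_v deviation N (qstar (t / N%:R)) x.1 v ^+ 2 < r ^+ 2.

Definition near_start (r : R) (x : {ffun V -> nat} * config e) : Prop :=
  forall v, `|(x.1 v)%:R / N%:R - q0 v| <= r.

Lemma time_itv t : 0 <= t <= Nr * T -> 0 <= t / Nr <= T.
Proof.
move=> /andP[t0 tT]; rewrite divr_ge0 ?(ltW Nr_gt0)//=.
by rewrite ler_pdivrMr ?Nr_gt0// mulrC.
Qed.

Lemma tube_deviation t x v : tube delta t x ->
  `|deviation N (qstar (t / N%:R)) x.1 v| < delta.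
Proof.
move=> H; rewrite -ltr_sqr ?nnegrE ?(ltW delta_gt0)// real_normK ?num_real//.
apply: le_lt_trans H; rewrite (bigD1 v)//= lerDl sumr_ge0// => w _.
exact: sqr_ge0.
Qed.

Lemma tube_queue t x v : 0 <= t <= Nr * T -> tube delta t x ->
  m * Nr <= (x.1 v)%:R <= (M0 + 1) * Nr.
Proof.
move=> /time_itv tT Gx; have := tube_deviation v Gx.
have /andP[q1 q2] := qstar_itv v tT.
rewrite /deviation -/Nr ltr_norml => /andP[d1 d2].
have d0 := delta_le2; have dm := delta_le.
have mE : m0 = 2 * m by rewrite /m; field.
apply/andP; split.
  by rewrite -ler_pdivlMr ?Nr_gt0//; lra.
by rewrite -ler_pdivrMr ?Nr_gt0//; lra.
Qed.

Lemma tube_queue_gt0 t x v : 0 <= t <= Nr * T -> tube delta t x -> (0 < x.1 v)%N.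
Proof.
move=> tT Gx; have /andP[H _] := tube_queue v tT Gx.
by rewrite -(ltr_nat R); apply: lt_le_trans H; rewrite mulr_gt0 ?m_gt0 ?Nr_gt0.
Qed.

Lemma tube_load t x v : 0 <= t <= Nr * T -> tube delta t x ->
  m * Nr <= load x.1 v <= M * Nr.
Proof.
move=> tT Gx; have /andP[H1 H2] := tube_queue v tT Gx.
rewrite /load -natr1; apply/andP; split.
  by apply: le_trans H1 _; rewrite lerDl.
have := N1; rewrite /M; move: H2; rewrite !mulrDl; lra.
Qed.

Definition queue_cap : nat := (Num.truncn (M * Nr)).+1.
Let B := @states_below V e queue_cap.

Lemma queue_capP (j : nat) : (j < queue_cap)%N = (j%:R <= M * Nr).
Proof.
rewrite /queue_cap ltnS truncn_ge_nat//.
by rewrite mulr_ge0 ?(ltW Nr_gt0)// (le_trans _ M_ge2).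
Qed.

Lemma tube_contains_jumps t x : 0 <= t <= Nr * T -> tube delta t x ->
  contains_jumps B x.
Proof.
move=> tT Gx v.
have cap w : ((x.1 w).+1 < queue_cap)%N.
  by rewrite queue_capP; have /andP[_] := tube_load w tT Gx.
split; [| |move=> sigma]; rewrite mem_states_below; apply/forallP => w.
- by rewrite /arrive ffunE; apply: leq_ltn_trans (cap w); rewrite -addn1 leq_add2l leq_b1.
- by rewrite /depart ffunE; apply: leq_ltn_trans (cap w); rewrite leqW// leq_subr.
- by apply: ltn_trans (cap w).
Qed.

Lemma tube_in t x : 0 <= t <= Nr * T -> tube delta t x -> x \in B.
Proof.
move=> tT Gx; have := tube_contains_jumps tT Gx.
have /card_gt0P[v _] := V_gt0.
by case: x Gx => q sigma Gx /(_ v) [_ _ /(_ sigma)].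
Qed.

Definition corrector_cap : R := 2 * W * M * n%:R / Nr.
Let c0 := corrector_cap.
Let F (t : R) (x : {ffun V -> nat} * config e) : R := lyapunov a N n c0 (qstar (t / Nr)) x.

Lemma deviation_bound t x v : 0 <= t <= Nr * T -> x \in B ->
  `|deviation N (qstar (t / Nr)) x.1 v| <= M.
Proof.
case: x => q sigma tT; rewrite mem_states_below => /forallP/(_ v).
rewrite queue_capP -ler_pdivrMr ?Nr_gt0// => qM /=.
have /andP[q1 q2] := qstar_itv v (time_itv tT).
have : 0 <= (q v)%:R / Nr by rewrite divr_ge0 ?(ltW Nr_gt0).
have mm := m0_gt0.
rewrite /deviation -/Nr ler_norml => qq; apply/andP.
by move: qM qq; rewrite /M; split; lra.
Qed.

Lemma lyapunov_bounds t x : 0 <= t <= Nr * T -> x \in B ->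
  \sum_v deviation N (qstar (t / Nr)) x.1 v ^+ 2 <= F t x <=
  \sum_v deviation N (qstar (t / Nr)) x.1 v ^+ 2 + 2 * c0.
Proof.
move=> tT xB.
set S := \sum_v deviation N (qstar (t / Nr)) x.1 v * potential a n v x.1 x.2.
have Sle : `|2 / Nr * S| <= c0.
  have -> : c0 = 2 / Nr * (W * (M * n%:R)) by rewrite /c0 /corrector_cap; ring.
  rewrite normrM ger0_norm ?divr_ge0 ?(ltW Nr_gt0)//.
  rewrite ler_wpM2l ?divr_ge0 ?(ltW Nr_gt0)//.
  apply: le_trans (ler_norm_sum _ _ _) _.
  apply: (@le_trans _ _ (\sum_(v : V) (M * n%:R))); last first.
    by rewrite sumr_const -[leLHS]mulr_natl.
  apply: ler_sum => v _; have /andP[p0 pn] := potential_itv a n v x.1 x.2.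
  rewrite normrM (ger0_norm p0); apply: ler_pM => //.
  exact: deviation_bound.
move: Sle; rewrite ler_norml => /andP[S1 S2].
by rewrite /F /lyapunov -/Nr -/S; apply/andP; split; lra.
Qed.

Lemma qstar_time t h : 0 <= t -> 0 < h -> t + h <= Nr * T -> forall v,
  exists2 xi, t / Nr <= xi <= (t + h) / Nr &
    qstar ((t + h) / Nr) v - qstar (t / Nr) v =
      h / Nr * (lam v - @pibar V e R a (qstar xi) v).
Proof.
move=> t0 h0 tT v.
have lt : t / Nr < (t + h) / Nr by rewrite ltr_pM2r ?invr_gt0 ?Nr_gt0// ltrDl.
have tN0 : 0 <= t / Nr by rewrite divr_ge0 ?(ltW Nr_gt0).
have tNT : (t + h) / Nr <= T by rewrite ler_pdivrMr ?Nr_gt0// mulrC.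
have [xi xin E] := qstar_increment sol T_lt v tN0 lt tNT.
by exists xi => //; rewrite E; congr (_ * _); ring.
Qed.

Lemma qstar_box t : 0 <= t <= T -> box m M (qstar t).
Proof.
move=> tT v; have /andP[q1 q2] := qstar_itv v tT.
have mm := m0_gt0; rewrite /m /M; apply/andP; split; lra.
Qed.

Lemma pibar_qstar t v : 0 <= t <= T -> 0 <= @pibar V e R a (qstar t) v <= 1.
Proof.
move=> tT; apply: pibar_itv => w; have /andP[q1 _] := qstar_itv w tT.
exact: lt_le_trans q1.
Qed.

Lemma qstar_dist1 x y : 0 <= x -> x <= y -> y <= T ->
  dist1 (qstar x) (qstar y) <= total_rate lam * (y - x).
Proof.
move=> x0 xy yT; rewrite /dist1 /total_rate mulr_suml; apply: ler_sum => v _.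
move: xy; rewrite le_eqVlt => /predU1P[->|xy]; first by rewrite !subrr normr0 mulr0.
have [xi /andP[xi0 xi1] E] := qstar_increment sol T_lt v x0 xy yT.
rewrite distrC E normrM mulrC [`|y - x|]gtr0_norm ?subr_gt0//.
rewrite ler_wpM2r ?subr_ge0 ?(ltW xy)//.
have xiT : 0 <= xi <= T by rewrite (le_trans x0 xi0) (le_trans xi1 yT).
have /andP[p0 p1] := pibar_qstar v xiT; have := lam_gt0 v.
by move=> l0; rewrite ler_norml; apply/andP; split; lra.
Qed.

(** Chain of four comparisons: [pibar] at [xi] and at the end of the step (the ODE
solution is Lipschitz), [pibar] at the ODE solution and at the scaled queues
([pibar] is Lipschitz), [pibar] and the stationary law of the fast chain
(concentration on maximal configurations), the stationary law and [averaged]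
(mixing). *)
Lemma averaging_error t h x (xi : R) v : 0 <= t -> 0 < h -> t + h <= Nr * T ->
  tube delta t x -> t / Nr <= xi <= (t + h) / Nr ->
  total_rate lam * (h / Nr) <= eta ->
  `|@pibar V e R a (qstar xi) v - averaged a n v x.1 x.2| <=
    L * (\sum_w `|deviation N (qstar ((t + h) / Nr)) x.1 w|) + eta1.
Proof.
move=> t0 h0 thT Gx /andP[xi0 xi1] hsmall.
have tT : 0 <= t <= Nr * T by rewrite t0 (le_trans _ thT)// lerDl ltW.
have thT' : 0 <= (t + h) / Nr <= T by apply: time_itv; rewrite thT andbT addr_ge0// ltW.
have /andP[th0 th1] := thT'; have /andP[tN0 tN1] := time_itv tT.
have xiT : 0 <= xi <= T by rewrite (le_trans tN0 xi0) (le_trans xi1 th1).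
pose z w := load x.1 w / Nr.
have zbox : box m M z.
  move=> w; have /andP[z1 z2] := tube_load w tT Gx.
  by rewrite /z ler_pdivlMr ?Nr_gt0// z1 ler_pdivrMr ?Nr_gt0.
have zE : (fun w => Nr * z w) = load x.1.
  by apply/funext => w; rewrite /z mulrC divfK ?gt_eqF ?Nr_gt0.
have H1 : `|@pibar V e R a (qstar xi) v - @pibar V e R a (qstar ((t + h) / Nr)) v|
    <= L * eta.
  apply: le_trans (pibar_lip v (qstar_box xiT) (qstar_box thT')) _.
  rewrite ler_wpM2l//; apply: le_trans hsmall.
  apply: le_trans (qstar_dist1 _ xi1 th1) _; first by case/andP: xiT.
  rewrite ler_wpM2l//.
    by apply: sumr_ge0 => w _; rewrite addr_ge0 ?(ltW (lam_gt0 w)).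
  by have -> : h / Nr = (t + h) / Nr - t / Nr by [rewrite -mulrBl addrC addKr]; rewrite lerB.
have H2 : `|@pibar V e R a (qstar ((t + h) / Nr)) v - @pibar V e R a z v| <=
    L * (\sum_w `|deviation N (qstar ((t + h) / Nr)) x.1 w|) + L * W * eta.
  apply: le_trans (pibar_lip v (qstar_box thT') zbox) _.
  rewrite -mulrA -mulrDr ler_wpM2l//.
  have -> : W * eta = \sum_(w : V) eta by rewrite sumr_const -mulr_natl.
  rewrite -big_split /=; apply: ler_sum => w _; rewrite distrC.
  have -> : z w - qstar ((t + h) / Nr) w = deviation N (qstar ((t + h) / Nr)) x.1 w + Nr^-1.
    by rewrite /z /load /deviation -natr1 -/Nr; ring.
  apply: le_trans (ler_normD _ _) _; rewrite lerD2l gtr0_norm// invr_gt0; exact: Nr_gt0.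
have H3 : `|@pibar V e R a z v - @stationary_occupation R V e a (load x.1) v| <= eta.
  by rewrite distrC -zE; apply: le_trans K_eta; exact: concentration N1 zbox.
have H4 : `|@stationary_occupation R V e a (load x.1) v - averaged a n v x.1 x.2| <= eta.
  have Y1 : 1 <= M * Nr by have := M_ge2; have := N1; nra.
  apply: (averaged_stationary a_gt0 v x.2 _ _ Y1 (ltW eta_gt0) mixing_eta).
    apply: le_trans (gap x.1); rewrite lee_fin ler_wpM2l ?(ltW C_gt0)//.
    have mx0 : (0 < \max_v (x.1 v).+1)%N.
      have /card_gt0P[w _] := V_gt0.
      by apply: leq_trans (leq_bigmax_cond (F := fun v => (x.1 v).+1) w isT).
    have mxM : (\max_v (x.1 v).+1)%:R <= M * Nr.
      have [w _ ->] := eq_bigmax_cond (fun v => (x.1 v).+1) (A := xpredT) V_gt0.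
      by case/andP: (tube_load w tT Gx).
    have MN0 : 0 < M * Nr by exact: lt_le_trans Y1.
    have mxr0 : 0 < (\max_v (x.1 v).+1)%:R :> R by rewrite ltr0n.
    rewrite !powRN lef_pV2 ?posrE ?powR_gt0//.
    by rewrite ge0_ler_powR ?nnegrE ?(ltW s_gt0) ?(ltW mxr0) ?(ltW MN0).
  by move=> w; case/andP: (tube_load w tT Gx).
move: H1 H2 H3 H4; rewrite /eta1.
move: (@pibar V e R a (qstar xi) v) (@pibar V e R a (qstar ((t + h) / Nr)) v) => p1 p2.
move: (@pibar V e R a z v) (stationary_occupation a (load x.1) v) => p3 p4.
move: (averaged a n v x.1 x.2) (\sum_w _) => p5 D.
rewrite !ler_norml => /andP[? ?] /andP[? ?] /andP[? ?] /andP[? ?].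
by apply/andP; split; lra.
Qed.

Local Lemma eta_le_eta1 : eta <= eta1.
Proof.
have LW0 : 0 <= L * W by rewrite mulr_ge0.
have := mulr_ge0 L_ge0 (ltW eta_gt0); have := mulr_ge0 LW0 (ltW eta_gt0).
have := eta_gt0; rewrite /eta1 !mulrDl; lra.
Qed.

Lemma lyapunov_tracking t h x : 0 <= t -> 0 < h -> t + h <= Nr * T ->
  tube delta t x -> total_rate lam * (h / Nr) <= eta ->
  F (t + h) x + h * lyapunov_drift a lam N n c0 (qstar ((t + h) / Nr)) x <=
    (1 + 4 * L * W * (h / Nr)) * F t x + eta1 * error_constant lam L * (h / Nr).
Proof.
move=> t0 h0 thT Gx hsmall.
have tT : 0 <= t <= Nr * T by rewrite t0 (le_trans _ thT)// lerDl ltW.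
have e1 := eta_le_eta1.
have hN0 : 0 <= h / Nr by rewrite divr_ge0 ?(ltW h0) ?(ltW Nr_gt0).
have xB := tube_in tT Gx.
have xi_ex v : exists y, t / Nr <= y <= (t + h) / Nr /\
    qstar ((t + h) / Nr) v - qstar (t / Nr) v =
      h / Nr * (lam v - @pibar V e R a (qstar y) v).
  by have [y y1 y2] := qstar_time t0 h0 thT v; exists y.
(* the mean value theorem gives one intermediate time per vertex *)
have [xi xiP] := choice xi_ex.
have th_itv : 0 <= (t + h) / Nr <= T.
  by apply: time_itv; rewrite thT andbT addr_ge0// ltW.
have xiT v : 0 <= xi v <= T.
  have [/andP[x1 x2] _] := xiP v; have /andP[tN0 _] := time_itv tT.
  by case/andP: th_itv => _ thN; rewrite (le_trans tN0 x1) (le_trans x2 thN).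
have g01 v := pibar_qstar v (xiT v).
have Delta v := proj2 (xiP v).
have Dsmall v : `|qstar ((t + h) / Nr) v - qstar (t / Nr) v| <= eta.
  rewrite Delta normrM ger0_norm//; apply: le_trans hsmall; rewrite mulrC.
  rewrite ler_wpM2r// /total_rate (bigD1 v)//=.
  apply: (@le_trans _ _ (lam v + 1)); last first.
    by rewrite lerDl sumr_ge0// => w _; rewrite addr_ge0 ?(ltW (lam_gt0 w)).
  have /andP[p0 p1] := g01 v; have := lam_gt0 v.
  by move=> l0; rewrite ler_norml; apply/andP; split; lra.
have d1 w : `|deviation N (qstar ((t + h) / Nr)) x.1 w| <= 1.
  have := tube_deviation w Gx; have := Dsmall w.
  have := eta1_le; have := delta_le2; rewrite -/Nr.
  have -> : deviation N (qstar ((t + h) / Nr)) x.1 w =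
    deviation N (qstar (t / Nr)) x.1 w - (qstar ((t + h) / Nr) w - qstar (t / Nr) w).
    by rewrite /deviation; ring.
  move: (deviation _ _ _ _) (_ - _) => z1 z2 H1 H2 H3 H4.
  apply: le_trans (ler_normB _ _) _; lra.
have inc v (y : R) : m * Nr <= y -> n%:R ^+ 2 * k%:R / y <= eta1.
  move=> my; apply: le_trans e1; apply: le_trans n2_eta; rewrite ler_wpM2l//.
  have mN : 0 < m * Nr by rewrite mulr_gt0 ?m_gt0 ?Nr_gt0.
  by rewrite lef_pV2 ?posrE//; exact: lt_le_trans mN my.
case: x Gx xB d1 => q sigma Gx xB d1.
have q_gt0 v : (0 < q v)%N := tube_queue_gt0 v tT Gx.
apply: (lyapunov_one_step (theta := eta1) (g := fun v => @pibar V e R a (qstar (xi v)) v)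
  lam_gt0 N_gt0 h0 L_ge0 _ q_gt0 d1 _ _ Delta g01 _ _ _ _ _ _).
- by have := eta1_le; have := eta_gt0; move: e1 => *; apply/andP; split; lra.
- move=> v w; apply: le_trans (potential_increment a_gt0 n w v q sigma a_le_k) _.
  by apply: inc => //; case/andP: (tube_load v tT Gx).
- move=> v w; rewrite distrC -{1}(arrive_depart (q_gt0 v)).
  apply: le_trans (potential_increment a_gt0 n w v (depart q v) sigma a_le_k) _.
  apply: inc => //; rewrite /load /depart ffunE eqxx /= subn1 prednK//.
  by case/andP: (tube_queue v tT Gx).
- by move=> v; exact: le_trans (Dsmall v) e1.
- move=> v; apply: (averaging_error v t0 h0 thT Gx _ hsmall).
  by case: (xiP v).
- exact: le_trans N_eta e1.
- by [].
- exact: le_trans n_eta e1.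
- by case/andP: (lyapunov_bounds tT xB).
Qed.

(** Bound on the probability of leaving the tube of radius [delta], in units of
[eta]. *)
Definition loss_constant : R := expR (4 * L * W * T) *
  (W + 4 * W * M + 2 * (L + L * W + 2) * error_constant lam L * T) / delta ^+ 2.

Lemma error_constant_gt0 : 0 < error_constant lam L.
Proof.
have W0 : 0 < W by rewrite ltr0n.
have Lam0 : 0 <= total_rate lam.
  by apply: sumr_ge0 => v _; rewrite addr_ge0 ?(ltW (lam_gt0 v)).
rewrite /error_constant -/W ltr_pwDl//; last first.
  by rewrite mulr_ge0// addr_ge0// mulr_ge0// ltW.
by rewrite ltr_wpDl// ?mulr_gt0// !mulr_ge0// ?exprn_ge0// ltW.
Qed.

Lemma stays_in_tube (d : measure_display) (Om : measurableType d) (P : probability Om R)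
    (X : R -> Om -> {ffun V -> nat} * config e) :
  markov_jump_process P (jump_rate e a lam) X -> q0 = qstar 0 ->
  ((fine (P (X 0 @^-1` near_start eta)) - eta * loss_constant)%:E
    <= P (\bigcap_i stays_dyadic X (Nr * T) (tube delta) i))%E.
Proof.
move=> X_markov q0E.
have d20 : 0 < delta ^+ 2 by rewrite exprn_gt0.
have Nr0 := Nr_gt0.
have NT0 : 0 < Nr * T by rewrite mulr_gt0.
have W0 : 0 < W by rewrite ltr0n.
have E0 := error_constant_gt0.
have eta10 : 0 < eta1 := lt_le_trans eta_gt0 eta_le_eta1.
have M0' : 0 <= M by rewrite (le_trans _ M_ge2).
pose kappa := 4 * L * W / Nr.
pose eps := eta1 * error_constant lam L / Nr / delta ^+ 2.
pose phi := (W * eta + 4 * W * M * eta) / delta ^+ 2.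
have -> : eta * loss_constant = expR (kappa * (Nr * T)) * (phi + 2 * eps * (Nr * T)).
  have -> : kappa * (Nr * T) = 4 * L * W * T by rewrite /kappa; field; rewrite gt_eqF.
  rewrite /loss_constant /phi /eps /eta1 mulrCA -!mulrA; congr (_ * _).
  by field; rewrite !gt_eqF.
pose G t x := F t x / delta ^+ 2.
have GB t x : 0 <= t <= Nr * T -> x \in B -> 0 <= G t x <= (W * M ^+ 2 + 2 * c0) / delta ^+ 2.
  move=> tT xB; have /andP[F1 F2] := lyapunov_bounds tT xB.
  apply/andP; split.
    rewrite divr_ge0 ?(ltW d20)//; apply: le_trans F1; apply: sumr_ge0 => v _; exact: sqr_ge0.
  rewrite ler_wpM2r ?invr_ge0 ?(ltW d20)//; apply: le_trans F2 _; rewrite lerD2r.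
  rewrite mulr_natl -sumr_const; apply: ler_sum => v _.
  rewrite -real_normK ?num_real// lerXn2r ?nnegrE//.
  exact: deviation_bound.
apply: (@stays_dyadic_probability_ge R _ _ _ P (jump_rate e a lam) X X_markov
  (jump_rate_ge0 a lam_gt0) (Nr * T) kappa eps phi ((W * M ^+ 2 + 2 * c0) / delta ^+ 2)
  B (tube delta) G (near_start eta)) => //.
- by rewrite /kappa divr_ge0 ?mulr_ge0// ltW.
- by rewrite !divr_gt0// mulr_gt0.
- rewrite divr_ge0 ?(ltW d20)// addr_ge0 ?mulr_ge0 ?(ltW W0) ?(ltW eta_gt0)//.
- exact: states_below_uniq.
- move=> t x tT Gx; split; first exact: tube_in Gx.
  by move=> y; apply: jump_rate_out; exact: tube_contains_jumps Gx.
- move=> t x tT xB nG; rewrite /G ler_pdivlMr// mul1r.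
  have /andP[F1 _] := lyapunov_bounds tT xB; apply: le_trans F1.
  by rewrite leNgt; apply/negP.
- have small : \forall h \near 0^'+, total_rate lam * (h / Nr) <= eta.
    have T1 : 0 < total_rate lam + 1.
      rewrite ltr_wpDl//; apply: sumr_ge0 => v _.
      by rewrite addr_ge0 ?(ltW (lam_gt0 v)).
    near=> h.
    have h0 : 0 < h by near: h; exact: nbhs_right_gt.
    have hle : h <= eta * Nr / (total_rate lam + 1).
      by near: h; apply: nbhs_right_le; rewrite divr_gt0// mulr_gt0.
    apply: (@le_trans _ _ ((total_rate lam + 1) * (h / Nr))).
      by rewrite ler_wpM2r ?divr_ge0 ?(ltW h0) ?(ltW Nr0)// lerDl.
    by rewrite mulrA ler_pdivrMr// mulrC -ler_pdivlMr.
  have pos : \forall h \near 0^'+, (0 : R) < h by exact: nbhs_right_gt.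
  apply: filterS2 pos small => h h0 hs t x t0 thT Gx.
  have tT : 0 <= t <= Nr * T by rewrite t0 (le_trans _ thT)// lerDl ltW.
  have track := lyapunov_tracking t0 h0 thT Gx hs.
  have -> : \sum_(y <- B | y != x) jump_rate e a lam x y * (G (t + h) y - G (t + h) x) =
      lyapunov_drift a lam N n c0 (qstar ((t + h) / Nr)) x / delta ^+ 2.
    transitivity ((\sum_(y <- B | y != x)
        jump_rate e a lam x y * (F (t + h) y - F (t + h) x)) / delta ^+ 2).
      by rewrite mulr_suml; apply: eq_bigr => y _; rewrite /G -mulrBl mulrA.
    have cj := tube_contains_jumps tT Gx.
    case: x cj {Gx track} => q sigma cj; congr (_ / _).
    exact: (jump_generatorE a lam (F (t + h)) (states_below_uniq queue_cap) cj).
  have step_div (A D Z : R) : A / Z + h * (D / Z) = (A + h * D) / Z by ring.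
  rewrite /G step_div.
  have -> : (1 + kappa * h) * (F t x / delta ^+ 2) + eps * h =
    ((1 + 4 * L * W * (h / Nr)) * F t x + eta1 * error_constant lam L * (h / Nr)) / delta ^+ 2.
    by rewrite /kappa /eps; field; rewrite !gt_eqF.
  by rewrite ler_wpM2r ?invr_ge0 ?(ltW d20).
move=> x Ix.
have z0 : 0 <= (0 : R) <= Nr * T by rewrite lexx ltW.
have dev2 : \sum_v deviation N (qstar (0 / N%:R)) x.1 v ^+ 2 <= W * eta.
  rewrite mulr_natl -sumr_const; apply: ler_sum => v _.
  rewrite mul0r -q0E /deviation -real_normK ?num_real//.
  have := Ix v; move: `|_| (normr_ge0 ((x.1 v)%:R / N%:R - q0 v)) => z z0' ze.
  rewrite expr2; apply: le_trans (_ : z * 1 <= _); last by rewrite mulr1.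
  by rewrite ler_wpM2l// (le_trans ze).
have Gx : tube delta 0 x by exact: le_lt_trans eta_delta.
split=> //.
rewrite /G /phi ler_wpM2r ?invr_ge0 ?(ltW d20)//.
have /andP[_ F2] := lyapunov_bounds z0 (tube_in z0 Gx).
apply: le_trans F2 _; apply: lerD => //.
have -> : 2 * c0 = 4 * W * M * (n%:R / Nr) by rewrite /c0 /corrector_cap; ring.
by rewrite ler_wpM2l// !mulr_ge0// ltW.
Unshelve. all: by end_near. Qed.

End Fixed_scale_bound.

(** * The supremum over a time interval *)

Section Norm.
Context {R : realType} {V : finType}.

Lemma norm_inf_leP (x : V -> R) (c : R) : 0 <= c ->
  (norm_inf x <= c) <-> (forall v, `|x v| <= c).
Proof.
move=> c0; split => [/bigmax_leP[_ H] v|H]; first exact: H.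
by apply/bigmax_leP; split => // v _; exact: H.
Qed.

Lemma norm_inf_ge0 (x : V -> R) : 0 <= norm_inf x.
Proof. by rewrite /norm_inf; elim/big_ind: _ => // y z y0 z0; rewrite le_max y0. Qed.

Lemma norm_inf_dist (x y : V -> R) (c : R) : 0 <= c ->
  (forall v, `|x v - y v| <= c) -> norm_inf x <= norm_inf y + c.
Proof.
move=> c0 H; apply/norm_inf_leP; first by rewrite addr_ge0 ?norm_inf_ge0.
move=> v; rewrite -[x v](subrK (y v)) addrC; apply: le_trans (ler_normD _ _) _.
apply: lerD => //; have [E _] := norm_inf_leP y (norm_inf_ge0 y).
exact: E.
Qed.

Lemma norm_inf_sqr (x : V -> R) (c : R) : 0 <= c ->
  \sum_v x v ^+ 2 <= c ^+ 2 -> norm_inf x <= c.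
Proof.
move=> c0 H; apply/norm_inf_leP => // v.
rewrite -ler_sqr ?nnegrE// real_normK ?num_real//; apply: le_trans H.
by rewrite (bigD1 v)//= lerDl sumr_ge0// => w _; exact: sqr_ge0.
Qed.

End Norm.

Section Dyadic_density.
Context {R : realType}.

Lemma near_at_rightP (t : R) (Q : R -> Prop) :
  (\forall s \near t^'+, Q s) <->
  exists2 rho : R, 0 < rho & forall s, t < s -> s < t + rho -> Q s.
Proof.
split=> [|[rho r0 H]].
  rewrite -nbhs_nearE /at_right /within /= => /nbhs_ballP[rho /= r0 Hr].
  exists rho => // s ts sr; apply: Hr => //.
  by rewrite /ball /= distrC gtr0_norm ?subr_gt0// ltrBlDl.
near=> s; apply: H; near: s; [exact: nbhs_right_gt|].
by apply: nbhs_right_lt; rewrite ltrDl.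
Unshelve. all: by end_near. Qed.

Lemma dyadic_right_dense (T t : R) (Q : R -> Prop) : 0 <= t -> t < T ->
  (\forall s \near t^'+, Q s) ->
  exists m i, [/\ (i <= 2 ^ m)%N, t < dyadic T m i & Q (dyadic T m i)].
Proof.
move=> t0 tT Qt; have T0 : 0 < T by exact: le_lt_trans tT.
have [rho rho0 Qrho] := proj1 (near_at_rightP _ _) Qt.
have H : \forall h \near 0^'+, forall s, t < s -> s <= t + h -> Q s /\ s <= T.
  near=> h => s ts sh.
  have h1 : h < rho by near: h; exact: nbhs_right_lt.
  have h2 : h < T - t by near: h; apply: nbhs_right_lt; rewrite subr_gt0.
  by split; [apply: Qrho => //; lra|lra].
have [m _ Hm] := near_dyadic_step T0 H.
have {}Hm := Hm m (leqnn m).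
set h := T / 2 ^+ m in Hm.
have h0 : 0 < h by rewrite divr_gt0 ?exprn_gt0.
pose i := (Num.truncn (t / h)).+1.
have ti : t < i%:R * h by rewrite -ltr_pdivrMr// truncnS_gt.
have it : i%:R * h <= t + h.
  rewrite -natr1 mulrDl mul1r lerD2r -ler_pdivlMr// truncn_le//.
  by rewrite divr_ge0 // ltW.
have [Qi iT] := Hm _ ti it.
exists m, i; split => //.
have : i%:R * h <= (2 ^ m)%:R * h.
  by rewrite natrX mulrC [leRHS]mulrC /h divfK ?expf_neq0// mulrC.
by rewrite ler_pM2r// ler_nat.
Unshelve. all: by end_near. Qed.

End Dyadic_density.

Section Sup_event.
Context {V : finType} {e : rel V} {R : realType}.
Context {d : measure_display} {Om : measurableType d} (P : probability Om R).
Variables (r : {ffun V -> nat} * config e -> {ffun V -> nat} * config e -> R).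
Variables (X : R -> Om -> {ffun V -> nat} * config e).
Hypothesis X_markov : markov_jump_process P r X.
Variables (T : R) (f : R -> V -> R) (N : nat).
Hypothesis T_gt0 : 0 < T.
Hypothesis N_gt0 : (0 < N)%N.
Hypothesis f_cont : forall t v, 0 <= t <= T -> {for t, continuous (f^~ v)}.

Let error t w : R := norm_inf (fun v => scaled_queue X N t w v - f t v).

Definition error_at_most (c t : R) (x : {ffun V -> nat} * config e) : Prop :=
  norm_inf (fun v => (x.1 v)%:R / N%:R - f (t / N%:R) v) <= c.

Definition sup_event (c : R) : set Om :=
  [set w | (c%:E <= ereal_sup [set (error t w)%:E | t in `[0%R, T]%classic])%E].

Let Nr0 : 0 < (N%:R : R). Proof. by rewrite ltr0n. Qed.

Lemma error_right_continuous t w (c : R) : 0 <= t -> t < T -> 0 < c ->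
  \forall s \near t^'+, error t w <= error s w + c.
Proof.
move=> t0 tT c0.
have Xr : \forall s \near t^'+, X (N%:R * s) w = X (N%:R * t) w.
  have := mjp_right X_markov w (mulr_ge0 (ltW Nr0) t0).
  move=> /near_at_rightP[rho r0 Hr]; apply/near_at_rightP.
  exists (rho / N%:R); first by rewrite divr_gt0.
  move=> s ts sr; apply: Hr; first by rewrite ltr_pM2l.
  have -> : N%:R * t + rho = N%:R * (t + rho / N%:R) by field; rewrite gt_eqF.
  by rewrite ltr_pM2l.
have Fr v : \forall s \near t^'+, `|f t v - f s v| <= c.
  have tin : 0 <= t <= T by rewrite t0 ltW.
  have := cvg_at_right_filter (@f_cont t v tin).
  by move=> /cvgrPdist_le /(_ _ c0).
have Fr' : \forall s \near t^'+, forall v, `|f t v - f s v| <= c.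
  by apply: filter_forall.
apply: filterS2 Xr Fr' => s Xs Fs.
apply: norm_inf_dist; first exact: ltW.
move=> v; rewrite /scaled_queue Xs opprB addrC addrA subrK distrC.
exact: Fs.
Qed.

(** By right-continuity of the paths and continuity of [f], dyadic times see the
supremum; the endpoint [T] is itself dyadic. *)
Lemma error_le_dyadic c w :
  (forall t, 0 <= t <= T -> error t w <= c) <->
  (\bigcap_m stays_dyadic X (N%:R * T) (error_at_most c) m) w.
Proof.
have dyE m i : dyadic (N%:R * T) m i = N%:R * dyadic T m i.
  by rewrite /dyadic; ring.
have dyT m i : dyadic (N%:R * T) m i / N%:R = dyadic T m i.
  by rewrite dyE mulrC mulKf// gt_eqF.
split=> [H m _ i im|H].
  rewrite /error_at_most dyT dyE; apply: H; exact: dyadic_itv (ltW T_gt0) im.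
have {}H m i : (i <= 2 ^ m)%N -> error (dyadic T m i) w <= c.
  by move=> im; have := H m I i im; rewrite /error_at_most dyT dyE.
move=> t /andP[t0]; rewrite le_eqVlt => /predU1P[->|tT].
  have := H 0%N 1%N isT; rewrite /dyadic expr0 divr1 mul1r; exact.
rewrite leNgt; apply/negP => ct.
have e0 : 0 < (error t w - c) / 2 by rewrite divr_gt0// subr_gt0.
have [m [i [im _ Q]]] := dyadic_right_dense t0 tT (error_right_continuous w t0 tT e0).
have := H m i im; lra.
Qed.

(** A supremum below [c] is below [c - 1 / n] for some [n]; this exhibits the event
as a countable combination of events at fixed times, hence measurable. *)
Lemma sup_eventE c : 0 < c -> sup_event c =
  ~` \bigcup_n \bigcap_m stays_dyadic X (N%:R * T) (error_at_most (c - n.+1%:R^-1)) m.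
Proof.
move=> c0; apply/seteqP; split => w.
  move=> supc [n _] /error_le_dyadic H.
  have : (ereal_sup [set (error t w)%:E | t in `[0%R, T]%classic] <= (c - n.+1%:R^-1)%:E)%E.
    apply: ge_ereal_sup => _ [t tin <-]; rewrite lee_fin; apply: H.
    by move: tin; rewrite /= in_itv.
  move=> /(le_trans supc); rewrite lee_fin lerBrDr gerDl => n0.
  by have : 0 < n.+1%:R^-1 :> R by []; rewrite ltNge n0.
move=> /= nA; rewrite /sup_event /= leNgt; apply/negP => supc; apply: nA.
have ub t : 0 <= t <= T ->
    ((error t w)%:E <= ereal_sup [set (error t w)%:E | t in `[0%R, T]%classic])%E.
  by move=> tin; apply: ereal_sup_ubound; exists t => //=; rewrite in_itv.
move: supc ub; case: (ereal_sup _) => [z||] supc ub.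
- rewrite lte_fin in supc; have [n Hn] := ltr_add_invr supc.
  exists n => //; apply/error_le_dyadic => t tin.
  by rewrite lerBrDr; apply: le_trans (ltW Hn); rewrite lerD2r -lee_fin; exact: ub.
- by [].
- by have := ub 0; rewrite lexx ltW// => /(_ isT).
Qed.

Lemma measurable_sup_event c : 0 < c -> measurable (sup_event c).
Proof.
move=> c0; rewrite sup_eventE//; apply: measurableC; apply: bigcup_measurable => n _.
apply: bigcap_measurableType => m _.
by apply: (measurable_stays_dyadic X_markov); rewrite mulr_ge0// ltW.
Qed.

Lemma sup_event_le (c : R) (Q : R -> set ({ffun V -> nat} * config e)) (p : R) :
  0 < c -> (forall t x, Q t x -> error_at_most (c / 2) t x) ->
  (p%:E <= P (\bigcap_m stays_dyadic X (N%:R * T) Q m))%E ->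
  fine (P (sup_event c)) <= 1 - p.
Proof.
move=> c0 Qc pP.
have NT : 0 <= N%:R * T by rewrite mulr_ge0// ltW.
have mS := measurable_sup_event c0.
have mQ : measurable (\bigcap_m stays_dyadic X (N%:R * T) Q m).
  by apply: bigcap_measurableType => m _; exact: (measurable_stays_dyadic X_markov).
have sub : sup_event c `<=` ~` (\bigcap_m stays_dyadic X (N%:R * T) Q m).
  rewrite sup_eventE// => w nA HQ; apply: nA.
  have [n Hn] : exists n : nat, c / 2 + n.+1%:R^-1 < c.
    by apply: ltr_add_invr; lra.
  exists n => // m _ i im; apply: le_trans (Qc _ _ (HQ m I i im)) _.
  by rewrite lerBrDr ltW.
have H : (P (sup_event c) <= P (~` (\bigcap_m stays_dyadic X (N%:R * T) Q m)))%E.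
  by apply: le_measure; rewrite ?inE//; exact: measurableC.
rewrite probability_setC// in H.
rewrite -lee_fin fineK ?fin_num_measure//; apply: le_trans H _.
by rewrite EFinB; apply: leeB.
Qed.

End Sup_event.

(** * Convergence *)

Lemma uniform_lipschitz {R : realType} {V : finType} {e : rel V} (a m M : R) :
  0 < a -> 0 < m -> exists2 L : R, 0 <= L & forall v x y,
    box m M x -> box m M y ->
    `|@pibar V e R a x v - @pibar V e R a y v| <= L * dist1 x y.
Proof.
move=> a0 m0.
have H v : exists C : R, 0 <= C /\ forall x y, box m M x -> box m M y ->
    `|@pibar V e R a x v - @pibar V e R a y v| <= C * dist1 x y.
  by have [C C0 [_ CL]] := @pibar_lipschitz R V e a a0 m M v m0; exists C.
have [C CP] := choice H.
exists (\sum_v C v); first by apply: sumr_ge0 => v _; case: (CP v).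
move=> v x y Dx Dy; have [C0 CL] := CP v; apply: le_trans (CL x y Dx Dy) _.
rewrite ler_wpM2r ?dist1_ge0// (bigD1 v)//= lerDl sumr_ge0// => w _.
by case: (CP w).
Qed.

Lemma near_start_probability {R : realType} {V : finType} {e : rel V}
    {d : measure_display} {Om : measurableType d} (P : probability Om R)
    (r : {ffun V -> nat} * config e -> {ffun V -> nat} * config e -> R)
    (X : R -> Om -> {ffun V -> nat} * config e) (N : nat) (q0 : V -> R) (eta : R) :
  markov_jump_process P r X -> 0 < eta ->
  1 - fine (P [set w | eta <= norm_inf (fun v => scaled_queue X N 0 w v - q0 v)])
    <= fine (P (X 0 @^-1` near_start q0 N eta)).
Proof.
move=> X_markov eta0.
have mA : measurable (X 0 @^-1` near_start q0 N eta) by apply: (measurable_state X_markov).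
pose far : set ({ffun V -> nat} * config e) :=
  [set x : {ffun V -> nat} * config e | eta <= norm_inf (fun v => (x.1 v)%:R / N%:R - q0 v)].
have E : [set w | eta <= norm_inf (fun v => scaled_queue X N 0 w v - q0 v)] = X 0 @^-1` far.
  by apply/funext => w; rewrite /scaled_queue mulr0.
rewrite E; have mB : measurable (X 0 @^-1` far) by apply: (measurable_state X_markov).
have H : (P (~` (X 0%R @^-1` far)) <= P (X 0%R @^-1` near_start q0 N eta))%E.
  apply: le_measure; rewrite ?inE//; first exact: measurableC.
  move=> w /= /negP; rewrite -ltNge => /ltW nw v.
  by move/(norm_inf_leP _ (ltW eta0)): nw => /(_ v).
rewrite probability_setC// in H.
by rewrite -lee_fin EFinB !fineK ?fin_num_measure.
Qed.

Unset Implicit Arguments.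

(** On the good scales the process stays in the tube except with probability at most
[eta] times a constant plus the probability of a bad start; [eta] is chosen first
and then [N] is taken large. *)
Theorem theorem2p3 (R : realType) (V : finType) (e : rel V)
  (e_sym : symmetric e) (e_irr : irreflexive e)
  (a : R) (a_gt0 : 0 < a) (lam : V -> R) (lam_gt0 : forall v, 0 < lam v)
  (d : nat -> measure_display) (Om : forall N : nat, measurableType (d N))
  (P : forall N : nat, probability (Om N) R)
  (X : forall N : nat, R -> Om N -> {ffun V -> nat} * config e)
  (X_markov : forall N : nat, (1 <= N)%N ->
     markov_jump_process (P N) (jump_rate e a lam) (X N))
  (beta : R) (beta_gt0 : 0 < beta)
  (gap : exists2 C : R, 0 < C & forall q : {ffun V -> nat},
     ((C * (\max_v (q v).+1)%:R `^ (- (a * beta)))%:E <= spectral_gap e a q)%E)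
  (a_beta : 2 * a * beta < 1)
  (q0 : V -> R) (q0_gt0 : forall v, 0 < q0 v)
  (X_init : forall delta : R, 0 < delta ->
     P N [set w | delta <= norm_inf (fun v => scaled_queue (X N) N 0 w v - q0 v)]
       @[N --> \oo] --> 0%E)
  (qstar : R -> V -> R) (Tmin Text : \bar R)
  (qstar_max : maximal_ode_solution (drift e a lam) q0 Tmin Text qstar) :
  forall T : R, 0 < T -> (T%:E < Text)%E -> forall delta : R, 0 < delta ->
    P N [set w | (delta%:E <= ereal_sup
           [set (norm_inf (fun v => scaled_queue (X N) N t w v - qstar t v))%:E
           | t in `[0%R, T]%classic])%E]
      @[N --> \oo] --> 0%E.
Proof.
move=> T T0 TText delta delta0.
have [sol _] := qstar_max.
have [C C0 gapC] := gap.
have q0E : q0 = qstar 0 by rewrite (ode_init sol).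
(* without vertices the largest load is 0 and the gap bound carries no information *)
have [V0|Vpos] := posnP #|V|.
  have empty_V (v : V) : False by move: (card0_eq V0 v); rewrite inE.
  have -> : (fun N => P N [set w | (delta%:E <= ereal_sup
           [set (norm_inf (fun v => scaled_queue (X N) N t w v - qstar t v))%:E
           | t in `[0%R, T]%classic])%E]) = (fun=> 0%E).
    apply/funext => N; rewrite (_ : [set w | _] = set0) ?measure0//.
    apply/seteqP; split => // w /=; rewrite leNgt => /negP; apply.
    apply: (@le_lt_trans _ _ 0%E); last by rewrite lte_fin.
    apply: ge_ereal_sup => _ [t _ <-]; rewrite lee_fin.
    by apply/norm_inf_leP => // v; case: (empty_V v).
  exact: cvg_cst.
have [m0 [M0 [m0_gt0 M0_ge0 qitv]]] := qstar_bounds sol T0 TText.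
have m_gt0 : 0 < m0 / 2 by rewrite divr_gt0.
have [L L0 lipL] := @uniform_lipschitz R V e a (m0 / 2) (M0 + 2) a_gt0 m_gt0.
have [K K0 conc] := @stationary_concentration R V e a a_gt0 (m0 / 2) (M0 + 2) m_gt0.
pose k := (Num.truncn a).+1.
have ak : a <= k%:R by rewrite ltW// truncnS_gt.
have s_gt0 : 0 < a * beta by rewrite mulr_gt0.
pose dl := Num.min (delta / 2) (Num.min 2^-1 (m0 / 2)).
have dl0 : 0 < dl by rewrite !lt_min m_gt0 andbT; apply/andP; split; rewrite ?divr_gt0 ?invr_gt0.
have dl_half : dl <= 2^-1 by rewrite /dl !ge_min lexx orbT.
have dl_m : dl <= m0 / 2 by rewrite /dl !ge_min lexx !orbT.
have dl_delta : dl <= delta / 2 by rewrite /dl !ge_min lexx.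
pose Z := @loss_constant V R lam T M0 L dl.
pose W : R := #|V|%:R.
apply/fine_cvgP; split.
  near=> N; have N1 : (1 <= N)%N by near: N; exact: nbhs_infty_gt.
  rewrite fin_num_measure//.
  apply: (measurable_sup_event (X_markov N N1) T0 N1 _ delta0) => t v tin.
  exact: (qstar_continuous sol TText).
apply/cvgr0Pnorm_le => eps eps0.
(* each requirement on eta has the form x * eta <= 1; D dominates every such x *)
pose D := 1 + 2 * (L + L * W + 2) + (W + 1) / dl ^+ 2 + 2 * (`|Z| + 1) / eps.
have W0 : 0 <= W by exact: ler0n.
have LW0 : 0 <= L * W by rewrite mulr_ge0.
have D1 : 0 <= 2 * (L + L * W + 2) by lra.
have D2 : 0 <= (W + 1) / dl ^+ 2 by rewrite divr_ge0 ?exprn_ge0 ?(ltW dl0)//; lra.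
have D3 : 0 <= 2 * (`|Z| + 1) / eps.
  by rewrite divr_ge0 ?(ltW eps0)// mulr_ge0// addr_ge0.
have Dpos : 0 < D by rewrite /D; lra.
pose eta := D^-1.
have eta0 : 0 < eta by rewrite invr_gt0.
have etaD x : 0 <= x -> x <= D -> x * eta <= 1.
  by move=> x0 xD; rewrite ler_pdivrMr// mul1r.
have eta1 : eta <= 1 by rewrite -[leLHS]mul1r etaD// /D; lra.
have eta_half : (L + L * W + 2) * eta <= 2^-1.
  have : 2 * (L + L * W + 2) * eta <= 1 by apply: etaD => //; rewrite /D; lra.
  by move=> H; lra.
have eta_dl : W * eta < dl ^+ 2.
  have dl2 : 0 < dl ^+ 2 by rewrite exprn_gt0.
  have : (W + 1) / dl ^+ 2 * eta <= 1 by apply: etaD => //; rewrite /D; lra.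
  rewrite mulrAC ler_pdivrMr// mul1r; apply: lt_le_trans.
  by rewrite ltr_pM2r// ltrDl.
have eta_Z : eta * Z <= eps / 2.
  have : 2 * (`|Z| + 1) / eps * eta <= 1 by apply: etaD => //; rewrite /D; lra.
  rewrite mulrAC ler_pdivrMr// mul1r => H.
  have : eta * Z <= eta * `|Z| by rewrite ler_wpM2l ?ler_norm// ltW.
  by move: H (eta0); lra.
have init : \forall N \near \oo,
    fine (P N [set w | eta <= norm_inf (fun v => scaled_queue (X N) N 0 w v - q0 v)]) <= eps / 2.
  have /fine_cvgP[_ /cvgrPdist_le /(_ (eps / 2))] := X_init eta eta0.
  rewrite divr_gt0// => /(_ isT); apply: filterS => N.
  by rewrite sub0r normrN; apply: le_trans; exact: ler_norm.
pose b := (a * beta + 2^-1) / 2.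
have st_gt0 : 0 < @mixing_step V R by exact: mixing_step_gt0.
have Mpos : 0 < M0 + 2 by rewrite ltr_wpDl.
have win := @near_window R a beta C (@mixing_step V R) (m0 / 2) (M0 + 2) k%:R K
  (#|{: config e}|%:R) (a * W) eta a_gt0 beta_gt0 a_beta C0 st_gt0 m_gt0 Mpos
  (ler0n _ _) K0 (ler0n _ _) eta0.
near=> N.
have N1 : (1 <= N)%N by near: N; exact: nbhs_infty_gt.
have initN : fine (P N [set w | eta <= norm_inf (fun v => scaled_queue (X N) N 0 w v - q0 v)]) <= eps / 2.
  by near: N.
have [w1 w2 w3 w4 w5] : [/\ N%:R^-1 <= eta, (window b N)%:R / N%:R <= eta,
    (window b N)%:R ^+ 2 * k%:R / (m0 / 2 * N%:R) <= eta, K * N%:R `^ (- a) <= eta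
  & expR (- (@mixing_step V R * (C * ((M0 + 2) * N%:R) `^ (- (a * beta))) * (window b N)%:R)) *
      (#|{: config e}|%:R * ((M0 + 2) * N%:R) `^ (a * W)) <= eta ^+ 2].
  by near: N.
have start := near_start_probability N q0 (X_markov N N1) eta0.
have stay := stays_in_tube a_gt0 lam_gt0 sol T0 TText m0_gt0 M0_ge0 qitv L0 lipL conc
  ak C0 s_gt0 gapC Vpos dl0 dl_half dl_m N1 eta0 eta1 eta_half eta_dl w1 w2 w3 w4 w5
  (X_markov N N1) q0E.
have fcont t v : 0 <= t <= T -> {for t, continuous (qstar^~ v)}.
  by move=> tin; exact: (qstar_continuous sol TText).
have := sup_event_le (X_markov N N1) T0 N1 fcont delta0 _ stay.
have tube_error t (x : {ffun V -> nat} * config e) : tube qstar N dl t x -> error_at_most qstar N (delta / 2) t x.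
  move=> H; apply: le_trans dl_delta.
  by apply: norm_inf_sqr; [exact: ltW|exact: ltW].
move=> /(_ tube_error) /= H.
rewrite ger0_norm ?fine_ge0//; apply: le_trans H _.
rewrite -/Z; lra.
Unshelve. all: by end_near. Qed.
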